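(* Let $q\in\mathbb{C}$ with $0<|q|<1$. Let $a_1,a_2,a_3,b_1\in\mathbb{C}^*$ satisfy $a_i/a_j\notin q^{\mathbb{Z}}$ for $i\ne j$ and $b_1\notin\{q^{-n}:n\in\mathbb{Z}_{\ge 0}\}$, and let $\lambda\in\mathbb{C}^*\setminus(-q^{\mathbb{Z}})$. Let ${}_3f_1(a_1,a_2,a_3;b_1;q;\lambda,x):=\left(\mathcal{L}_{q,\lambda}^+\circ\mathcal{B}_q^+\,{}_3\varphi_1(a_1,a_2,a_3;b_1;q,x)\right)(x)$ be the $q$-Borel-Laplace transform of the (in general divergent) series ${}_3\varphi_1(a_1,a_2,a_3;b_1;q,x)$. Then for any $x\in\mathbb{C}^*\setminus[-\lambda;q]$, $$\begin{aligned} {}_3f_1(a_1,a_2,a_3;b_1;q;\lambda,x) &=\frac{(a_2,a_3,b_1/a_1;q)_\infty}{(b_1,a_2/a_1,a_3/a_1;q)_\infty}\frac{\theta_q(a_1\lambda)}{\theta_q(\lambda)}\frac{\theta_q(a_1qx/\lambda)}{\theta_q(qx/\lambda)}\frac{\theta_q(x)}{\theta_q(a_1x)}v_1(x)\\ &+\frac{(a_1,a_3,b_1/a_2;q)_\infty}{(b_1,a_1/a_2,a_3/a_2;q)_\infty}\frac{\theta_q(a_2\lambda)}{\theta_q(\lambda)}\frac{\theta_q(a_2qx/\lambda)}{\theta_q(qx/\lambda)}\frac{\theta_q(x)}{\theta_q(a_2x)}v_2(x)\\ &+\frac{(a_2,a_1,b_1/a_3;q)_\infty}{(b_1,a_2/a_3,a_1/a_3;q)_\infty}\frac{\theta_q(a_3\lambda)}{\theta_q(\lambda)}\frac{\theta_q(a_3qx/\lambda)}{\theta_q(qx/\lambda)}\frac{\theta_q(x)}{\theta_q(a_3x)}v_3(x),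 \end{aligned}$$ where $$\begin{aligned} v_1(x)&=\frac{\theta_q(a_1x)}{\theta_q(x)}\,{}_3\varphi_2\!\left(a_1,\frac{a_1q}{b_1},0;\frac{a_1q}{a_2},\frac{a_1q}{a_3};q,\frac{qb_1}{a_1a_2a_3x}\right),\\ v_2(x)&=\frac{\theta_q(a_2x)}{\theta_q(x)}\,{}_3\varphi_2\!\left(a_2,\frac{a_2q}{b_1},0;\frac{a_2q}{a_1},\frac{a_2q}{a_3};q,\frac{qb_1}{a_1a_2a_3x}\right),\\ v_3(x)&=\frac{\theta_q(a_3x)}{\theta_q(x)}\,{}_3\varphi_2\!\left(a_3,\frac{a_3q}{b_1},0;\frac{a_3q}{a_2},\frac{a_3q}{a_1};q,\frac{qb_1}{a_1a_2a_3x}\right). \end{aligned}$$ Here the series ${}_3\varphi_2$ in $v_j$ are understood through their meromorphic continuation when $|qb_1/(a_1a_2a_3x)|\ge 1$, and the identity is one of meromorphic functions of $x\in\mathbb{C}^*$ (removable singularities of the right-hand side being removed).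
   Context: Notation. $(a;q)_0=1$, $(a;q)_n=(1-a)(1-aq)\cdots(1-aq^{n-1})$ for $n\ge1$, $(a;q)_\infty=\lim_{n\to\infty}(a;q)_n$, and $(c_1,\dots,c_m;q)_n=(c_1;q)_n\cdots(c_m;q)_n$, including $n=\infty$. The basic hypergeometric series is $${}_r\varphi_s(a_1,\dots,a_r;b_1,\dots,b_s;q,x)=\sum_{n\ge0}\frac{(a_1,\dots,a_r;q)_n}{(b_1,\dots,b_s;q)_n(q;q)_n}\left\{(-1)^nq^{n(n-1)/2}\right\}^{1+s-r}x^n.$$ In particular ${}_3\varphi_1(a_1,a_2,a_3;b_1;q,x)=\sum_{n\ge0}\frac{(a_1,a_2,a_3;q)_n}{(b_1;q)_n(q;q)_n}\{(-1)^nq^{n(n-1)/2}\}^{-1}x^n$, regarded as a formal power series. A series ${}_3\varphi_2$ converges for argument of modulus $<1$ and continues meromorphically to $\mathbb{C}$ with poles contained in $\{q^{-n}:n\ge0\}$. The theta function is $\theta_q(x)=\sum_{n\in\mathbb{Z}}q^{n(n-1)/2}x^n$ for $x\in\mathbb{C}^*$; its zeros are exactly the points of $-q^{\mathbb{Z}}$. The spiral is $[\mu;q]=\mu q^{\mathbb{Z}}=\{\mu q^k:k\in\mathbb{Z}\}$. $q$-Borel transformation: for a formal power series $f(x)=\sum_{n\ge0}c_nx^n$, $(\mathcal{B}_q^+f)(\xi)=\sum_{n\ge0}c_nq^{n(n-1)/2}\xi^n$. $q$-Laplace transformation: for $\psi$ analytic near $\xi=0$ (meromorphically continued so as to be defined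 on the spiral $[\lambda;q]$), $$(\mathcal{L}_{q,\lambda}^+\psi)(x)=\sum_{n\in\mathbb{Z}}\frac{\psi(\lambda q^n)}{\theta_q(\lambda q^n/x)}.$$ For $f={}_3\varphi_1(a_1,a_2,a_3;b_1;q,\cdot)$, the $q$-Borel transform is a series convergent for $|\xi|<1$; $\mathcal{L}_{q,\lambda}^+$ is applied to its meromorphic continuation to $\mathbb{C}$, whose poles are contained in $\{-q^{-n}:n\ge0\}$. *)

(* Defs.v *)
(* Stdlib reals and Coquelicot complex numbers. *)
From Stdlib Require Import Reals ZArith List ClassicalEpsilon.
From Coquelicot Require Import Coquelicot.
Export ListNotations.
Open Scope C_scope.

(** ** Limits, series and integer powers in [C]

    Total operators: they return the limit or sum when it exists and an
    unspecified value otherwise. *)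

Definition CLim_seq (u : nat -> C) : C :=
  (real (Lim_seq (fun n => Re (u n))), real (Lim_seq (fun n => Im (u n)))).

Definition CSeries (u : nat -> C) : C :=
  CLim_seq (fun n => sum_n (G := C_AbelianMonoid) u n).

(* The sum over all of Z, as the sum of the two one-sided series. *)
Definition CSeriesZ (u : Z -> C) : C :=
  CSeries (fun n => u (Z.of_nat n)) + CSeries (fun n => u (- Z.of_nat (S n))%Z).

Definition Cpowz (x : C) (k : Z) : C :=
  match k with
  | Z0 => 1
  | Zpos p => x ^ Pos.to_nat p
  | Zneg p => / x ^ Pos.to_nat p
  end.

(** ** q-shifted factorials, basic hypergeometric series, theta function *)

Fixpoint qpoch (a q : C) (n : nat) : C :=
  match n with
  | O => 1
  | S m => qpoch a q m * (1 - a * q ^ m)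
  end.

Definition qpoch_inf (a q : C) : C := CLim_seq (qpoch a q).

Definition Cprod (l : list C) : C := fold_right Cmult 1 l.

Definition qpochs (l : list C) (q : C) (n : nat) : C :=
  Cprod (map (fun a => qpoch a q n) l).

Definition qpochs_inf (l : list C) (q : C) : C :=
  Cprod (map (fun a => qpoch_inf a q) l).

(* q^(n(n-1)/2); the division is exact. *)
Definition qtri (q : C) (n : Z) : C := Cpowz q (n * (n - 1) / 2).

(* A formal power series is represented by its sequence of coefficients; this
   is the series r-phi-s with r = length a and s = length b. *)
Definition phi_coef (a b : list C) (q : C) (n : nat) : C :=
  qpochs a q n / (qpochs b q n * qpoch q q n)
  * Cpowz ((- (1)) ^ n * qtri q (Z.of_nat n))
          (1 + Z.of_nat (length b) - Z.of_nat (length a)).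

Definition theta (q x : C) : C := CSeriesZ (fun n => qtri q n * Cpowz x n).

Definition spiral (mu q x : C) : Prop := exists k : Z, x = mu * Cpowz q k.

(** ** Meromorphic continuation of a power series *)

Definition is_power_sum (c : nat -> C) (z l : C) : Prop :=
  is_series (K := C_AbsRing) (V := C_NormedModule) (fun n => c n * z ^ n) l.

Definition analytic_at (f : C -> C) (z0 : C) : Prop :=
  exists (c : nat -> C) (r : posreal),
    forall z : C, (Cmod (z - z0) < r)%R -> is_power_sum c (z - z0) (f z).

Definition meromorphic_at (f : C -> C) (z0 : C) : Prop :=
  exists (g : C -> C) (k : nat) (r : posreal),
    analytic_at g z0 /\
    forall z : C, z <> z0 -> (Cmod (z - z0) < r)%R -> f z = g z / (z - z0) ^ k.

(* [f] is a meromorphic function on C, with poles contained in [P], whose germ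
   at 0 is the power series with coefficients [c].  The values of [f] on [P]
   are not constrained. *)
Definition is_mero_cont (P : C -> Prop) (c : nat -> C) (f : C -> C) : Prop :=
  (exists r : posreal, forall z : C, (Cmod z < r)%R -> is_power_sum c z (f z)) /\
  (forall z : C, ~ P z -> analytic_at f z) /\
  (forall z : C, P z -> meromorphic_at f z).

(* By the identity theorem the continuation is unique outside [P], so there the
   choice made by [epsilon] is immaterial. *)
Definition mero_cont (P : C -> Prop) (c : nat -> C) : C -> C :=
  epsilon (inhabits (fun _ : C => RtoC 0)) (is_mero_cont P c).

Definition qpoles (q z : C) : Prop := exists n : nat, z = / q ^ n.

(* The sum of the series r-phi-s, continued meromorphically to C with poles in
   { q^(-n) : n >= 0 } (meaningful for r = s + 1). *)
Definition phi (a b : list C) (q : C) : C -> C :=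
  mero_cont (qpoles q) (phi_coef a b q).

(** ** q-Borel and q-Laplace transformations *)

Definition qBorel (q : C) (c : nat -> C) (n : nat) : C :=
  c n * qtri q (Z.of_nat n).

Definition qLaplace (q lam : C) (psi : C -> C) (x : C) : C :=
  CSeriesZ (fun n => psi (lam * Cpowz q n) / theta q (lam * Cpowz q n / x)).

Definition f31 (a1 a2 a3 b1 q lam x : C) : C :=
  qLaplace q lam
    (mero_cont (fun xi => qpoles q (- xi))
       (qBorel q (phi_coef [a1; a2; a3] [b1] q))) x.

(* Main.v *)
Require Import Defs.
From Stdlib Require Import Reals ZArith List Lra Lia ClassicalEpsilon FunctionalExtensionality.
From Coquelicot Require Import Coquelicot.
Open Scope C_scope.

(** Write [psi] for the continued Borel transform, a [3phi2] in [-xi] with one lower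
    parameter equal to 0, and [u = lam / x].  The theta function in the Laplace
    transform is quasi-periodic, so the left-hand side is
    [sum_k psi(lam q^k) q^(k(k-1)/2) u^k / theta_q(u)]: only the values of [psi] on
    the spiral of [lam] matter.

    Those values are given by the connection formula of [psi] between 0 and
    infinity.  For [|xi| < 1] it expresses that the residues of
    [(b1 t, -q t/xi, -xi/t; q)_oo / (a1 t, a2 t, a3 t, 1/t; q)_oo] sum to zero: the
    poles [t = q^n] add up to [theta_q(xi) psi(xi)], and the poles
    [t = q^(-m) / a_j] to the three solutions at infinity.  No contour integral is
    needed: the truncated products are rational functions, for which the statement
    is a partial fraction expansion ([partial_fractions], [residue_sum]), and
    dominated convergence ([tannery]) gives the limit ([connection_disc]).  When
    some [a_j] is [q^(-N)] the poles collide, but then [psi] is a polynomial and the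
    formula is the reversal of its coefficients ([terminating_reverse]).  The thetas
    in product form are turned into series by [jacobi_triple_product].

    Everything outside the discs of convergence comes from q-difference equations.
    The series involved satisfy third-order equations that express [f(z)] by
    [f(q z)], [f(q^2 z)], [f(q^3 z)], with a division by [1 - z] (or [1 + z]); this
    constructs the meromorphic continuation, and [mero_cont_unique], an identity
    theorem along segments, identifies it with the chosen one
    ([qdiff_continuation]).  The same equations carry the connection formula from
    the disc to the whole spiral ([connection_spiral]).

    Inserting that formula in the Laplace sum, the contribution of each solution at
    infinity becomes, after completing a square in the exponents, the product of
    [theta_q(u / a_j)] and the [3phi2] of the theorem ([laplace_solval]).  The
    exchange of summations requires [|z(x)| < 1]; both sides satisfy one more
    q-difference equation in [u], whose leading coefficient vanishes only where
    [z(x) = 1], and it extends the identity to all [x] off the poles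
    ([laplace_identity]).  Finally the exceptional points lie on finitely many
    spirals, hence are isolated, and the left-hand side is continuous, so it is the
    limit of the right-hand side at each of them. *)

(** * Limits and absolutely convergent series *)

Definition Ccv (u : nat -> C) (l : C) : Prop :=
  forall eps : R, (0 < eps)%R ->
    exists N, forall n, (N <= n)%nat -> (Cmod (u n - l) < eps)%R.

Lemma Cmod_minus_sym (x y : C) : Cmod (x - y) = Cmod (y - x).
Proof. rewrite <- Cmod_opp. f_equal. ring. Qed.

Lemma Cmod_triangle_minus (x y : C) : (Cmod (x - y) <= Cmod x + Cmod y)%R.
Proof. unfold Cminus. rewrite <- (Cmod_opp y). apply Cmod_triangle. Qed.

Lemma Cmod_rev_triangle (x y : C) : (Cmod x - Cmod y <= Cmod (x - y))%R.
Proof.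
  pose proof (Cmod_triangle (x - y) y) as H.
  replace (x - y + y) with x in H by ring. lra.
Qed.

Lemma Cmod_small_eq (x y : C) :
  (forall eps, (0 < eps)%R -> (Cmod (x - y) < eps)%R) -> x = y.
Proof.
  intros H. destruct (Req_dec (Cmod (x - y)) 0) as [E|E].
  - apply Cmod_eq_0 in E. replace x with (x - y + y) by ring. rewrite E. ring.
  - pose proof (Cmod_ge_0 (x - y)). specialize (H (Cmod (x - y)) ltac:(lra)). lra.
Qed.

Lemma Ccv_unique u l l' : Ccv u l -> Ccv u l' -> l = l'.
Proof.
  intros H H'. apply Cmod_small_eq. intros eps He.
  destruct (H (eps / 2)%R ltac:(lra)) as [N HN].
  destruct (H' (eps / 2)%R ltac:(lra)) as [N' HN'].
  specialize (HN (N + N')%nat ltac:(lia)). specialize (HN' (N + N')%nat ltac:(lia)).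
  rewrite Cmod_minus_sym in HN.
  pose proof (Cmod_triangle (l - u (N + N')%nat) (u (N + N')%nat - l')) as T.
  replace (l - u (N + N')%nat + (u (N + N')%nat - l')) with (l - l') in T by ring.
  lra.
Qed.

Lemma Ccv_ext_loc u v l N :
  (forall n, (N <= n)%nat -> u n = v n) -> Ccv u l -> Ccv v l.
Proof.
  intros E H eps He. destruct (H eps He) as [N1 H1]. exists (N + N1)%nat.
  intros n Hn. rewrite <- E by lia. apply H1. lia.
Qed.

Lemma Ccv_ext u v l : (forall n, u n = v n) -> Ccv u l -> Ccv v l.
Proof. intros E. apply (Ccv_ext_loc u v l 0). auto. Qed.

Lemma Ccv_const c : Ccv (fun _ => c) c.
Proof.
  intros eps He. exists O. intros n _.
  replace (c - c) with (RtoC 0) by ring. rewrite Cmod_0. exact He.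
Qed.

Lemma Ccv_plus u v l m : Ccv u l -> Ccv v m -> Ccv (fun n => u n + v n) (l + m).
Proof.
  intros H H' eps He.
  destruct (H (eps / 2)%R ltac:(lra)) as [N HN].
  destruct (H' (eps / 2)%R ltac:(lra)) as [N' HN'].
  exists (N + N')%nat. intros n Hn.
  specialize (HN n ltac:(lia)). specialize (HN' n ltac:(lia)).
  replace (u n + v n - (l + m)) with ((u n - l) + (v n - m)) by ring.
  pose proof (Cmod_triangle (u n - l) (v n - m)). lra.
Qed.

Lemma Ccv_bounded u l : Ccv u l -> exists B, (0 < B)%R /\ forall n, (Cmod (u n) <= B)%R.
Proof.
  intros H. destruct (H 1%R ltac:(lra)) as [N HN].
  assert (HB : forall M, exists B, (0 < B)%R /\ forall n, (n < M)%nat -> (Cmod (u n) <= B)%R).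
  { induction M as [|M [B [HB IH]]].
    - exists 1%R. split; [lra|]. intros; lia.
    - exists (B + Cmod (u M))%R. pose proof (Cmod_ge_0 (u M)). split; [lra|].
      intros n Hn. destruct (Nat.eq_dec n M) as [->|]; [lra|].
      specialize (IH n ltac:(lia)). lra. }
  destruct (HB N) as [B [HB0 HB1]]. exists (B + Cmod l + 1)%R.
  pose proof (Cmod_ge_0 l). split; [lra|]. intros n.
  destruct (Nat.lt_ge_cases n N) as [L|L].
  - specialize (HB1 n L). lra.
  - specialize (HN n L). pose proof (Cmod_rev_triangle (u n) l). lra.
Qed.

Lemma Ccv_scal c u l : Ccv u l -> Ccv (fun n => c * u n) (c * l).
Proof.
  intros H eps He. pose proof (Cmod_ge_0 c).
  destruct (H (eps / (Cmod c + 1))%R) as [N HN].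
  { apply Rdiv_lt_0_compat; lra. }
  exists N. intros n Hn. specialize (HN n Hn).
  replace (c * u n - c * l) with (c * (u n - l)) by ring. rewrite Cmod_mult.
  apply Rle_lt_trans with ((Cmod c) * (eps / (Cmod c + 1)))%R.
  - apply Rmult_le_compat_l; lra.
  - replace eps with ((Cmod c + 1) * (eps / (Cmod c + 1)))%R at 2 by (field; lra).
    apply Rmult_lt_compat_r; [apply Rdiv_lt_0_compat|]; lra.
Qed.

Lemma Ccv_mult u v l m : Ccv u l -> Ccv v m -> Ccv (fun n => u n * v n) (l * m).
Proof.
  intros H H'.
  apply Ccv_ext with (fun n => (u n - l) * (v n) + l * v n); [intros; ring|].
  replace (l * m) with (0 + l * m) by ring.
  apply Ccv_plus; [|now apply Ccv_scal].
  destruct (Ccv_bounded _ _ H') as [B [HB0 HB]].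
  intros eps He. destruct (H (eps / B)%R) as [N HN].
  { apply Rdiv_lt_0_compat; lra. }
  exists N. intros n Hn. specialize (HN n Hn).
  replace ((u n - l) * v n - 0) with ((u n - l) * v n) by ring. rewrite Cmod_mult.
  apply Rle_lt_trans with (Cmod (u n - l) * B)%R.
  - apply Rmult_le_compat_l; [apply Cmod_ge_0|apply HB].
  - replace eps with (eps / B * B)%R by (field; lra).
    apply Rmult_lt_compat_r; lra.
Qed.

Lemma Ccv_inv (u : nat -> C) (l : C) : l <> 0 -> Ccv u l -> Ccv (fun n => / u n) (/ l).
Proof.
  intros Hl H eps He. assert (Hl' : (0 < Cmod l)%R) by now apply Cmod_gt_0.
  destruct (H (Cmod l / 2)%R ltac:(lra)) as [N HN].
  destruct (H (eps * (Cmod l * (Cmod l / 2)))%R) as [N' HN'].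
  { apply Rmult_lt_0_compat; [lra|]. apply Rmult_lt_0_compat; lra. }
  exists (N + N')%nat. intros n Hn.
  specialize (HN n ltac:(lia)). specialize (HN' n ltac:(lia)).
  assert (Hu : (Cmod l / 2 < Cmod (u n))%R).
  { rewrite Cmod_minus_sym in HN. pose proof (Cmod_rev_triangle l (u n)). lra. }
  assert (Hu0 : u n <> 0) by (apply Cmod_gt_0; lra).
  replace (/ u n - / l) with ((l - u n) / (u n * l)) by (field; auto).
  rewrite Cmod_div by (apply Cmult_neq_0; auto). rewrite Cmod_mult, Cmod_minus_sym.
  apply Rmult_lt_reg_r with (Cmod (u n) * Cmod l)%R.
  { apply Rmult_lt_0_compat; lra. }
  replace (Cmod (u n - l) / (Cmod (u n) * Cmod l) * (Cmod (u n) * Cmod l))%R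
    with (Cmod (u n - l)) by (field; split; lra).
  apply Rlt_le_trans with (1 := HN').
  apply Rmult_le_compat_l; [lra|].
  rewrite (Rmult_comm (Cmod (u n))). apply Rmult_le_compat_l; lra.
Qed.

Lemma Ccv_div (u v : nat -> C) (l m : C) :
  m <> 0 -> Ccv u l -> Ccv v m -> Ccv (fun n => u n / v n) (l / m).
Proof. intros. apply Ccv_mult; [|apply Ccv_inv]; auto. Qed.

Lemma Ccv_subseq u l (phi : nat -> nat) :
  (forall n, (n <= phi n)%nat) -> Ccv u l -> Ccv (fun n => u (phi n)) l.
Proof.
  intros Hp H eps He. destruct (H eps He) as [N HN]. exists N. intros n Hn.
  apply HN. specialize (Hp n). lia.
Qed.

Lemma Ccv_Cmod_le u l B :
  Ccv u l -> (forall n, (Cmod (u n) <= B)%R) -> (Cmod l <= B)%R.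
Proof.
  intros H HB. apply Rnot_lt_le. intros L.
  destruct (H (Cmod l - B)%R ltac:(lra)) as [N HN].
  specialize (HN N (le_n N)). specialize (HB N).
  rewrite Cmod_minus_sym in HN. pose proof (Cmod_rev_triangle l (u N)). lra.
Qed.

Lemma Ccv_Cmod_ge u l B :
  Ccv u l -> (forall n, (B <= Cmod (u n))%R) -> (B <= Cmod l)%R.
Proof.
  intros H HB. apply Rnot_lt_le. intros L.
  destruct (H (B - Cmod l)%R ltac:(lra)) as [N HN].
  specialize (HN N (le_n N)). specialize (HB N).
  pose proof (Cmod_rev_triangle (u N) l). lra.
Qed.

Lemma Ccv_CLim_seq u l : Ccv u l -> CLim_seq u = l.
Proof.
  intros H. unfold CLim_seq.
  assert (H1 : is_lim_seq (fun n => Re (u n)) (Re l)).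
  { apply is_lim_seq_spec. intros eps. destruct (H eps (cond_pos eps)) as [N HN].
    exists N. intros n Hn. specialize (HN n Hn).
    pose proof (re_le_Cmod (u n - l)) as K.
    replace (Re (u n - l)) with (Re (u n) - Re l)%R in K by reflexivity. lra. }
  assert (H2 : is_lim_seq (fun n => Im (u n)) (Im l)).
  { apply is_lim_seq_spec. intros eps. destruct (H eps (cond_pos eps)) as [N HN].
    exists N. intros n Hn. specialize (HN n Hn).
    pose proof (Rmax_Cmod (u n - l)) as K.
    pose proof (Rmax_r (Rabs (fst (u n - l))) (Rabs (snd (u n - l)))) as K2.
    replace (snd (u n - l)) with (Im (u n) - Im l)%R in K, K2 by reflexivity. lra. }
  rewrite (is_lim_seq_unique _ _ H1), (is_lim_seq_unique _ _ H2).
  simpl. destruct l; reflexivity.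
Qed.

(** * Finite sums *)

Fixpoint csum (f : nat -> C) (n : nat) : C :=
  match n with O => 0 | S m => csum f m + f m end.

Fixpoint rsum (f : nat -> R) (n : nat) : R :=
  match n with O => 0%R | S m => (rsum f m + f m)%R end.

Lemma csum_ext f g n : (forall k, (k < n)%nat -> f k = g k) -> csum f n = csum g n.
Proof.
  induction n as [|n IH]; intros H; simpl; [auto|].
  rewrite IH by (intros; apply H; lia). now rewrite H by lia.
Qed.

Lemma csum_plus f g n : csum (fun k => f k + g k) n = csum f n + csum g n.
Proof. induction n as [|n IH]; simpl; [|rewrite IH]; ring. Qed.

Lemma csum_scal c f n : csum (fun k => c * f k) n = c * csum f n.
Proof. induction n as [|n IH]; simpl; [|rewrite IH]; ring. Qed.

Lemma csum_zero (f : nat -> C) n : (forall k, (k < n)%nat -> f k = 0) -> csum f n = 0.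
Proof.
  induction n as [|n IH]; intros H; simpl; [auto|].
  rewrite IH by (intros; apply H; lia). rewrite H by lia. ring.
Qed.

Lemma csum_app f n m : csum f (n + m) = csum f n + csum (fun k => f (n + k)%nat) m.
Proof.
  induction m as [|m IH]; [rewrite Nat.add_0_r; simpl; ring|].
  rewrite Nat.add_succ_r. simpl. rewrite IH. ring.
Qed.

Lemma csum_S_l f n : csum f (S n) = f O + csum (fun k => f (S k)) n.
Proof. change (S n) with (1 + n)%nat. rewrite csum_app. simpl. ring. Qed.

Lemma csum_rev f n : csum f n = csum (fun k => f (n - 1 - k)%nat) n.
Proof.
  induction n as [|n IH]; [reflexivity|].
  rewrite csum_S_l with (f := fun k => f (S n - 1 - k)%nat). cbn [csum].
  rewrite IH. replace (S n - 1 - 0)%nat with n by lia.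
  rewrite (csum_ext (fun k => f (n - 1 - k)%nat) (fun k => f (S n - 1 - S k)%nat)).
  - ring.
  - intros k Hk. f_equal. lia.
Qed.

Lemma csum_sum_n f n : sum_n (G := C_AbelianMonoid) f n = csum f (S n).
Proof.
  induction n as [|n IH].
  - rewrite sum_O. symmetry. apply Cplus_0_l.
  - rewrite sum_Sn, IH. reflexivity.
Qed.

Lemma rsum_app f n m : rsum f (n + m) = (rsum f n + rsum (fun k => f (n + k)%nat) m)%R.
Proof.
  induction m as [|m IH]; [rewrite Nat.add_0_r; simpl; ring|].
  rewrite Nat.add_succ_r. simpl. rewrite IH. ring.
Qed.

Lemma rsum_le f g n : (forall k, (k < n)%nat -> (f k <= g k)%R) -> (rsum f n <= rsum g n)%R.
Proof.
  induction n as [|n IH]; intros H; simpl; [lra|].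
  apply Rplus_le_compat; [apply IH; intros; apply H; lia|apply H; lia].
Qed.

Lemma rsum_ext f g n : (forall k, (k < n)%nat -> f k = g k) -> rsum f n = rsum g n.
Proof.
  induction n as [|n IH]; intros H; simpl; [auto|].
  rewrite IH by (intros; apply H; lia). now rewrite H by lia.
Qed.

Lemma rsum_scal c f n : rsum (fun k => c * f k)%R n = (c * rsum f n)%R.
Proof. induction n as [|n IH]; simpl; [|rewrite IH]; ring. Qed.

Lemma rsum_nonneg f n : (forall k, (0 <= f k)%R) -> (0 <= rsum f n)%R.
Proof.
  intros H. induction n as [|n IH]; simpl; [lra|]. specialize (H n). lra.
Qed.

Lemma rsum_mono f n m :
  (forall k, (0 <= f k)%R) -> (n <= m)%nat -> (rsum f n <= rsum f m)%R.
Proof.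
  intros H L. replace m with (n + (m - n))%nat by lia. rewrite rsum_app.
  pose proof (rsum_nonneg (fun k => f (n + k)%nat) (m - n) (fun k => H _)). lra.
Qed.

Lemma Cmod_csum_le f n : (Cmod (csum f n) <= rsum (fun k => Cmod (f k)) n)%R.
Proof.
  induction n as [|n IH]; simpl; [rewrite Cmod_0; lra|].
  pose proof (Cmod_triangle (csum f n) (f n)). lra.
Qed.

(** * Summability *)

Definition rsummable (b : nat -> R) : Prop :=
  (forall n, (0 <= b n)%R) /\ exists B, forall n, (rsum b n <= B)%R.

Definition csummable (a : nat -> C) : Prop := rsummable (fun n => Cmod (a n)).

Definition Cser (a : nat -> C) (l : C) : Prop := Ccv (csum a) l.

Lemma rsummable_tail b : rsummable b ->
  forall eps, (0 < eps)%R -> exists N, forall n, (rsum (fun k => b (N + k)%nat) n < eps)%R.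
Proof.
  intros [Hb [B HB]] eps He.
  destruct (completeness (fun x => exists n, x = rsum b n)) as [s [Hs1 Hs2]].
  - exists B. intros x [n ->]. apply HB.
  - exists 0%R. exists O. reflexivity.
  - assert (exists N, (s - eps < rsum b N)%R) as [N HN].
    { apply NNPP. intros K. assert (s <= s - eps)%R; [|lra].
      apply Hs2. intros x [n ->]. apply Rnot_lt_le. intros L. apply K. now exists n. }
    exists N. intros n. pose proof (Hs1 _ (ex_intro _ (N + n)%nat eq_refl)) as K.
    rewrite rsum_app in K. lra.
Qed.

Lemma rsummable_le a b :
  (forall n, (0 <= a n <= b n)%R) -> rsummable b -> rsummable a.
Proof.
  intros H [Hb [B HB]]. split; [intros n; apply H|]. exists B. intros n.
  apply Rle_trans with (2 := HB n). apply rsum_le. intros k _. apply H.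
Qed.

Lemma rsummable_scal c b : (0 <= c)%R -> rsummable b -> rsummable (fun n => c * b n)%R.
Proof.
  intros Hc [Hb [B HB]]. split.
  - intros n. apply Rmult_le_pos; auto.
  - exists (c * B)%R. intros n. rewrite rsum_scal. apply Rmult_le_compat_l; auto.
Qed.

Lemma rsummable_ext a b : (forall n, a n = b n) -> rsummable a -> rsummable b.
Proof.
  intros E [Ha H]. apply rsummable_le with a; [|now split].
  intros n. rewrite <- E. split; [apply Ha|lra].
Qed.

Lemma pow_01 (r : R) n : (0 <= r <= 1)%R -> (0 <= r ^ n <= 1)%R.
Proof.
  intros Hr. split; [apply pow_le; lra|]. rewrite <- (pow1 n). apply pow_incr. lra.
Qed.

Lemma rsum_geom_le r n : (0 <= r < 1)%R -> (rsum (fun k => r ^ k) n <= / (1 - r))%R.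
Proof.
  intros Hr.
  assert (E : (rsum (fun n => r ^ n) n * (1 - r) = 1 - r ^ n)%R).
  { induction n as [|n IH]; simpl; [ring|]. rewrite Rmult_plus_distr_r, IH. ring. }
  apply Rmult_le_reg_r with (1 - r)%R; [lra|]. rewrite E, Rinv_l by lra.
  pose proof (pow_01 r n). lra.
Qed.

Lemma rsummable_geom r : (0 <= r < 1)%R -> rsummable (fun n => r ^ n)%R.
Proof.
  intros Hr. split; [intros; apply pow_le; lra|].
  exists (/ (1 - r))%R. intros n. now apply rsum_geom_le.
Qed.

Lemma rsummable_shift b N : (forall n, (0 <= b n)%R) ->
  rsummable (fun n => b (N + n)%nat) -> rsummable b.
Proof.
  intros Hb [_ [B HB]]. split; auto. exists (rsum b N + B)%R. intros n.
  apply Rle_trans with (rsum b (N + n)); [apply rsum_mono; auto; lia|].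
  rewrite rsum_app. specialize (HB n). lra.
Qed.

Lemma rsummable_ratio b r N : (forall n, (0 <= b n)%R) -> (0 <= r < 1)%R ->
  (forall n, (N <= n)%nat -> (b (S n) <= r * b n)%R) -> rsummable b.
Proof.
  intros Hb Hr H. apply rsummable_shift with N; auto.
  apply rsummable_le with (fun n => b N * r ^ n)%R.
  - intros n. split; auto. induction n as [|n IH].
    + rewrite Nat.add_0_r. simpl. lra.
    + rewrite Nat.add_succ_r. specialize (H (N + n)%nat ltac:(lia)).
      apply Rle_trans with (1 := H). simpl.
      replace (b N * (r * r ^ n))%R with (r * (b N * r ^ n))%R by ring.
      apply Rmult_le_compat_l; lra.
  - apply rsummable_scal; auto. now apply rsummable_geom.
Qed.

Lemma rsummable_tail' b N : rsummable b -> rsummable (fun n => b (N + n)%nat).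
Proof.
  intros [Hb [B HB]]. split; auto. exists B. intros n.
  specialize (HB (N + n)%nat). rewrite rsum_app in HB.
  pose proof (rsum_nonneg b N Hb). lra.
Qed.

Lemma csummable_le a b :
  (forall n, (Cmod (a n) <= b n)%R) -> rsummable b -> csummable a.
Proof.
  intros H. apply rsummable_le. intros n. split; [apply Cmod_ge_0|apply H].
Qed.

Lemma csummable_ext a b : (forall n, a n = b n) -> csummable a -> csummable b.
Proof. intros H. apply rsummable_ext. intros n. now rewrite H. Qed.

Lemma csummable_scal c a : csummable a -> csummable (fun n => c * a n).
Proof.
  intros H. apply rsummable_ext with (fun n => Cmod c * Cmod (a n))%R.
  - intros n. now rewrite Cmod_mult.
  - apply rsummable_scal; auto. apply Cmod_ge_0.
Qed.

Lemma Cser_is_series a l :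
  Cser a l <-> is_series (K := C_AbsRing) (V := C_NormedModule) a l.
Proof.
  split.
  - intros H. apply filterlim_locally. intros eps.
    destruct (H eps (cond_pos eps)) as [N HN]. exists N. intros n Hn.
    apply C_NormedModule_mixin_compat1. rewrite csum_sum_n. apply HN. lia.
  - intros H eps He.
    assert (Hs : (0 < sqrt 2)%R) by (apply sqrt_lt_R0; lra).
    assert (He' : (0 < eps / sqrt 2)%R) by (apply Rdiv_lt_0_compat; lra).
    pose proof (proj1 (filterlim_locally _ _) H (mkposreal _ He')) as [N HN].
    exists (S N). intros n Hn. destruct n as [|n]; [lia|].
    specialize (HN n ltac:(lia)).
    apply C_NormedModule_mixin_compat2 in HN. rewrite csum_sum_n in HN.
    simpl in HN. replace (sqrt 2 * (eps / sqrt 2))%R with eps in HN by (field; lra).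
    exact HN.
Qed.

Lemma Cser_CSeries a l : Cser a l -> CSeries a = l.
Proof.
  intros H. apply Ccv_CLim_seq.
  apply Ccv_ext with (fun n => csum a (S n)); [intros; now rewrite csum_sum_n|].
  apply (Ccv_subseq (csum a) l S); auto.
Qed.

Lemma Cser_unique a l l' : Cser a l -> Cser a l' -> l = l'.
Proof. apply Ccv_unique. Qed.

Lemma Cser_ext a b l : (forall n, a n = b n) -> Cser a l -> Cser b l.
Proof. intros E. apply Ccv_ext. intros n. apply csum_ext. auto. Qed.

Lemma Cser_plus a b l m : Cser a l -> Cser b m -> Cser (fun n => a n + b n) (l + m).
Proof.
  intros H H'. apply Ccv_ext with (fun n => csum a n + csum b n).
  - intros n. now rewrite csum_plus.
  - now apply Ccv_plus.
Qed.

Lemma Cser_scal c a l : Cser a l -> Cser (fun n => c * a n) (c * l).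
Proof.
  intros H. apply Ccv_ext with (fun n => c * csum a n).
  - intros n. now rewrite csum_scal.
  - now apply Ccv_scal.
Qed.

Lemma Cser_zero : Cser (fun _ => 0) 0.
Proof.
  apply Ccv_ext with (fun _ => 0); [|apply Ccv_const].
  intros n. symmetry. now apply csum_zero.
Qed.

Lemma Cser_fin (a : nat -> C) N : (forall n, (N <= n)%nat -> a n = 0) -> Cser a (csum a N).
Proof.
  intros H. apply (Ccv_ext_loc (fun _ => csum a N) _ _ N); [|apply Ccv_const].
  intros n Hn. replace n with (N + (n - N))%nat by lia. rewrite csum_app.
  rewrite (csum_zero (fun k => a (N + k)%nat)); [ring|].
  intros. apply H. lia.
Qed.

Lemma Cser_S a l : Cser (fun n => a (S n)) l -> Cser a (a O + l).
Proof.
  intros H eps He. destruct (H eps He) as [N HN]. exists (S N).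
  intros [|n] Hn; [lia|]. rewrite csum_S_l.
  replace (a O + csum (fun k => a (S k)) n - (a O + l))
    with (csum (fun k => a (S k)) n - l) by ring.
  apply HN. lia.
Qed.

Lemma Cser_S_inv a l : Cser a l -> Cser (fun n => a (S n)) (l - a O).
Proof.
  intros H eps He. destruct (H eps He) as [N HN]. exists N.
  intros n Hn. specialize (HN (S n) ltac:(lia)). rewrite csum_S_l in HN.
  replace (csum (fun k => a (S k)) n - (l - a O))
    with (a O + csum (fun k => a (S k)) n - l) by ring. exact HN.
Qed.

Lemma csummable_Cser a : csummable a -> Cser a (CSeries a).
Proof.
  intros Ha.
  assert (exists l, Cser a l) as [l Hl].
  { destruct (filterlim_locally_cauchy (U := C_CompleteNormedModule) (FF := eventually_filter)
      (fun n => csum a n : C_CompleteNormedModule)) as [K _].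
    destruct K as [l Hl].
    - intros eps. destruct (rsummable_tail _ Ha (eps / 2)%R) as [N HN].
      { pose proof (cond_pos eps). lra. }
      assert (HN' : forall n, (N <= n)%nat -> (Cmod (csum a n - csum a N) < eps / 2)%R).
      { intros n Hn. replace n with (N + (n - N))%nat by lia. rewrite csum_app.
        replace (csum a N + csum (fun k => a (N + k)%nat) (n - N) - csum a N)
          with (csum (fun k => a (N + k)%nat) (n - N)) by ring.
        apply Rle_lt_trans with (1 := Cmod_csum_le _ _). apply HN. }
      exists (fun n => (N <= n)%nat). split; [now exists N|].
      intros u v Hu Hv. apply C_NormedModule_mixin_compat1.
      change (Cmod (csum a v - csum a u) < eps)%R.
      pose proof (HN' u Hu) as A. pose proof (HN' v Hv) as B.
      rewrite Cmod_minus_sym in A.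
      pose proof (Cmod_triangle (csum a v - csum a N) (csum a N - csum a u)) as T.
      replace (csum a v - csum a N + (csum a N - csum a u)) with (csum a v - csum a u) in T by ring.
      lra.
    - exists l. intros eps He.
      assert (Hs : (0 < sqrt 2)%R) by (apply sqrt_lt_R0; lra).
      assert (He' : (0 < eps / sqrt 2)%R) by (apply Rdiv_lt_0_compat; lra).
      pose proof (proj1 (filterlim_locally _ _) Hl (mkposreal _ He')) as [N HN].
      exists N. intros n Hn. specialize (HN n Hn).
      apply C_NormedModule_mixin_compat2 in HN. simpl in HN.
      replace (sqrt 2 * (eps / sqrt 2))%R with eps in HN by (field; lra).
      exact HN. }
  now rewrite (Cser_CSeries _ _ Hl).
Qed.

Lemma CSeries_ext a b : (forall n, a n = b n) -> CSeries a = CSeries b.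
Proof.
  intros E. unfold CSeries, CLim_seq. f_equal; f_equal; apply Lim_seq_ext; intros n;
  rewrite !csum_sum_n; now rewrite (csum_ext a b) by auto.
Qed.

Lemma CSeries_bound a B :
  csummable a -> (forall n, (rsum (fun k => Cmod (a k)) n <= B)%R) ->
  (Cmod (CSeries a) <= B)%R.
Proof.
  intros Ha HB. apply Ccv_Cmod_le with (csum a); [now apply csummable_Cser|].
  intros n. apply Rle_trans with (1 := Cmod_csum_le _ _). apply HB.
Qed.

Lemma rsum_exists_bound b : rsummable b ->
  exists B, (0 < B)%R /\ forall n, (rsum b n <= B)%R.
Proof.
  intros [Hb [B HB]]. exists (Rabs B + 1)%R. split; [pose proof (Rabs_pos B); lra|].
  intros n. specialize (HB n). pose proof (Rle_abs B). lra.
Qed.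

(** * Dominated convergence and exchange of summations *)

(** A common summable majorant makes the tails uniformly small, so termwise
    limits may be summed. *)
Lemma tannery (f : nat -> nat -> C) (g : nat -> C) (b : nat -> R) :
  rsummable b ->
  (forall M i, (Cmod (f M i) <= b i)%R) ->
  (forall i, Ccv (fun M => f M i) (g i)) ->
  Ccv (fun M => CSeries (f M)) (CSeries g).
Proof.
  intros Hb Hf Hg.
  assert (Hgb : forall i, (Cmod (g i) <= b i)%R).
  { intros i. apply Ccv_Cmod_le with (1 := Hg i). auto. }
  assert (tail : forall h N eps, (forall i, (Cmod (h i) <= b i)%R) ->
    (forall n, (rsum (fun k => b (N + k)%nat) n < eps)%R) ->
    (Cmod (CSeries h - csum h N) <= eps)%R).
  { intros h N eps Hh HN.
    assert (Hs : Cser h (CSeries h)).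
    { apply csummable_Cser. now apply csummable_le with b. }
    apply Ccv_Cmod_le with (fun n => csum h (N + n)%nat - csum h N).
    - apply Ccv_plus; [|apply Ccv_const].
      apply (Ccv_subseq (csum h) _ (fun n => (N + n)%nat)); auto. intros; lia.
    - intros n. rewrite csum_app.
      replace (csum h N + csum (fun k => h (N + k)%nat) n - csum h N)
        with (csum (fun k => h (N + k)%nat) n) by ring.
      apply Rle_trans with (1 := Cmod_csum_le _ _). left.
      apply Rle_lt_trans with (2 := HN n). apply rsum_le. auto. }
  intros eps He. destruct (rsummable_tail b Hb (eps / 3)%R ltac:(lra)) as [N HN].
  assert (Hfin : Ccv (fun M => csum (f M) N) (csum g N)).
  { clear HN. induction N as [|N IH]; simpl; [apply Ccv_const|now apply Ccv_plus]. }
  destruct (Hfin (eps / 3)%R ltac:(lra)) as [N1 HN1].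
  exists N1. intros M HM. specialize (HN1 M HM).
  pose proof (tail (f M) N (eps / 3)%R (Hf M) HN) as T1.
  pose proof (tail g N (eps / 3)%R Hgb HN) as T2. rewrite Cmod_minus_sym in T2.
  pose proof (Cmod_triangle (CSeries (f M) - csum (f M) N) (csum (f M) N - csum g N)) as T3.
  pose proof (Cmod_triangle ((CSeries (f M) - csum (f M) N) + (csum (f M) N - csum g N))
                (csum g N - CSeries g)) as T4.
  replace (CSeries (f M) - csum (f M) N + (csum (f M) N - csum g N) + (csum g N - CSeries g))
    with (CSeries (f M) - CSeries g) in T4 by ring.
  lra.
Qed.

(** The form needed for truncations, whose number of terms grows with the
    parameter: the missing terms count as zero. *)
Lemma tannery_fin (f : nat -> nat -> C) (g : nat -> C) (b : nat -> R) (N : nat -> nat) :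
  rsummable b ->
  (forall M i, (i < N M)%nat -> (Cmod (f M i) <= b i)%R) ->
  (forall M, (M <= N M)%nat) ->
  (forall i, Ccv (fun M => f M i) (g i)) ->
  Ccv (fun M => csum (f M) (N M)) (CSeries g).
Proof.
  intros Hb Hf HNM Hg.
  set (f' := fun M i => if (i <? N M)%nat then f M i else 0).
  apply Ccv_ext with (fun M => CSeries (f' M)).
  - intros M. apply Cser_CSeries.
    replace (csum (f M) (N M)) with (csum (f' M) (N M)).
    + apply (Cser_fin (f' M)). intros n Hn. unfold f'.
      destruct (Nat.ltb_spec n (N M)); [lia|auto].
    + apply csum_ext. intros k Hk. unfold f'.
      destruct (Nat.ltb_spec k (N M)); [auto|lia].
  - apply tannery with b; auto.
    + intros M i. unfold f'. destruct (Nat.ltb_spec i (N M)); auto.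
      rewrite Cmod_0. apply Hb.
    + intros i. apply (Ccv_ext_loc (fun M => f M i) _ _ (S i)); auto.
      intros M HM. unfold f'. specialize (HNM M).
      destruct (Nat.ltb_spec i (N M)); [auto|lia].
Qed.

Lemma csum_CSeries_swap (g : nat -> nat -> C) J :
  (forall j, csummable (fun i => g i j)) ->
  csum (fun j => CSeries (fun i => g i j)) J = CSeries (fun i => csum (fun j => g i j) J).
Proof.
  intros H. symmetry. apply Cser_CSeries.
  induction J as [|J IH]; simpl; [apply Cser_zero|].
  apply Cser_plus; auto. now apply csummable_Cser.
Qed.

Lemma rsum_single_le f n k : (forall k, (0 <= f k)%R) -> (k < n)%nat -> (f k <= rsum f n)%R.
Proof.
  intros H L. apply Rle_trans with (rsum f (S k)).
  - simpl. pose proof (rsum_nonneg f k H). lra.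
  - apply rsum_mono; auto.
Qed.

Lemma fubini_col (g : nat -> nat -> C) (m : nat -> R) :
  rsummable m -> (forall i n, (rsum (fun j => Cmod (g i j)) n <= m i)%R) ->
  forall j, csummable (fun i => g i j).
Proof.
  intros Hm Hg j. apply csummable_le with m; auto.
  intros i. apply Rle_trans with (2 := Hg i (S j)).
  apply (rsum_single_le (fun j => Cmod (g i j)) (S j) j); [intros; apply Cmod_ge_0|lia].
Qed.

(** The partial sums over [j] converge dominatedly as functions of [i]. *)
Lemma fubini (g : nat -> nat -> C) (m : nat -> R) :
  rsummable m -> (forall i n, (rsum (fun j => Cmod (g i j)) n <= m i)%R) ->
  Cser (fun j => CSeries (fun i => g i j)) (CSeries (fun i => CSeries (fun j => g i j))).
Proof.
  intros Hm Hg. pose proof (fubini_col g m Hm Hg) as Hc. unfold Cser.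
  apply Ccv_ext with (fun J => CSeries (fun i => csum (fun j => g i j) J)).
  - intros J. symmetry. now apply csum_CSeries_swap.
  - apply tannery with m; auto.
    + intros M i. apply Rle_trans with (1 := Cmod_csum_le _ _). apply Hg.
    + intros i. apply csummable_Cser. split; [intros; apply Cmod_ge_0|].
      exists (m i). apply Hg.
Qed.

(** * Integer powers and q-shifted factorials *)

Lemma Cmod_pos (x : C) : x <> 0 -> (0 < Cmod x)%R.
Proof. apply Cmod_gt_0. Qed.

Lemma Cmod_pos_nz (x : C) : (0 < Cmod x)%R -> x <> 0.
Proof. apply Cmod_gt_0. Qed.

Lemma Cmult_eq0 (x y : C) : x * y = 0 -> x = 0 \/ y = 0.
Proof.
  intros H. destruct (excluded_middle_informative (x = 0)) as [E|E]; auto.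
  right. replace y with (x * y / x) by (field; auto). rewrite H. field. auto.
Qed.

Lemma Cinv_nz (x : C) : x <> 0 -> / x <> 0.
Proof.
  intros H E. apply C1_nz. replace (RtoC 1) with (x * / x) by (field; auto).
  rewrite E. ring.
Qed.

Lemma Cdiv_nz (x y : C) : x <> 0 -> y <> 0 -> x / y <> 0.
Proof. intros. apply Cmult_neq_0; auto using Cinv_nz. Qed.

Lemma Copp_nz (x : C) : x <> 0 -> - x <> 0.
Proof. intros H E. apply H. replace x with (- - x) by ring. rewrite E. ring. Qed.

Lemma Cminus_nz (x y : C) : x <> y -> x - y <> 0.
Proof. intros H E. apply H. replace x with (x - y + y) by ring. rewrite E. ring. Qed.

Lemma Cpowz_nat x n : Cpowz x (Z.of_nat n) = x ^ n.
Proof. destruct n; simpl; [auto|]. now rewrite SuccNat2Pos.id_succ. Qed.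

Lemma Cpowz_neg x n : Cpowz x (- Z.of_nat n) = / x ^ n.
Proof.
  destruct n; simpl; [field|]. now rewrite SuccNat2Pos.id_succ.
Qed.

Lemma Cpowz_nz (x : C) k : x <> 0 -> Cpowz x k <> 0.
Proof.
  intros H. destruct k; simpl; [apply C1_nz| |apply Cinv_nz]; now apply Cpow_nz.
Qed.

Lemma Cpowz_succ (x : C) k : x <> 0 -> Cpowz x (k + 1) = x * Cpowz x k.
Proof.
  intros H. destruct (Z_le_gt_dec 0 k) as [L|L].
  - rewrite <- (Z2Nat.id k) by auto. replace (Z.of_nat (Z.to_nat k) + 1)%Z
      with (Z.of_nat (S (Z.to_nat k))) by lia. now rewrite !Cpowz_nat, Cpow_S.
  - replace k with (- Z.of_nat (S (Z.to_nat (- k - 1))))%Z by lia.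
    replace (- Z.of_nat (S (Z.to_nat (- k - 1))) + 1)%Z
      with (- Z.of_nat (Z.to_nat (- k - 1)))%Z by lia.
    rewrite !Cpowz_neg, Cpow_S. field. split; auto. now apply Cpow_nz.
Qed.

Lemma Cpowz_add (x : C) k l : x <> 0 -> Cpowz x (k + l) = Cpowz x k * Cpowz x l.
Proof.
  intros H. revert l. apply Z.bi_induction.
  - intros ? ? ->. tauto.
  - rewrite Z.add_0_r. simpl. ring.
  - intros l. replace (k + Z.succ l)%Z with (k + l + 1)%Z by lia.
    rewrite <- Z.add_1_r, !Cpowz_succ by auto. split; intros E.
    + rewrite E. ring.
    + replace (Cpowz x (k + l)) with (x * Cpowz x (k + l) / x) by (field; auto).
      rewrite E. field. auto.
Qed.

Lemma Cpowz_opp (x : C) k : x <> 0 -> Cpowz x (- k) = / Cpowz x k.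
Proof.
  intros H. assert (E : Cpowz x (- k) * Cpowz x k = 1).
  { rewrite <- Cpowz_add by auto. now replace (- k + k)%Z with 0%Z by ring. }
  replace (Cpowz x (- k)) with (Cpowz x (- k) * Cpowz x k / Cpowz x k).
  - rewrite E. field. now apply Cpowz_nz.
  - field. now apply Cpowz_nz.
Qed.

Lemma Cpowz_mult_l (x y : C) k : x <> 0 -> y <> 0 ->
  Cpowz (x * y) k = Cpowz x k * Cpowz y k.
Proof.
  intros Hx Hy. destruct k; simpl; [ring| |]; rewrite Cpow_mult_l; [auto|].
  field. split; now apply Cpow_nz.
Qed.

Lemma Cpowz_inv (x : C) k : x <> 0 -> Cpowz (/ x) k = / Cpowz x k.
Proof.
  intros H. assert (E : Cpowz (/ x) k * Cpowz x k = 1).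
  { rewrite <- Cpowz_mult_l by auto using Cinv_nz.
    replace (/ x * x) with (RtoC 1) by (field; auto).
    destruct k; simpl; rewrite ?Cpow_1_l; try field; auto. }
  replace (Cpowz (/ x) k) with (Cpowz (/ x) k * Cpowz x k / Cpowz x k).
  - rewrite E. field. now apply Cpowz_nz.
  - field. now apply Cpowz_nz.
Qed.

Lemma Cpowz_mul (x : C) k l : x <> 0 -> Cpowz x (k * l) = Cpowz (Cpowz x k) l.
Proof.
  intros H. revert l. apply Z.bi_induction.
  - intros ? ? ->. tauto.
  - rewrite Z.mul_0_r. reflexivity.
  - intros l. rewrite Z.mul_succ_r, <- Z.add_1_r, Cpowz_succ by now apply Cpowz_nz.
    rewrite Cpowz_add by auto. pose proof (Cpowz_nz x k H). split; intros E.
    + rewrite E. ring.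
    + replace (Cpowz x (k * l)) with (Cpowz x (k * l) * Cpowz x k / Cpowz x k) by (field; auto).
      rewrite E. field. auto.
Qed.

(** The Gaussian factor [q^(n(n-1)/2)]. *)
Fixpoint tri (q : C) (n : nat) : C :=
  match n with O => 1 | S m => tri q m * q ^ m end.

Lemma tri_nz (q : C) n : q <> 0 -> tri q n <> 0.
Proof.
  intros H. induction n; simpl; [apply C1_nz|]. apply Cmult_neq_0; auto.
  now apply Cpow_nz.
Qed.

Lemma div2_succ k : ((k + 1) * (k + 1 - 1) / 2 = k * (k - 1) / 2 + k)%Z.
Proof.
  replace ((k + 1) * (k + 1 - 1))%Z with (k * (k - 1) + k * 2)%Z by ring.
  now rewrite Z.div_add.
Qed.

Lemma qtri_succ (q : C) k : q <> 0 -> qtri q (k + 1) = qtri q k * Cpowz q k.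
Proof. intros H. unfold qtri. now rewrite div2_succ, Cpowz_add. Qed.

Lemma qtri_nat (q : C) n : q <> 0 -> qtri q (Z.of_nat n) = tri q n.
Proof.
  intros H. induction n as [|n IH]; [reflexivity|].
  replace (Z.of_nat (S n)) with (Z.of_nat n + 1)%Z by lia.
  rewrite qtri_succ, IH, Cpowz_nat by auto. reflexivity.
Qed.

Lemma qtri_neg (q : C) k : qtri q (- k) = qtri q (k + 1).
Proof. unfold qtri. f_equal. f_equal. ring. Qed.

Lemma qtri_negS (q : C) n : q <> 0 -> qtri q (- Z.of_nat (S n)) = tri q (S (S n)).
Proof.
  intros H. rewrite qtri_neg. replace (Z.of_nat (S n) + 1)%Z with (Z.of_nat (S (S n))) by lia.
  now apply qtri_nat.
Qed.

Lemma qtri_add (q : C) k l : q <> 0 ->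
  qtri q (k + l) = qtri q k * qtri q l * Cpowz q (k * l).
Proof.
  intros H. revert l. apply Z.bi_induction.
  - intros ? ? ->. tauto.
  - rewrite Z.add_0_r, Z.mul_0_r. unfold qtri at 3. simpl. ring.
  - intros l. replace (k + Z.succ l)%Z with (k + l + 1)%Z by lia.
    rewrite <- Z.add_1_r, !qtri_succ by auto.
    replace (k * (l + 1))%Z with (k * l + k)%Z by ring. rewrite !Cpowz_add by auto.
    pose proof (Cpowz_nz q k H). pose proof (Cpowz_nz q l H). split; intros E.
    + rewrite E. ring.
    + replace (qtri q (k + l)) with
        (qtri q (k + l) * (Cpowz q k * Cpowz q l) / (Cpowz q k * Cpowz q l)) by (field; auto).
      rewrite E. field. auto.
Qed.

Lemma qtri_nz (q : C) k : q <> 0 -> qtri q k <> 0.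
Proof. apply Cpowz_nz. Qed.

Lemma q_nz (q : C) : (0 < Cmod q < 1)%R -> q <> 0.
Proof. intros H. apply Cmod_pos_nz. lra. Qed.

Lemma qpow_neq1 (q : C) n : (0 < Cmod q < 1)%R -> (0 < n)%nat -> q ^ n <> 1.
Proof.
  intros H Hn E. assert (K : Cmod (q ^ n) = 1%R) by (rewrite E; apply Cmod_1).
  rewrite Cmod_pow in K.
  assert (Cmod q ^ n < 1)%R; [|lra]. destruct n; [lia|]. simpl.
  assert (Cmod q ^ n <= 1)%R.
  { rewrite <- (pow1 n). apply pow_incr. lra. }
  assert (0 < Cmod q ^ n)%R by (apply pow_lt; lra). nra.
Qed.

Lemma pow_small (r e : R) : (0 <= r < 1)%R -> (0 < e)%R ->
  exists N, forall n, (N <= n)%nat -> (r ^ n < e)%R.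
Proof.
  intros Hr He. destruct (pow_lt_1_zero r) with (y := e) as [N HN]; auto.
  - rewrite Rabs_pos_eq; lra.
  - exists N. intros n Hn. specialize (HN n Hn). rewrite Rabs_pos_eq in HN; auto.
    apply pow_le. lra.
Qed.

Lemma qpoch_add a q n m : qpoch a q (n + m) = qpoch a q n * qpoch (a * q ^ n) q m.
Proof.
  induction m as [|m IH]; [rewrite Nat.add_0_r; simpl; ring|].
  rewrite Nat.add_succ_r. simpl. rewrite IH, Cpow_add_r. ring.
Qed.

Lemma qpoch_S_l a q n : qpoch a q (S n) = (1 - a) * qpoch (a * q) q n.
Proof.
  change (S n) with (1 + n)%nat. rewrite qpoch_add. simpl.
  replace (a * (q * 1)) with (a * q) by ring. ring.
Qed.

Lemma qpoch_0 q n : qpoch 0 q n = 1.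
Proof. induction n as [|n IH]; simpl; [auto|]. rewrite IH. ring. Qed.

Lemma qpoch_nz (a q : C) n :
  (forall k, (k < n)%nat -> a * q ^ k <> 1) -> qpoch a q n <> 0.
Proof.
  induction n as [|n IH]; intros H; simpl; [apply C1_nz|].
  apply Cmult_neq_0; [apply IH; intros; apply H; lia|].
  intros E. apply (H n (le_n _)). replace (a * q ^ n) with (1 - (1 - a * q ^ n)) by ring.
  rewrite E. ring.
Qed.

Lemma qpoch_bound q A : (Cmod q < 1)%R ->
  exists B, (0 < B)%R /\ forall a n, (Cmod a <= A)%R -> (Cmod (qpoch a q n) <= B)%R.
Proof.
  intros Hq. exists (exp (A * / (1 - Cmod q))). split; [apply exp_pos|].
  intros a n Ha. assert (HA : (0 <= A)%R) by (pose proof (Cmod_ge_0 a); lra).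
  pose proof (Cmod_ge_0 q) as Hq0.
  apply Rle_trans with (exp (A * rsum (fun k => Cmod q ^ k)%R n)).
  - induction n as [|n IH]; simpl.
    + rewrite Cmod_1, Rmult_0_r, exp_0. lra.
    + rewrite Cmod_mult, Rmult_plus_distr_l, exp_plus.
      apply Rmult_le_compat; auto using Cmod_ge_0.
      apply Rle_trans with (1 + A * Cmod q ^ n)%R; [|apply exp_ineq1_le].
      apply Rle_trans with (1 := Cmod_triangle_minus _ _).
      rewrite Cmod_1, Cmod_mult, Cmod_pow.
      apply Rplus_le_compat_l, Rmult_le_compat_r; auto. now apply pow_le.
  - assert (L : (A * rsum (fun k => Cmod q ^ k)%R n <= A * / (1 - Cmod q))%R).
    { apply Rmult_le_compat_l; auto. apply rsum_geom_le. lra. }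
    destruct L as [L| ->]; [left; now apply exp_increasing|right; reflexivity].
Qed.

Lemma qpoch_telescope a q n :
  qpoch a q n = 1 + csum (fun k => - a * (qpoch a q k * q ^ k)) n.
Proof. induction n as [|n IH]; simpl; [ring|].
  transitivity (qpoch a q n + - a * (qpoch a q n * q ^ n)); [ring|].
  rewrite IH at 1. ring.
Qed.

(** The partial products telescope into an absolutely convergent series. *)
Lemma qpoch_cv a q : (Cmod q < 1)%R -> Ccv (qpoch a q) (qpoch_inf a q).
Proof.
  intros Hq.
  assert (exists l, Ccv (qpoch a q) l) as [l Hl].
  { exists (1 + CSeries (fun k => - a * (qpoch a q k * q ^ k))).
    apply Ccv_ext with (fun n => 1 + csum (fun k => - a * (qpoch a q k * q ^ k)) n).
    - intros n. now rewrite <- qpoch_telescope.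
    - apply Ccv_plus; [apply Ccv_const|]. apply csummable_Cser. apply csummable_scal.
      destruct (qpoch_bound q (Cmod a) Hq) as [B [HB0 HB]].
      apply csummable_le with (fun n => B * Cmod q ^ n)%R.
      + intros n. rewrite Cmod_mult, Cmod_pow. apply Rmult_le_compat_r.
        * apply pow_le, Cmod_ge_0.
        * apply HB. lra.
      + apply rsummable_scal; [lra|]. apply rsummable_geom. split; auto using Cmod_ge_0. }
  unfold qpoch_inf. now rewrite (Ccv_CLim_seq _ _ Hl).
Qed.

Lemma qpoch_inf_split a q n : (Cmod q < 1)%R ->
  qpoch_inf a q = qpoch a q n * qpoch_inf (a * q ^ n) q.
Proof.
  intros Hq. apply (Ccv_unique (fun m => qpoch a q (n + m))).
  - apply (Ccv_subseq (qpoch a q) _ (fun m => (n + m)%nat)); [lia|now apply qpoch_cv].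
  - apply Ccv_ext with (fun m => qpoch a q n * qpoch (a * q ^ n) q m).
    + intros m. now rewrite qpoch_add.
    + apply Ccv_scal. now apply qpoch_cv.
Qed.

Lemma qpoch_inf_zero (a q : C) n : (Cmod q < 1)%R -> a * q ^ n = 1 -> qpoch_inf a q = 0.
Proof.
  intros Hq H. rewrite (qpoch_inf_split a q (S n)) by auto. simpl. rewrite H. ring.
Qed.

(** By [(1 - s)(1 - t) >= 1 - s - t], the product is at least
    [1 - sum_k |a q^k|]. *)
Lemma qpoch_ge_half a q n : (Cmod q < 1)%R -> (Cmod a * / (1 - Cmod q) <= 1 / 2)%R ->
  (1 / 2 <= Cmod (qpoch a q n))%R.
Proof.
  intros Hq Ha. pose proof (Cmod_ge_0 q) as Hq0. pose proof (Cmod_ge_0 a) as Ha0.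
  assert (S0 : forall m, (0 <= Cmod a * rsum (fun k => Cmod q ^ k) m <= 1 / 2)%R).
  { intros m. split.
    - apply Rmult_le_pos; auto. apply rsum_nonneg. intros. now apply pow_le.
    - apply Rle_trans with (2 := Ha). apply Rmult_le_compat_l; auto.
      apply rsum_geom_le. lra. }
  apply Rle_trans with (1 - Cmod a * rsum (fun k => Cmod q ^ k) n)%R.
  { specialize (S0 n). lra. }
  induction n as [|n IH]; simpl; [rewrite Cmod_1; lra|].
  rewrite Cmod_mult. pose proof (S0 n) as H1. pose proof (S0 (S n)) as H2. simpl in H2.
  pose proof (Cmod_rev_triangle 1 (a * q ^ n)) as H3.
  rewrite Cmod_1, Cmod_mult, Cmod_pow in H3.
  assert (H4 : (0 <= Cmod a * Cmod q ^ n)%R) by (apply Rmult_le_pos; auto; now apply pow_le).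
  set (s := (Cmod a * rsum (fun k => Cmod q ^ k) n)%R) in *.
  set (t := (Cmod a * Cmod q ^ n)%R) in *.
  rewrite Rmult_plus_distr_l in *. fold s t in H2. fold s t.
  apply Rle_trans with ((1 - s) * (1 - t))%R; [nra|].
  apply Rmult_le_compat; lra.
Qed.

(** After finitely many nonzero factors the base [a q^N] is small enough for
    [qpoch_ge_half]. *)
Lemma qpoch_inf_nz (a q : C) : (Cmod q < 1)%R ->
  (forall n, a * q ^ n <> 1) -> qpoch_inf a q <> 0.
Proof.
  intros Hq H. pose proof (Cmod_ge_0 q) as Hq0. pose proof (Cmod_ge_0 a) as Ha0.
  destruct (pow_small (Cmod q) ((1 - Cmod q) / (2 * (Cmod a + 1)))) as [N HN]; [lra| |].
  { apply Rdiv_lt_0_compat; lra. }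
  specialize (HN N (le_n N)).
  rewrite (qpoch_inf_split a q N) by auto.
  apply Cmult_neq_0; [apply qpoch_nz; auto|].
  apply Cmod_pos_nz. apply Rlt_le_trans with (1 / 2)%R; [lra|].
  apply Ccv_Cmod_ge with (qpoch (a * q ^ N) q); [now apply qpoch_cv|].
  intros n. apply qpoch_ge_half; auto. rewrite Cmod_mult, Cmod_pow.
  apply Rmult_le_reg_r with (1 - Cmod q)%R; [lra|].
  rewrite Rmult_assoc, Rinv_l, Rmult_1_r by lra.
  apply Rle_trans with (Cmod a * ((1 - Cmod q) / (2 * (Cmod a + 1))))%R.
  - apply Rmult_le_compat_l; lra.
  - replace (Cmod a * ((1 - Cmod q) / (2 * (Cmod a + 1))))%R
      with (1 / 2 * (1 - Cmod q) * (Cmod a / (Cmod a + 1)))%R by (field; lra).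
    rewrite <- (Rmult_1_r (1 / 2 * (1 - Cmod q))) at 2.
    apply Rmult_le_compat_l; [lra|].
    apply Rmult_le_reg_r with (Cmod a + 1)%R; [lra|].
    replace (Cmod a / (Cmod a + 1) * (Cmod a + 1))%R with (Cmod a) by (field; lra). lra.
Qed.

Lemma qpoch_inv_bound (a q : C) : (Cmod q < 1)%R -> (forall n, a * q ^ n <> 1) ->
  exists B, (0 < B)%R /\ forall n, (Cmod (/ qpoch a q n) <= B)%R.
Proof.
  intros Hq H. apply (Ccv_bounded _ (/ qpoch_inf a q)).
  apply Ccv_inv; [now apply qpoch_inf_nz|now apply qpoch_cv].
Qed.

(** The shifted product is a quotient of two unshifted ones, so that the bound
    does not depend on the shift. *)
Lemma qpoch_shift_inv_bound (a q : C) : (Cmod q < 1)%R -> (forall n, a * q ^ n <> 1) ->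
  exists B, (0 < B)%R /\ forall n M, (Cmod (/ qpoch (a * q ^ n) q M) <= B)%R.
Proof.
  intros Hq H. destruct (qpoch_inv_bound a q Hq H) as [B [HB0 HB]].
  destruct (qpoch_bound q (Cmod a) Hq) as [B' [HB0' HB']].
  exists (B' * B)%R. split; [now apply Rmult_lt_0_compat|]. intros n M.
  replace (/ qpoch (a * q ^ n) q M) with (qpoch a q n * / qpoch a q (n + M)).
  - rewrite Cmod_mult. apply Rmult_le_compat; auto using Cmod_ge_0. apply HB'. lra.
  - rewrite qpoch_add. field. split.
    + apply qpoch_nz. intros k _. rewrite <- Cmult_assoc, <- Cpow_add_r. apply H.
    + apply qpoch_nz. auto.
Qed.

Lemma qpoch_shift_bound a q : (Cmod q < 1)%R ->
  exists B, (0 < B)%R /\ forall n M, (Cmod (qpoch (a * q ^ n) q M) <= B)%R.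
Proof.
  intros Hq. destruct (qpoch_bound q (Cmod a) Hq) as [B [HB0 HB]].
  exists B. split; auto. intros n M. apply HB. rewrite Cmod_mult, Cmod_pow.
  rewrite <- (Rmult_1_r (Cmod a)) at 2. apply Rmult_le_compat_l; [apply Cmod_ge_0|].
  rewrite <- (pow1 n). apply pow_incr. split; [apply Cmod_ge_0|lra].
Qed.

Lemma qq_nz (q : C) : (0 < Cmod q < 1)%R -> forall n, q * q ^ n <> 1.
Proof. intros H n. rewrite <- Cpow_S. apply qpow_neq1; auto. lia. Qed.

(** Each factor [1 - b q^(-k)] equals [-b q^(-k) (1 - q^k / b)]; the powers of
    [q] pulled out form a Gaussian factor in the denominator. *)
Lemma qpoch_reverse (b q : C) m : q <> 0 -> b <> 0 ->
  qpoch (b / q ^ m) q m = (- b) ^ m * qpoch (q / b) q m / tri q (S m).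
Proof.
  intros Hq Hb. induction m as [|m IH]; [simpl; field|].
  assert (Hm : q ^ m <> 0) by now apply Cpow_nz.
  rewrite qpoch_S_l. replace (b / q ^ S m * q) with (b / q ^ m).
  - rewrite IH. change (tri q (S (S m))) with (tri q (S m) * q ^ S m).
    change (qpoch (q / b) q (S m)) with (qpoch (q / b) q m * (1 - q / b * q ^ m)).
    rewrite !Cpow_S. field. repeat split; auto. now apply (tri_nz q (S m)).
  - rewrite Cpow_S. field. auto.
Qed.

Lemma qpoch_reverse_add (b q : C) m n : q <> 0 -> b <> 0 ->
  qpoch (b / q ^ m) q (m + n) = (- b) ^ m * qpoch (q / b) q m / tri q (S m) * qpoch b q n.
Proof.
  intros Hq Hb. rewrite qpoch_add, qpoch_reverse by auto. f_equal. f_equal.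
  field. now apply Cpow_nz.
Qed.

Lemma qpoch_reverse_1 (q : C) m : q <> 0 ->
  qpoch (/ q ^ m) q m = (- (1)) ^ m * qpoch q q m / tri q (S m).
Proof.
  intros H. pose proof (qpoch_reverse 1 q m H C1_nz) as E.
  replace (1 / q ^ m) with (/ q ^ m) in E by (unfold Cdiv; ring).
  replace (q / 1) with q in E by field. exact E.
Qed.

(** * Bilateral series *)

(** The two halves converge separately, as in [CSeriesZ]; this is stronger than
    convergence of symmetric partial sums and makes index shifts harmless. *)
Definition Zser (u : Z -> C) (l : C) : Prop :=
  exists l1 l2, Cser (fun n => u (Z.of_nat n)) l1 /\
    Cser (fun n => u (- Z.of_nat (S n))%Z) l2 /\ l = l1 + l2.

Definition Zsummable (u : Z -> C) : Prop :=
  csummable (fun n => u (Z.of_nat n)) /\ csummable (fun n => u (- Z.of_nat (S n))%Z).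

Lemma Zser_CSeriesZ u l : Zser u l -> CSeriesZ u = l.
Proof.
  intros (l1 & l2 & H1 & H2 & ->). unfold CSeriesZ.
  now rewrite (Cser_CSeries _ _ H1), (Cser_CSeries _ _ H2).
Qed.

Lemma Zsummable_Zser u : Zsummable u -> Zser u (CSeriesZ u).
Proof.
  intros [H1 H2]. exists (CSeries (fun n => u (Z.of_nat n))),
    (CSeries (fun n => u (- Z.of_nat (S n))%Z)).
  repeat split; now apply csummable_Cser.
Qed.

Lemma Zser_unique u l l' : Zser u l -> Zser u l' -> l = l'.
Proof. intros H H'. rewrite <- (Zser_CSeriesZ _ _ H). now apply Zser_CSeriesZ. Qed.

Lemma Zser_ext u v l : (forall k, u k = v k) -> Zser u l -> Zser v l.
Proof.
  intros E (l1 & l2 & H1 & H2 & ->). exists l1, l2.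
  split; [|split; auto]; [revert H1|revert H2]; apply Cser_ext; intros; apply E.
Qed.

Lemma CSeriesZ_ext u v : (forall k, u k = v k) -> CSeriesZ u = CSeriesZ v.
Proof. intros E. unfold CSeriesZ. f_equal; apply CSeries_ext; intros; apply E. Qed.

Lemma Zser_plus u v l m : Zser u l -> Zser v m -> Zser (fun k => u k + v k) (l + m).
Proof.
  intros (l1 & l2 & H1 & H2 & ->) (m1 & m2 & K1 & K2 & ->).
  exists (l1 + m1), (l2 + m2).
  split; [now apply (Cser_plus (fun n => u (Z.of_nat n)) (fun n => v (Z.of_nat n)))|].
  split; [now apply (Cser_plus (fun n => u (- Z.of_nat (S n))%Z)
                      (fun n => v (- Z.of_nat (S n))%Z))|ring].
Qed.

Lemma Zser_scal c u l : Zser u l -> Zser (fun k => c * u k) (c * l).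
Proof.
  intros (l1 & l2 & H1 & H2 & ->). exists (c * l1), (c * l2).
  split; [now apply (Cser_scal c (fun n => u (Z.of_nat n)))|].
  split; [now apply (Cser_scal c (fun n => u (- Z.of_nat (S n))%Z))|ring].
Qed.

Lemma Zser_zero : Zser (fun _ => 0) 0.
Proof. exists (RtoC 0), (RtoC 0). repeat split; try apply Cser_zero. now rewrite Cplus_0_l. Qed.

Lemma Zser_succ u l : Zser u l -> Zser (fun k => u (k + 1)%Z) l.
Proof.
  intros (l1 & l2 & H1 & H2 & ->). exists (l1 - u 0%Z), (u 0%Z + l2).
  split; [|split; [|ring]].
  - apply Cser_S_inv in H1. revert H1. apply Cser_ext. intros n. f_equal; lia.
  - apply (Cser_S (fun n => u (- Z.of_nat n)%Z)) in H2. revert H2.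
    apply Cser_ext. intros n. f_equal; lia.
Qed.

Lemma Zser_pred u l : Zser u l -> Zser (fun k => u (k - 1)%Z) l.
Proof.
  intros (l1 & l2 & H1 & H2 & ->). exists (u (-1)%Z + l1), (l2 - u (-1)%Z).
  split; [|split; [|ring]].
  - apply (Cser_ext (fun n => u (Z.of_nat n - 1)%Z)); [auto|].
    apply (Cser_S (fun n => u (Z.of_nat n - 1)%Z)). revert H1.
    apply Cser_ext. intros n. f_equal; lia.
  - apply Cser_S_inv in H2. revert H2. apply Cser_ext. intros n. f_equal; lia.
Qed.

Lemma Zser_shift u l m : Zser u l -> Zser (fun k => u (k + m)%Z) l.
Proof.
  intros H. revert m. apply Z.bi_induction.
  - intros ? ? ->. tauto.
  - revert H. apply Zser_ext. intros k; f_equal; ring.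
  - intros m. split; intros K.
    + apply Zser_succ in K. revert K. apply Zser_ext. intros k; f_equal; ring.
    + apply Zser_pred in K. revert K. apply Zser_ext. intros k; f_equal; ring.
Qed.

Lemma Zser_reflect u l : Zser u l -> Zser (fun k => u (- k)%Z) l.
Proof.
  intros (l1 & l2 & H1 & H2 & ->). exists (u 0%Z + l2), (l1 - u 0%Z).
  split; [|split; [|ring]].
  - now apply (Cser_S (fun n => u (- Z.of_nat n)%Z)).
  - apply Cser_S_inv in H1. revert H1. apply Cser_ext. intros n. f_equal; lia.
Qed.

Lemma Zsummable_le u v :
  (forall k, (Cmod (u k) <= Cmod (v k))%R) -> Zsummable v -> Zsummable u.
Proof.
  intros H [H1 H2]. split.
  - revert H1. apply csummable_le. intros; apply H.
  - revert H2. apply csummable_le. intros; apply H.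
Qed.

(** * Laurent series with Gaussian coefficients *)

(** At most geometric growth in both directions, which a Gaussian factor
    always beats. *)
Definition expgrowth (y : Z -> C) : Prop :=
  exists A w : R, (0 <= A)%R /\ (0 <= w)%R /\
    forall n, (Cmod (y (Z.of_nat n)) <= A * w ^ n)%R /\
              (Cmod (y (- Z.of_nat n)%Z) <= A * w ^ n)%R.

Definition laurent (y : Z -> C) (q u : C) : C :=
  CSeriesZ (fun k => y k * (qtri q k * Cpowz u k)).

Lemma tri_summable q w : (0 < Cmod q < 1)%R -> (0 <= w)%R ->
  rsummable (fun n => w ^ n * Cmod (tri q n))%R.
Proof.
  intros Hq Hw.
  destruct (pow_small (Cmod q) (1 / (2 * (w + 1)))) as [N HN]; [lra| |].
  { apply Rdiv_lt_0_compat; lra. }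
  apply rsummable_ratio with (1 / 2)%R N; [|lra|].
  - intros n. apply Rmult_le_pos; [now apply pow_le|apply Cmod_ge_0].
  - intros n Hn. simpl. rewrite Cmod_mult, Cmod_pow. specialize (HN n Hn).
    replace (w * w ^ n * (Cmod (tri q n) * Cmod q ^ n))%R
      with ((w * Cmod q ^ n) * (w ^ n * Cmod (tri q n)))%R by ring.
    apply Rmult_le_compat_r.
    + apply Rmult_le_pos; [now apply pow_le|apply Cmod_ge_0].
    + apply Rle_trans with (w * (1 / (2 * (w + 1))))%R; [apply Rmult_le_compat_l; lra|].
      apply Rmult_le_reg_r with (2 * (w + 1))%R; [lra|].
      replace (w * (1 / (2 * (w + 1))) * (2 * (w + 1)))%R with w by (field; lra). lra.
Qed.

Lemma tri_summable2 q w : (0 < Cmod q < 1)%R -> (0 <= w)%R ->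
  rsummable (fun n => w ^ S n * Cmod (tri q (S (S n))))%R.
Proof.
  intros Hq Hw.
  apply (rsummable_tail' (fun n => w ^ n * Cmod (tri q (S n)))%R 1).
  apply rsummable_ext with (fun n => (w * Cmod q) ^ n * Cmod (tri q n))%R.
  - intros n. simpl. rewrite Cmod_mult, Cmod_pow, Rpow_mult_distr. ring.
  - apply tri_summable; auto. apply Rmult_le_pos; [auto|lra].
Qed.

(** The majorants depend on [u] only through [r] and [s], so they serve for a
    whole convergent sequence of arguments. *)
Lemma laurent_term_bound (y : Z -> C) (q u : C) (A w r s : R) : (0 < Cmod q < 1)%R -> u <> 0 ->
  (0 <= A)%R -> (0 <= w)%R ->
  (forall n, (Cmod (y (Z.of_nat n)) <= A * w ^ n)%R /\
             (Cmod (y (- Z.of_nat n)%Z) <= A * w ^ n)%R) ->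
  (Cmod u <= r)%R -> (Cmod (/ u) <= s)%R ->
  (forall n, (Cmod (y (Z.of_nat n) * (qtri q (Z.of_nat n) * Cpowz u (Z.of_nat n)))
     <= A * ((w * r) ^ n * Cmod (tri q n)))%R) /\
  (forall n, (Cmod (y (- Z.of_nat (S n))%Z *
                (qtri q (- Z.of_nat (S n)) * Cpowz u (- Z.of_nat (S n))))
     <= A * ((w * s) ^ S n * Cmod (tri q (S (S n)))))%R).
Proof.
  intros Hq Hu HA Hw Hy Hr Hs. pose proof (q_nz q Hq).
  pose proof (Cmod_ge_0 u). pose proof (Cmod_ge_0 (/ u)).
  split; intros n.
  - rewrite qtri_nat by auto. rewrite Cpowz_nat, !Cmod_mult, Cmod_pow, Rpow_mult_distr.
    replace (A * (w ^ n * r ^ n * Cmod (tri q n)))%R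
      with ((A * w ^ n) * (Cmod (tri q n) * r ^ n))%R by ring.
    apply Rmult_le_compat; auto using Cmod_ge_0.
    + apply Rmult_le_pos; [apply Cmod_ge_0|now apply pow_le].
    + apply Hy.
    + apply Rmult_le_compat_l; [apply Cmod_ge_0|]. apply pow_incr. lra.
  - rewrite qtri_negS, Cpowz_neg, <- Cpow_inv by auto. rewrite !Cmod_mult, Cmod_pow, Rpow_mult_distr.
    replace (A * (w ^ S n * s ^ S n * Cmod (tri q (S (S n)))))%R
      with ((A * w ^ S n) * (Cmod (tri q (S (S n))) * s ^ S n))%R by ring.
    apply Rmult_le_compat; auto using Cmod_ge_0.
    + apply Rmult_le_pos; [apply Cmod_ge_0|now apply pow_le].
    + apply Hy.
    + apply Rmult_le_compat_l; [apply Cmod_ge_0|]. apply pow_incr. lra.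
Qed.

Lemma laurent_summable (y : Z -> C) (q u : C) : (0 < Cmod q < 1)%R -> expgrowth y -> u <> 0 ->
  Zsummable (fun k => y k * (qtri q k * Cpowz u k)).
Proof.
  intros Hq (A & w & HA & Hw & Hy) Hu.
  destruct (laurent_term_bound y q u A w (Cmod u) (Cmod (/ u))) as [B1 B2]; auto; try lra.
  split.
  - apply csummable_le with (1 := B1). apply rsummable_scal; auto.
    apply tri_summable; auto. apply Rmult_le_pos; auto using Cmod_ge_0.
  - apply csummable_le with (1 := B2). apply rsummable_scal; auto.
    apply tri_summable2; auto. apply Rmult_le_pos; auto using Cmod_ge_0.
Qed.

Lemma laurent_Zser (y : Z -> C) (q u : C) : (0 < Cmod q < 1)%R -> expgrowth y -> u <> 0 ->
  Zser (fun k => y k * (qtri q k * Cpowz u k)) (laurent y q u).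
Proof. intros. apply Zsummable_Zser. now apply laurent_summable. Qed.

Lemma expgrowth_1 : expgrowth (fun _ => 1).
Proof.
  exists 1%R, 1%R. repeat split; try lra; rewrite Cmod_1, pow1; lra.
Qed.

(** * The theta function *)

Lemma theta_summable (q x : C) : (0 < Cmod q < 1)%R -> x <> 0 ->
  Zsummable (fun n => qtri q n * Cpowz x n).
Proof.
  intros Hq Hx. apply Zsummable_le with (fun k => 1 * (qtri q k * Cpowz x k)).
  - intros k. rewrite Cmult_1_l. lra.
  - apply laurent_summable; auto. apply expgrowth_1.
Qed.

Lemma theta_Zser (q x : C) : (0 < Cmod q < 1)%R -> x <> 0 ->
  Zser (fun n => qtri q n * Cpowz x n) (theta q x).
Proof. intros. apply Zsummable_Zser. now apply theta_summable. Qed.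

Lemma theta_laurent q x : theta q x = laurent (fun _ => 1) q x.
Proof. apply CSeriesZ_ext. intros k. ring. Qed.

Lemma theta_qshift (q x : C) k : (0 < Cmod q < 1)%R -> x <> 0 ->
  theta q (x * Cpowz q k) = theta q x / (qtri q k * Cpowz x k).
Proof.
  intros Hq Hx. pose proof (q_nz q Hq) as Hq0.
  assert (Hk : qtri q k * Cpowz x k <> 0).
  { apply Cmult_neq_0; [now apply qtri_nz|now apply Cpowz_nz]. }
  apply (Zser_unique (fun n => qtri q n * Cpowz (x * Cpowz q k) n)).
  { apply theta_Zser; auto. apply Cmult_neq_0; auto. now apply Cpowz_nz. }
  replace (theta q x / (qtri q k * Cpowz x k)) with (/ (qtri q k * Cpowz x k) * theta q x)
    by (unfold Cdiv; ring).
  apply Zser_ext with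
    (fun n => / (qtri q k * Cpowz x k) * (qtri q (n + k) * Cpowz x (n + k))).
  - intros n. rewrite qtri_add, Cpowz_add, Cpowz_mult_l by auto using Cpowz_nz.
    rewrite (Z.mul_comm n k), Cpowz_mul by auto. field.
    split; [now apply Cpowz_nz|now apply qtri_nz].
  - apply Zser_scal. apply (Zser_shift (fun n => qtri q n * Cpowz x n)).
    now apply theta_Zser.
Qed.

Lemma theta_inv (q x : C) : (0 < Cmod q < 1)%R -> x <> 0 -> theta q (q * x) = theta q (/ x).
Proof.
  intros Hq Hx. pose proof (q_nz q Hq) as Hq0.
  apply (Zser_unique (fun n => qtri q n * Cpowz (q * x) n)).
  { apply theta_Zser; auto. now apply Cmult_neq_0. }
  apply Zser_ext with (fun n => qtri q (- n) * Cpowz (/ x) (- n)).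
  - intros n. rewrite qtri_neg, qtri_succ, Cpowz_inv, Cpowz_mult_l, Cpowz_opp by auto.
    field. now apply Cpowz_nz.
  - apply (Zser_reflect (fun n => qtri q n * Cpowz (/ x) n)).
    apply theta_Zser; auto using Cinv_nz.
Qed.

(** * Jacobi's triple product *)

(** The Gaussian binomial coefficient. *)
Definition gbin (q : C) (n k : nat) : C :=
  if (k <=? n)%nat then qpoch q q n / (qpoch q q k * qpoch q q (n - k)) else 0.

Lemma qpochq_nz (q : C) n : (0 < Cmod q < 1)%R -> qpoch q q n <> 0.
Proof. intros H. apply qpoch_nz. intros k _. now apply qq_nz. Qed.

Lemma gbin_pascal q n k : (0 < Cmod q < 1)%R -> (k <= n)%nat ->
  gbin q (S n) (S k) = gbin q n (S k) + q ^ (n - k) * gbin q n k.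
Proof.
  intros H L. pose proof (fun n => qpochq_nz q n H) as Hnz.
  unfold gbin. destruct (Nat.leb_spec (S k) (S n)); [|lia].
  destruct (Nat.leb_spec k n); [|lia].
  destruct (Nat.leb_spec (S k) n).
  - replace (S n - S k)%nat with (S (n - S k)) by lia.
    replace (n - k)%nat with (S (n - S k)) by lia.
    set (d := (n - S k)%nat). assert (En : n = (S k + d)%nat) by lia.
    assert (N1 : 1 - q * q ^ d <> 0).
    { intros E. apply (qq_nz q H d). replace (q * q ^ d) with (1 - (1 - q * q ^ d)) by ring.
      rewrite E. ring. }
    assert (N2 : 1 - q * q ^ k <> 0).
    { intros E. apply (qq_nz q H k). replace (q * q ^ k) with (1 - (1 - q * q ^ k)) by ring.
      rewrite E. ring. }
    simpl. rewrite En at 2. rewrite Cpow_add_r, Cpow_S. field. auto.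
  - replace k with n by lia. rewrite Nat.sub_diag, Nat.sub_diag. simpl.
    assert (N1 : 1 - q * q ^ n <> 0).
    { intros E. apply (qq_nz q H n). replace (q * q ^ n) with (1 - (1 - q * q ^ n)) by ring.
      rewrite E. ring. }
    field. auto.
Qed.

Lemma qbinomial_finite q x n : (0 < Cmod q < 1)%R ->
  qpoch (- x) q n = csum (fun k => gbin q n k * (tri q k * x ^ k)) (S n).
Proof.
  intros H. pose proof (fun n => qpochq_nz q n H) as Hnz.
  induction n as [|n IH].
  - simpl. unfold gbin. simpl. field.
  - rewrite csum_S_l.
    rewrite (csum_ext _ (fun k => gbin q n (S k) * (tri q (S k) * x ^ S k)
               + x * q ^ n * (gbin q n k * (tri q k * x ^ k)))).
    + rewrite csum_plus, csum_scal, <- IH.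
      assert (E : qpoch (- x) q n = gbin q (S n) 0 * (tri q 0 * x ^ 0)
         + csum (fun k => gbin q n (S k) * (tri q (S k) * x ^ S k)) (S n)).
      { replace (gbin q (S n) 0) with (gbin q n 0).
        - rewrite <- (csum_S_l (fun k => gbin q n k * (tri q k * x ^ k))).
          change (csum (fun k => gbin q n k * (tri q k * x ^ k)) (S (S n)))
            with (csum (fun k => gbin q n k * (tri q k * x ^ k)) (S n)
                  + gbin q n (S n) * (tri q (S n) * x ^ S n)).
          rewrite <- IH. unfold gbin at 1. destruct (Nat.leb_spec (S n) n); [lia|ring].
        - unfold gbin. cbn -[qpoch]. rewrite !Nat.sub_0_r. cbn [qpoch].
          assert (N1 : 1 - q * q ^ n <> 0).
          { intros E. apply (qq_nz q H n).
            replace (q * q ^ n) with (1 - (1 - q * q ^ n)) by ring. rewrite E. ring. }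
          field. auto. }
      rewrite Cplus_assoc, <- E. cbn [qpoch]. ring.
    + intros k Hk. rewrite gbin_pascal by (auto; lia). cbn [tri].
      rewrite Cpow_S. replace (q ^ n) with (q ^ (n - k) * q ^ k).
      * ring.
      * rewrite <- Cpow_add_r. f_equal; lia.
Qed.

Lemma tri_square (q : C) n : q <> 0 -> tri q n * tri q n * q ^ n = (q ^ n) ^ n.
Proof.
  intros H. induction n as [|n IH]; [simpl; ring|].
  replace (tri q (S n) * tri q (S n) * q ^ S n)
    with (tri q n * tri q n * q ^ n * (q ^ n * q ^ S n)) by (simpl; ring).
  rewrite IH. rewrite <- !Cpow_mult_r, <- !Cpow_add_r. f_equal; lia.
Qed.

(** Completing the square: with [k = M + j], the exponents involving [M] cancel. *)
Lemma tri_centre (q x : C) M k j : q <> 0 -> x <> 0 ->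
  Z.of_nat k = (Z.of_nat M + j)%Z ->
  tri q (S M) / x ^ M * (tri q k * (x / q ^ M) ^ k) = qtri q j * Cpowz x j.
Proof.
  intros Hq Hx E.
  rewrite <- (qtri_nat q k), E, qtri_add, qtri_nat by auto.
  rewrite <- (Cpowz_nat (x / q ^ M) k), E.
  assert (HM : q ^ M <> 0) by now apply Cpow_nz.
  unfold Cdiv. rewrite Cpowz_mult_l, !Cpowz_inv by auto using Cinv_nz.
  rewrite !Cpowz_add, Cpowz_mul by auto. rewrite !Cpowz_nat.
  rewrite <- (tri_square q M) by auto. cbn [tri].
  field. repeat split; auto using tri_nz, Cpow_nz, Cpowz_nz.
Qed.

(** The q-binomial theorem with [2M] factors, at the point [x q^(-M)] and with
    the summation index centred. *)
Lemma triple_finite (q x : C) M : (0 < Cmod q < 1)%R -> x <> 0 ->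
  qpoch (- x) q M * qpoch (- q / x) q M =
  csum (fun i => gbin q (M + M) (M + i) *
          (qtri q (Z.of_nat i) * Cpowz x (Z.of_nat i))) (S M)
  + csum (fun i => gbin q (M + M) (M - S i) *
          (qtri q (- Z.of_nat (S i)) * Cpowz x (- Z.of_nat (S i)))) M.
Proof.
  intros H Hx. pose proof (q_nz q H) as Hq.
  assert (Hmx : - x <> 0) by now apply Copp_nz.
  pose proof (qpoch_reverse_add (- x) q M M Hq Hmx) as R.
  replace (- x / q ^ M) with (- (x / q ^ M)) in R by (unfold Cdiv; ring).
  rewrite qbinomial_finite in R by auto.
  replace (q / - x) with (- q / x) in R by (field; auto).
  replace (- - x) with x in R by ring.
  assert (HxM : x ^ M <> 0) by now apply Cpow_nz.
  pose proof (tri_nz q (S M) Hq) as Ht.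
  transitivity (tri q (S M) / x ^ M *
    csum (fun k => gbin q (M + M) k * (tri q k * (x / q ^ M) ^ k)) (S (M + M))).
  { rewrite R. field. auto. }
  rewrite <- csum_scal.
  replace (S (M + M)) with (M + S M)%nat by lia.
  rewrite csum_app, Cplus_comm. f_equal.
  - apply csum_ext. intros k Hk. rewrite <- (tri_centre q x M (M + k)) by (auto; lia). ring.
  - rewrite csum_rev. apply csum_ext. intros k Hk.
    replace (M - 1 - k)%nat with (M - S k)%nat by lia.
    rewrite <- (tri_centre q x M (M - S k)) by (auto; lia). ring.
Qed.

(** In [triple_finite] the Gaussian binomials are uniformly bounded and tend to
    [1 / (q;q)_oo]. *)
Theorem jacobi_triple_product (q x : C) : (0 < Cmod q < 1)%R -> x <> 0 ->
  theta q x = qpoch_inf q q * qpoch_inf (- x) q * qpoch_inf (- q / x) q.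
Proof.
  intros H Hx. pose proof (q_nz q H) as Hq. assert (Hq1 : (Cmod q < 1)%R) by lra.
  pose proof (qpoch_inf_nz q q Hq1 (qq_nz q H)) as Hinf.
  pose proof (fun n => qpochq_nz q n H) as Hnz.
  destruct (qpoch_bound q (Cmod q) Hq1) as [B [HB0 HB]].
  destruct (qpoch_inv_bound q q Hq1 (qq_nz q H)) as [B' [HB0' HB']].
  assert (Hg : forall n k, (Cmod (gbin q n k) <= B * (B' * B'))%R).
  { intros n k. unfold gbin. destruct (k <=? n)%nat.
    - replace (qpoch q q n / (qpoch q q k * qpoch q q (n - k)))
        with (qpoch q q n * (/ qpoch q q k * / qpoch q q (n - k))) by (field; auto).
      rewrite !Cmod_mult. apply Rmult_le_compat; auto using Cmod_ge_0.
      + apply Rmult_le_pos; apply Cmod_ge_0.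
      + apply HB. lra.
      + apply Rmult_le_compat; auto using Cmod_ge_0.
    - rewrite Cmod_0. repeat apply Rmult_le_pos; lra. }
  assert (Hgl : forall (f : nat -> nat) i, (forall M, (i <= M)%nat -> (f M <= M + M)%nat) ->
     (forall M, (M <= f M + i)%nat) -> (forall M, (i <= M)%nat -> (M <= (M + M - f M) + i)%nat) ->
     Ccv (fun M => gbin q (M + M) (f M)) (/ qpoch_inf q q)).
  { intros f i F1 F2 F3.
    apply (Ccv_ext_loc (fun M => qpoch q q (M + M) / (qpoch q q (f M) * qpoch q q (M + M - f M)))
             _ _ i).
    - intros M HM. unfold gbin. specialize (F1 M HM).
      destruct (Nat.leb_spec (f M) (M + M)); [auto|lia].
    - replace (/ qpoch_inf q q) with (qpoch_inf q q / (qpoch_inf q q * qpoch_inf q q))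
        by (field; auto).
      pose proof (qpoch_cv q q Hq1) as Hc.
      assert (Hc' : forall h : nat -> nat, (forall M, (i <= M)%nat -> (M <= h M + i)%nat) ->
                 Ccv (fun M => qpoch q q (h M)) (qpoch_inf q q)).
      { intros h Hh eps He. destruct (Hc eps He) as [N HN]. exists (N + i)%nat.
        intros n Hn. apply HN. specialize (Hh n ltac:(lia)). lia. }
      apply Ccv_div; [now apply Cmult_neq_0|apply Hc'; intros; lia|].
      apply Ccv_mult; apply Hc'; auto. }
  destruct (theta_summable q x H Hx) as [S1 S2].
  assert (L : Ccv (fun M => qpoch (- x) q M * qpoch (- q / x) q M)
     (CSeries (fun i => / qpoch_inf q q * (qtri q (Z.of_nat i) * Cpowz x (Z.of_nat i)))
      + CSeries (fun i => / qpoch_inf q q *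
          (qtri q (- Z.of_nat (S i)) * Cpowz x (- Z.of_nat (S i)))))).
  { eapply Ccv_ext; [intros M; symmetry; apply triple_finite; auto|].
    apply Ccv_plus.
    - apply (tannery_fin (fun M i => gbin q (M + M) (M + i) *
          (qtri q (Z.of_nat i) * Cpowz x (Z.of_nat i))) _
        (fun i => B * (B' * B') * Cmod (qtri q (Z.of_nat i) * Cpowz x (Z.of_nat i)))%R S).
      + apply rsummable_scal; auto. repeat apply Rmult_le_pos; lra.
      + intros M i _. rewrite Cmod_mult. apply Rmult_le_compat_r; auto using Cmod_ge_0.
      + auto.
      + intros i. apply Ccv_mult; [|apply Ccv_const].
        apply (Hgl (fun M => (M + i)%nat) i); intros; lia.
    - apply (tannery_fin (fun M i => gbin q (M + M) (M - S i) *
          (qtri q (- Z.of_nat (S i)) * Cpowz x (- Z.of_nat (S i)))) _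
        (fun i => B * (B' * B') *
            Cmod (qtri q (- Z.of_nat (S i)) * Cpowz x (- Z.of_nat (S i))))%R (fun M => M)).
      + apply rsummable_scal; auto. repeat apply Rmult_le_pos; lra.
      + intros M i _. rewrite Cmod_mult. apply Rmult_le_compat_r; auto using Cmod_ge_0.
      + auto.
      + intros i. apply Ccv_mult; [|apply Ccv_const].
        apply (Hgl (fun M => (M - S i)%nat) (S i)); intros; lia. }
  assert (L' := Ccv_mult _ _ _ _ (qpoch_cv (- x) q Hq1) (qpoch_cv (- q / x) q Hq1)).
  pose proof (Ccv_unique _ _ _ L L') as E.
  rewrite <- Cmult_assoc, <- E.
  rewrite (Cser_CSeries _ _ (Cser_scal _ _ _ (csummable_Cser _ S1))).
  rewrite (Cser_CSeries _ _ (Cser_scal _ _ _ (csummable_Cser _ S2))).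
  unfold theta, CSeriesZ. field. auto.
Qed.

Lemma theta_zero (q x : C) : (0 < Cmod q < 1)%R -> x <> 0 ->
  theta q x = 0 -> spiral (- (1)) q x.
Proof.
  intros H Hx E. pose proof (q_nz q H) as Hq. assert (Hq1 : (Cmod q < 1)%R) by lra.
  apply NNPP. intros N. revert E. rewrite jacobi_triple_product by auto.
  apply Cmult_neq_0; [apply Cmult_neq_0|]; apply qpoch_inf_nz; auto using qq_nz.
  - intros n En. apply N. exists (- Z.of_nat n)%Z. rewrite Cpowz_neg.
    replace x with (- (- x * q ^ n) / q ^ n) by (field; now apply Cpow_nz).
    rewrite En. unfold Cdiv. ring.
  - intros n En. apply N. exists (Z.of_nat (S n)). rewrite Cpowz_nat, Cpow_S.
    replace x with (x * (- q / x * q ^ n)) by (rewrite En; ring). field. auto.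
Qed.

(** * Analytic germs *)

Lemma is_power_sum_Cser c z l : is_power_sum c z l <-> Cser (fun n => c n * z ^ n) l.
Proof. unfold is_power_sum. split; apply Cser_is_series. Qed.

Lemma Cser_term_bounded a l : Cser a l ->
  exists B, (0 < B)%R /\ forall n, (Cmod (a n) <= B)%R.
Proof.
  intros H. destruct (Ccv_bounded _ _ H) as [B [HB0 HB]].
  exists (B + B)%R. split; [lra|]. intros n.
  pose proof (HB n). pose proof (HB (S n)). simpl in *.
  pose proof (Cmod_triangle_minus (csum a n + a n) (csum a n)) as T.
  replace (csum a n + a n - csum a n) with (a n) in T by ring. lra.
Qed.

Lemma analytic_ext f g z0 (r : R) : (0 < r)%R ->
  (forall z, (Cmod (z - z0) < r)%R -> f z = g z) -> analytic_at g z0 -> analytic_at f z0.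
Proof.
  intros Hr E (c & r' & H).
  assert (Hm : (0 < Rmin r r')%R) by (apply Rmin_pos; auto; apply cond_pos).
  exists c, (mkposreal _ Hm). simpl. intros z Hz.
  pose proof (Rmin_l r r'). pose proof (Rmin_r r r').
  rewrite E by lra. apply H. lra.
Qed.

Lemma analytic_plus f g z0 : analytic_at f z0 -> analytic_at g z0 ->
  analytic_at (fun z => f z + g z) z0.
Proof.
  intros (c & r & H) (d & r' & H').
  assert (Hm : (0 < Rmin r r')%R) by (apply Rmin_pos; apply cond_pos).
  exists (fun n => c n + d n), (mkposreal _ Hm). simpl. intros z Hz.
  pose proof (Rmin_l r r'). pose proof (Rmin_r r r').
  apply is_power_sum_Cser.
  apply Cser_ext with (fun n => c n * (z - z0) ^ n + d n * (z - z0) ^ n); [intros; ring|].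
  apply Cser_plus; apply is_power_sum_Cser; [apply H|apply H']; lra.
Qed.

Lemma analytic_linear u v f z0 : analytic_at f z0 ->
  analytic_at (fun z => (u + v * z) * f z) z0.
Proof.
  intros (c & r & H).
  exists (fun n => (u + v * z0) * c n + match n with O => 0 | S m => v * c m end), r.
  intros z Hz. apply is_power_sum_Cser. specialize (H z Hz).
  apply is_power_sum_Cser in H.
  replace ((u + v * z) * f z) with ((u + v * z0) * f z + (0 + v * (z - z0) * f z)) by ring.
  apply Cser_ext with (fun n => (u + v * z0) * (c n * (z - z0) ^ n)
      + match n with O => 0 | S m => v * (z - z0) * (c m * (z - z0) ^ m) end).
  - intros [|n]; simpl; ring.
  - apply Cser_plus; [now apply Cser_scal|].
    apply (Cser_S (fun n => match n with O => 0
                     | S m => v * (z - z0) * (c m * (z - z0) ^ m) end)).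
    apply (Cser_scal (v * (z - z0)) (fun m => c m * (z - z0) ^ m)). exact H.
Qed.

Lemma analytic_pow k f z0 : analytic_at f z0 ->
  analytic_at (fun z => f z * (z - z0) ^ k) z0.
Proof.
  intros H. induction k as [|k IH].
  - apply (analytic_ext _ f _ 1); auto; [lra|]. intros; simpl; ring.
  - apply (analytic_ext _ (fun z => (- z0 + 1 * z) * (f z * (z - z0) ^ k)) _ 1); [lra| |].
    + intros; simpl; ring.
    + now apply analytic_linear.
Qed.

Lemma analytic_scale (p : C) f z0 : p <> 0 -> analytic_at f (p * z0) ->
  analytic_at (fun z => f (p * z)) z0.
Proof.
  intros Hp (c & r & H). apply Cmod_pos in Hp.
  assert (Hm : (0 < r / Cmod p)%R) by (apply Rdiv_lt_0_compat; auto; apply cond_pos).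
  exists (fun n => c n * p ^ n), (mkposreal _ Hm). simpl. intros z Hz.
  assert (Hz' : (Cmod (p * z - p * z0) < r)%R).
  { replace (p * z - p * z0) with (p * (z - z0)) by ring. rewrite Cmod_mult.
    replace (pos r) with (Cmod p * (r / Cmod p))%R by (field; lra).
    now apply Rmult_lt_compat_l. }
  specialize (H _ Hz'). apply is_power_sum_Cser in H. apply is_power_sum_Cser.
  revert H. apply Cser_ext. intros n.
  replace (p * z - p * z0) with (p * (z - z0)) by ring. rewrite Cpow_mult_l. ring.
Qed.

Lemma Ccv_zero_geom a (B t : R) : (0 <= t < 1)%R ->
  (forall n, (Cmod (a n) <= B * t ^ n)%R) -> Ccv a 0.
Proof.
  intros Ht H eps He.
  assert (HB : (0 <= B)%R).
  { specialize (H O). pose proof (Cmod_ge_0 (a O)). simpl in H. lra. }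
  destruct (pow_small t (eps / (B + 1))) as [N HN]; auto.
  { apply Rdiv_lt_0_compat; lra. }
  exists N. intros n Hn. specialize (HN n Hn).
  replace (a n - 0) with (a n) by ring. apply Rle_lt_trans with (1 := H n).
  apply Rle_lt_trans with (B * (eps / (B + 1)))%R; [apply Rmult_le_compat_l; lra|].
  replace eps with ((B + 1) * (eps / (B + 1)))%R at 2 by (field; lra).
  apply Rmult_lt_compat_r; [apply Rdiv_lt_0_compat|]; lra.
Qed.

(** The coefficients of the quotient satisfy a first-order recursion, which keeps
    them geometrically bounded. *)
Lemma analytic_div (s : C) f z0 : (Cmod s <= 1)%R -> s * z0 <> 1 -> analytic_at f z0 ->
  analytic_at (fun z => f z / (1 - s * z)) z0.
Proof.
  intros Hs Hz0 (c & r & H).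
  set (dl := 1 - s * z0).
  assert (Hdl : dl <> 0).
  { intros E. apply Hz0. replace (s * z0) with (1 - dl) by (unfold dl; ring). rewrite E. ring. }
  pose proof (Cmod_pos _ Hdl) as Hdl'. pose proof (cond_pos r) as Hr.
  (* As [|s| <= 1], the recursion for [e] below contracts on discs of radius at most
     half of [|dl|]. *)
  set (R0 := (Rmin r (Cmod dl) / 2)%R).
  assert (HR : (0 < R0)%R /\ (R0 < r)%R /\ (R0 <= Cmod dl / 2)%R).
  { pose proof (Rmin_l r (Cmod dl)). pose proof (Rmin_r r (Cmod dl)).
    pose proof (Rmin_pos r (Cmod dl) Hr Hdl'). unfold R0. lra. }
  destruct HR as (HR1 & HR2 & HR3).
  assert (exists C0, (0 < C0)%R /\ forall n, (Cmod (c n) * R0 ^ n <= C0)%R) as (C0 & HC0 & HC).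
  { specialize (H (z0 + R0)). replace (z0 + R0 - z0) with (RtoC R0) in H by ring.
    rewrite Cmod_R, Rabs_pos_eq in H by lra. specialize (H HR2).
    apply is_power_sum_Cser, Cser_term_bounded in H. destruct H as (B & HB0 & HB).
    exists B. split; auto. intros n. specialize (HB n).
    rewrite Cmod_mult, Cmod_pow, Cmod_R, Rabs_pos_eq in HB by lra. exact HB. }
  set (e := fix e n := match n with O => c O / dl | S m => (c (S m) + s * e m) / dl end).
  set (E := (2 * C0 / Cmod dl)%R).
  assert (HE0 : (0 < E)%R) by (apply Rdiv_lt_0_compat; lra).
  assert (HE : forall n, (Cmod (e n) * R0 ^ n <= E)%R).
  { induction n as [|n IH].
    - simpl. rewrite Cmod_div by auto. pose proof (HC O) as K. simpl in K. unfold E.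
      apply Rmult_le_reg_r with (Cmod dl); auto.
      replace (Cmod (c O) / Cmod dl * 1 * Cmod dl)%R with (Cmod (c O)) by (field; lra).
      replace (2 * C0 / Cmod dl * Cmod dl)%R with (2 * C0)%R by (field; lra). lra.
    - change (e (S n)) with ((c (S n) + s * e n) / dl). rewrite Cmod_div by auto.
      pose proof (Cmod_triangle (c (S n)) (s * e n)) as T. rewrite Cmod_mult in T.
      assert (T' : (Cmod (c (S n) + s * e n) <= Cmod (c (S n)) + Cmod (e n))%R).
      { pose proof (Cmod_ge_0 (e n)). nra. }
      pose proof (HC (S n)) as K.
      assert (P : (0 <= R0 ^ S n)%R) by (apply pow_le; lra).
      assert (Hx : (Cmod (c (S n) + s * e n) * R0 ^ S n <= C0 + R0 * E)%R).
      { apply Rle_trans with ((Cmod (c (S n)) + Cmod (e n)) * R0 ^ S n)%R.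
        - now apply Rmult_le_compat_r.
        - rewrite Rmult_plus_distr_r. apply Rplus_le_compat; auto.
          simpl. replace (Cmod (e n) * (R0 * R0 ^ n))%R with (R0 * (Cmod (e n) * R0 ^ n))%R by ring.
          apply Rmult_le_compat_l; lra. }
      apply Rmult_le_reg_r with (Cmod dl); auto.
      replace (Cmod (c (S n) + s * e n) / Cmod dl * R0 ^ S n * Cmod dl)%R
        with (Cmod (c (S n) + s * e n) * R0 ^ S n)%R by (field; lra).
      apply Rle_trans with (1 := Hx).
      replace (E * Cmod dl)%R with (2 * C0)%R by (unfold E; field; lra).
      assert (R0 * E <= C0)%R; [|lra].
      apply Rle_trans with (Cmod dl / 2 * E)%R; [apply Rmult_le_compat_r; lra|].
      right. unfold E. field. lra. }
  exists e, (mkposreal _ HR1). simpl. intros z Hz. apply is_power_sum_Cser.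
  set (w := z - z0) in *.
  assert (Hw : dl - s * w <> 0).
  { apply Cmod_pos_nz. pose proof (Cmod_rev_triangle dl (s * w)) as T.
    rewrite Cmod_mult in T. pose proof (Cmod_ge_0 w). nra. }
  replace (1 - s * z) with (dl - s * w) by (unfold dl, w; ring).
  assert (Hf : Cser (fun n => c n * w ^ n) (f z)).
  { apply is_power_sum_Cser. apply H. unfold w in *. lra. }
  assert (Ep : forall n, csum (fun n => e n * w ^ n) (S n) =
     (csum (fun n => c n * w ^ n) (S n) - s * w * (e n * w ^ n)) / (dl - s * w)).
  { intros n.
    assert (Ep : csum (fun n => e n * w ^ n) (S n) * (dl - s * w) =
     csum (fun n => c n * w ^ n) (S n) - s * w * (e n * w ^ n)).
    { induction n as [|n IH].
      - simpl. field. auto.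
      - change (csum (fun n => e n * w ^ n) (S (S n)))
          with (csum (fun n => e n * w ^ n) (S n) + e (S n) * w ^ S n).
        rewrite Cmult_plus_distr_r, IH.
        change (csum (fun n => c n * w ^ n) (S (S n)))
          with (csum (fun n => c n * w ^ n) (S n) + c (S n) * w ^ S n).
        change (e (S n)) with ((c (S n) + s * e n) / dl). rewrite Cpow_S. field. auto. }
    rewrite <- Ep. field. auto. }
  assert (Hlim : Ccv (fun n => csum (fun n => e n * w ^ n) (S n)) (f z / (dl - s * w))).
  { eapply Ccv_ext; [intros n; symmetry; apply Ep|].
    replace (f z) with (f z - s * w * 0) by ring.
    apply Ccv_div; auto; [|apply Ccv_const].
    apply Ccv_plus.
    - apply (Ccv_subseq (csum (fun n => c n * w ^ n)) _ S); auto.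
    - replace (- (s * w * 0)) with (- (s * w) * 0) by ring.
      apply Ccv_ext with (fun n => - (s * w) * (e n * w ^ n)); [intros; ring|].
      apply Ccv_scal. apply Ccv_zero_geom with E (Cmod w / R0)%R.
      + split; [apply Rmult_le_pos; [apply Cmod_ge_0|left; now apply Rinv_0_lt_compat]|].
        apply Rmult_lt_reg_r with R0; auto.
        replace (Cmod w / R0 * R0)%R with (Cmod w) by (field; lra). lra.
      + intros n. rewrite Cmod_mult, Cmod_pow.
        replace (Cmod (e n) * Cmod w ^ n)%R
          with ((Cmod (e n) * R0 ^ n) * (Cmod w / R0) ^ n)%R.
        * apply Rmult_le_compat_r; auto. apply pow_le.
          apply Rmult_le_pos; [apply Cmod_ge_0|left; now apply Rinv_0_lt_compat].
        * unfold Rdiv. rewrite Rpow_mult_distr, pow_inv. field. apply pow_nonzero. lra. }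
  intros eps He. destruct (Hlim eps He) as [N HN]. exists (S N).
  intros [|n] Hn; [lia|]. apply HN. lia.
Qed.

(** The coefficients of [(z0 + w)^n] in powers of [w]; defined by Pascal's rule,
    which also bounds the sum of their moduli by [(|z0| + |w|)^n]. *)
Fixpoint recentre (z0 : C) (n k : nat) : C :=
  match n with
  | O => match k with O => 1 | S _ => 0 end
  | S m => z0 * recentre z0 m k + match k with O => 0 | S j => recentre z0 m j end
  end.

Lemma recentre_big z0 n k : (n < k)%nat -> recentre z0 n k = 0.
Proof.
  revert k. induction n as [|n IH]; intros [|k] H; try lia; simpl; auto.
  rewrite !IH by lia. ring.
Qed.

Lemma recentre_sum z0 w n N : (n < N)%nat ->
  csum (fun k => recentre z0 n k * w ^ k) N = (z0 + w) ^ n.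
Proof.
  revert N. induction n as [|n IH]; intros N H.
  - destruct N; [lia|]. rewrite csum_S_l. rewrite csum_zero; [simpl; ring|].
    intros; simpl; ring.
  - destruct N; [lia|]. cbn [recentre].
    rewrite (csum_ext _ (fun k => z0 * (recentre z0 n k * w ^ k) +
       match k with O => 0 | S j => w * (recentre z0 n j * w ^ j) end)).
    + rewrite csum_plus, csum_scal, IH by lia.
      rewrite csum_S_l, csum_scal, IH by lia. rewrite Cpow_S. ring.
    + intros [|k] _; simpl; ring.
Qed.

Lemma recentre_abs z0 n t N : (0 <= t)%R ->
  (rsum (fun k => Cmod (recentre z0 n k) * t ^ k) N <= (Cmod z0 + t) ^ n)%R.
Proof.
  intros Ht. pose proof (Cmod_ge_0 z0). revert N. induction n as [|n IH]; intros N.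
  - apply Rle_trans with (rsum (fun k => match k with O => 1 | S _ => 0 end)%R N).
    + apply rsum_le. intros [|k] _; simpl; rewrite ?Cmod_1, ?Cmod_0; lra.
    + destruct N as [|N]; [simpl; lra|]. induction N as [|N IH]; simpl in *; lra.
  - apply Rle_trans with (Cmod z0 * rsum (fun k => Cmod (recentre z0 n k) * t ^ k) N +
      t * rsum (fun k => Cmod (recentre z0 n k) * t ^ k) N)%R.
    + assert (Hpos : forall k, (0 <= Cmod (recentre z0 n k) * t ^ k)%R).
      { intros k. apply Rmult_le_pos; [apply Cmod_ge_0|now apply pow_le]. }
      apply Rle_trans with (Cmod z0 * rsum (fun k => Cmod (recentre z0 n k) * t ^ k) N +
        rsum (fun k => match k with O => 0 | S j => t * (Cmod (recentre z0 n j) * t ^ j) end) N)%R.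
      * clear IH. induction N as [|N IH]; simpl; [lra|].
        pose proof (Cmod_triangle (z0 * recentre z0 n N)
           (match N with O => 0 | S j => recentre z0 n j end)) as T.
        rewrite Cmod_mult in T.
        assert (T2 : (Cmod (z0 * recentre z0 n N + match N with O => 0 | S j => recentre z0 n j end)
           * t ^ N <= (Cmod z0 * (Cmod (recentre z0 n N) * t ^ N)) +
             match N with O => 0 | S j => t * (Cmod (recentre z0 n j) * t ^ j) end)%R).
        { apply Rle_trans with ((Cmod z0 * Cmod (recentre z0 n N) +
            Cmod (match N with O => 0 | S j => recentre z0 n j end)) * t ^ N)%R.
          - apply Rmult_le_compat_r; auto. now apply pow_le.
          - destruct N; simpl; rewrite ?Cmod_0; lra. }
        simpl in IH. lra.
      * apply Rplus_le_compat_l. destruct N as [|N]; [simpl; lra|].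
        apply Rle_trans with (t * rsum (fun k => Cmod (recentre z0 n k) * t ^ k) N)%R.
        -- clear. induction N as [|N IH]; simpl in *; lra.
        -- apply Rmult_le_compat_l; auto. simpl. specialize (Hpos N). lra.
    + simpl. rewrite Rmult_plus_distr_r. pose proof (IH N).
      apply Rplus_le_compat; apply Rmult_le_compat_l; auto.
Qed.

(** Expand [(z0 + w)^n] and exchange the summations, which is allowed as long as
    [|z0| + |w|] stays below the radius of convergence. *)
Lemma power_sum_analytic c f (R0 : R) z0 :
  (forall z, (Cmod z < R0)%R -> is_power_sum c z (f z)) ->
  (Cmod z0 < R0)%R -> analytic_at f z0.
Proof.
  intros H Hz0. pose proof (Cmod_ge_0 z0) as Hz1.
  set (r := ((R0 - Cmod z0) / 3)%R). assert (Hr : (0 < r)%R) by (unfold r; lra).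
  set (rho := (Cmod z0 + 2 * r)%R). assert (Hrho : (0 < rho < R0)%R) by (unfold rho, r in *; lra).
  assert (exists B, (0 < B)%R /\ forall n, (Cmod (c n) * rho ^ n <= B)%R) as (B & HB0 & HB).
  { specialize (H rho). rewrite Cmod_R, Rabs_pos_eq in H by lra. specialize (H (proj2 Hrho)).
    apply is_power_sum_Cser, Cser_term_bounded in H. destruct H as (B & HB0 & HB).
    exists B. split; auto. intros n. specialize (HB n).
    rewrite Cmod_mult, Cmod_pow, Cmod_R, Rabs_pos_eq in HB by lra. exact HB. }
  set (m := fun n => (Cmod (c n) * (Cmod z0 + r) ^ n)%R).
  assert (Hm : rsummable m).
  { apply rsummable_le with (fun n => B * ((Cmod z0 + r) / rho) ^ n)%R.
    - intros n. split; [apply Rmult_le_pos; [apply Cmod_ge_0|apply pow_le; lra]|].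
      unfold m. replace (Cmod (c n) * (Cmod z0 + r) ^ n)%R
        with ((Cmod (c n) * rho ^ n) * ((Cmod z0 + r) / rho) ^ n)%R.
      + apply Rmult_le_compat_r; auto. apply pow_le.
        apply Rmult_le_pos; [lra|left; apply Rinv_0_lt_compat; lra].
      + unfold Rdiv. rewrite Rpow_mult_distr, pow_inv. field. apply pow_nonzero. lra.
    - apply rsummable_scal; [lra|]. apply rsummable_geom. split.
      + apply Rmult_le_pos; [lra|left; apply Rinv_0_lt_compat; lra].
      + apply Rmult_lt_reg_r with rho; [lra|].
        replace ((Cmod z0 + r) / rho * rho)%R with (Cmod z0 + r)%R by (field; lra).
        unfold rho. lra. }
  assert (Hsum : forall w, (Cmod w <= r)%R -> forall n N,
     (rsum (fun k => Cmod (c n * recentre z0 n k * w ^ k)) N <= m n)%R).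
  { intros w Hw n N. apply Rle_trans with
      (rsum (fun k => Cmod (c n) * (Cmod (recentre z0 n k) * r ^ k)) N)%R.
    - apply rsum_le. intros k _. rewrite !Cmod_mult, Cmod_pow, Rmult_assoc.
      apply Rmult_le_compat_l; [apply Cmod_ge_0|].
      apply Rmult_le_compat_l; [apply Cmod_ge_0|]. apply pow_incr. split; auto using Cmod_ge_0.
    - rewrite rsum_scal. apply Rmult_le_compat_l; [apply Cmod_ge_0|].
      apply recentre_abs. lra. }
  exists (fun k => CSeries (fun n => c n * recentre z0 n k)), (mkposreal _ Hr).
  simpl. intros z Hz. apply is_power_sum_Cser. set (w := z - z0) in *.
  pose proof (fubini (fun n k => c n * recentre z0 n k * w ^ k) m Hm (Hsum w ltac:(lra))) as F.
  cbv beta in F.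
  replace (f z) with (CSeries (fun n => CSeries (fun k => c n * recentre z0 n k * w ^ k))).
  - revert F. apply Cser_ext. intros k. rewrite Cmult_comm.
    apply Cser_CSeries. apply Cser_ext with (fun n => w ^ k * (c n * recentre z0 n k)).
    { intros; ring. }
    apply Cser_scal. apply csummable_Cser.
    assert (Hr0 : (RtoC r) ^ k <> 0).
    { apply Cpow_nz. intros E. apply RtoC_inj in E. lra. }
    apply csummable_ext with (fun n => / (RtoC r) ^ k * (c n * recentre z0 n k * (RtoC r) ^ k)).
    { intros n. field. auto. }
    apply csummable_scal.
    apply (fubini_col (fun n k => c n * recentre z0 n k * (RtoC r) ^ k) m Hm).
    apply Hsum. rewrite Cmod_R, Rabs_pos_eq; lra.
  - apply Cser_CSeries.
    assert (Hfz : is_power_sum c z (f z)).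
    { apply H. pose proof (Cmod_triangle z0 w) as T.
      replace (z0 + w) with z in T by (unfold w; ring). unfold rho in Hrho. lra. }
    apply is_power_sum_Cser in Hfz. revert Hfz. apply Cser_ext. intros n.
    symmetry. apply Cser_CSeries.
    replace (c n * z ^ n) with (csum (fun k => c n * recentre z0 n k * w ^ k) (S n)).
    + apply (Cser_fin (fun k => c n * recentre z0 n k * w ^ k)).
      intros k Hk. rewrite recentre_big by lia. ring.
    + rewrite (csum_ext _ (fun k => c n * (recentre z0 n k * w ^ k))) by (intros; ring).
      rewrite csum_scal, recentre_sum by lia. f_equal. f_equal. unfold w. ring.
Qed.

(** * Meromorphic germs *)

Lemma analytic_meromorphic f z0 : analytic_at f z0 -> meromorphic_at f z0.
Proof.
  intros H. exists f, O, (mkposreal 1 Rlt_0_1). split; auto.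
  intros z _ _. simpl. field.
Qed.

Lemma meromorphic_ext f g z0 (r : R) : (0 < r)%R ->
  (forall z, (Cmod (z - z0) < r)%R -> f z = g z) -> meromorphic_at g z0 -> meromorphic_at f z0.
Proof.
  intros Hr E (h & k & r' & Hh & H).
  assert (Hm : (0 < Rmin r r')%R) by (apply Rmin_pos; auto; apply cond_pos).
  exists h, k, (mkposreal _ Hm). split; auto. simpl. intros z Hz1 Hz.
  pose proof (Rmin_l r r'). pose proof (Rmin_r r r').
  rewrite E by lra. apply H; auto. lra.
Qed.

Lemma meromorphic_plus f g z0 : meromorphic_at f z0 -> meromorphic_at g z0 ->
  meromorphic_at (fun z => f z + g z) z0.
Proof.
  intros (h & k & r & Hh & H) (h' & k' & r' & Hh' & H').
  assert (Hm : (0 < Rmin r r')%R) by (apply Rmin_pos; apply cond_pos).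
  exists (fun z => h z * (z - z0) ^ k' + h' z * (z - z0) ^ k), (k + k')%nat, (mkposreal _ Hm).
  split; [apply analytic_plus; now apply analytic_pow|]. simpl. intros z Hz1 Hz.
  pose proof (Rmin_l r r'). pose proof (Rmin_r r r').
  rewrite H, H' by (auto; lra). rewrite Cpow_add_r. pose proof (Cminus_nz _ _ Hz1). field.
  split; now apply Cpow_nz.
Qed.

Lemma meromorphic_linear u v f z0 : meromorphic_at f z0 ->
  meromorphic_at (fun z => (u + v * z) * f z) z0.
Proof.
  intros (h & k & r & Hh & H).
  exists (fun z => (u + v * z) * h z), k, r. split; [now apply analytic_linear|].
  intros z Hz1 Hz. rewrite H by auto. unfold Cdiv. ring.
Qed.

Lemma meromorphic_scale (p : C) f z0 : p <> 0 -> meromorphic_at f (p * z0) ->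
  meromorphic_at (fun z => f (p * z)) z0.
Proof.
  intros Hp (h & k & r & Hh & H). pose proof (Cmod_pos _ Hp) as Hp'.
  assert (Hm : (0 < r / Cmod p)%R) by (apply Rdiv_lt_0_compat; auto; apply cond_pos).
  exists (fun z => (/ p ^ k + 0 * z) * h (p * z)), k, (mkposreal _ Hm).
  split; [apply (analytic_linear (/ p ^ k) 0 (fun z => h (p * z)));
          now apply analytic_scale|].
  simpl. intros z Hz1 Hz.
  assert (Hz2 : p * z <> p * z0).
  { intros E. apply Hz1. replace z with (p * z / p) by (field; auto). rewrite E. field. auto. }
  rewrite H; auto.
  - replace (p * z - p * z0) with (p * (z - z0)) by ring. rewrite Cpow_mult_l.
    pose proof (Cminus_nz _ _ Hz1). field. split; now apply Cpow_nz.
  - replace (p * z - p * z0) with (p * (z - z0)) by ring. rewrite Cmod_mult.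
    replace (pos r) with (Cmod p * (r / Cmod p))%R by (field; lra).
    now apply Rmult_lt_compat_l.
Qed.

Lemma meromorphic_div (s : C) f z0 : (Cmod s <= 1)%R -> s <> 0 -> meromorphic_at f z0 ->
  meromorphic_at (fun z => f z / (1 - s * z)) z0.
Proof.
  intros Hs Hs0 (h & k & r & Hh & H).
  destruct (excluded_middle_informative (s * z0 = 1)) as [E|E].
  - exists (fun z => (- / s + 0 * z) * h z), (S k), r. split; [now apply analytic_linear|].
    intros z Hz1 Hz. rewrite H by auto.
    replace (1 - s * z) with (- s * (z - z0)) by (rewrite <- E; ring).
    rewrite Cpow_S. pose proof (Cminus_nz _ _ Hz1). field.
    repeat split; auto. now apply Cpow_nz.
  - exists (fun z => h z / (1 - s * z)), k, r. split; [now apply analytic_div|].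
    intros z Hz1 Hz. rewrite H by auto. unfold Cdiv. ring.
Qed.

(** * Uniqueness of the continuation *)

(** Close to [z0] the first nonzero term of the expansion dominates the sum of the
    others. *)
Lemma analytic_dichotomy h z0 : analytic_at h z0 ->
  (exists r, (0 < r)%R /\ forall z, (Cmod (z - z0) < r)%R -> h z = 0) \/
  (exists r, (0 < r)%R /\ forall z, z <> z0 -> (Cmod (z - z0) < r)%R -> h z <> 0).
Proof.
  intros (c & r & H). pose proof (cond_pos r) as Hr.
  destruct (excluded_middle_informative (forall n, c n = 0)) as [Z|NZ].
  - left. exists r. split; auto. intros z Hz. specialize (H z Hz).
    apply is_power_sum_Cser in H. apply (Cser_unique _ _ _ H).
    apply Cser_ext with (fun _ => 0); [|apply Cser_zero]. intros n. rewrite Z. ring.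
  - right. assert (exists k, c k <> 0 /\ forall j, (j < k)%nat -> c j = 0) as (k & Hk & Hmin).
    { apply NNPP. intros N. apply NZ.
      assert (K : forall n j, (j < n)%nat -> c j = 0).
      { induction n as [|n IH]; intros j Hj; [lia|].
        destruct (Nat.eq_dec j n) as [->|]; [|apply IH; lia].
        apply NNPP. intros Hc. apply N. exists n. split; auto. }
      intros n. apply (K (S n)). lia. }
    set (w0 := (r / 2)%R).
    assert (exists B, (0 < B)%R /\ forall n, (Cmod (c (k + n)%nat) * w0 ^ n <= B)%R)
      as (B & HB0 & HB).
    { pose proof (H (z0 + w0)) as K. replace (z0 + w0 - z0) with (RtoC w0) in K by ring.
      rewrite Cmod_R, Rabs_pos_eq in K by (unfold w0; lra). specialize (K ltac:(unfold w0; lra)).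
      apply is_power_sum_Cser, Cser_term_bounded in K. destruct K as (B & HB0 & HB).
      assert (0 < w0 ^ k)%R by (apply pow_lt; unfold w0; lra).
      exists (B / w0 ^ k)%R. split; [now apply Rdiv_lt_0_compat|]. intros n.
      specialize (HB (k + n)%nat).
      rewrite Cmod_mult, Cmod_pow, Cmod_R, Rabs_pos_eq in HB by (unfold w0; lra).
      rewrite pow_add in HB. apply Rmult_le_reg_r with (w0 ^ k)%R; auto.
      replace (B / w0 ^ k * w0 ^ k)%R with B by (field; lra). lra. }
    pose proof (Cmod_pos _ Hk) as Hk'.
    (* With this radius the later terms sum to at most half of the first one. *)
    set (tm := (Rmin (1 / 2) (Cmod (c k) / (4 * B)))%R).
    assert (Htm : (0 < tm)%R).
    { apply Rmin_pos; [lra|]. apply Rdiv_lt_0_compat; lra. }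
    exists (w0 * tm)%R. split; [apply Rmult_lt_0_compat; [unfold w0; lra|auto]|].
    intros z Hz1 Hz. set (w := z - z0) in *.
    assert (Hw0 : (0 < w0)%R) by (unfold w0; lra).
    pose proof (Rmin_l (1 / 2) (Cmod (c k) / (4 * B))) as M1. fold tm in M1.
    pose proof (Rmin_r (1 / 2) (Cmod (c k) / (4 * B))) as M2. fold tm in M2.
    assert (Hz2 : (Cmod w < r)%R).
    { apply Rlt_le_trans with (1 := Hz). apply Rle_trans with (w0 * (1 / 2))%R.
      - apply Rmult_le_compat_l; lra.
      - unfold w0. lra. }
    specialize (H z Hz2). apply is_power_sum_Cser in H. fold w in H.
    assert (H' : Cser (fun n => c (k + n)%nat * w ^ (k + n)) (h z)).
    { clear - H Hmin. induction k as [|k IH]; [exact H|].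
      assert (K := IH ltac:(intros; apply Hmin; lia)). apply Cser_S_inv in K.
      rewrite Nat.add_0_r, Hmin in K by lia.
      replace (h z - 0 * w ^ k) with (h z) in K by ring. revert K.
      apply Cser_ext. intros n. now rewrite Nat.add_succ_r. }
    set (t := (Cmod w / w0)%R).
    assert (Ht : (0 <= t < tm)%R).
    { unfold t. split; [apply Rmult_le_pos; [apply Cmod_ge_0|left; now apply Rinv_0_lt_compat]|].
      apply Rmult_lt_reg_r with w0; auto.
      replace (Cmod w / w0 * w0)%R with (Cmod w) by (field; lra). lra. }
    assert (Hwk : (0 < Cmod (w ^ k))%R).
    { apply Cmod_pos, Cpow_nz. now apply Cminus_nz. }
    apply Cmod_pos_nz.
    apply Rlt_le_trans with (Cmod (w ^ k) * (Cmod (c k) / 2))%R.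
    { apply Rmult_lt_0_compat; lra. }
    apply Ccv_Cmod_ge with (fun n => csum (fun n => c (k + n)%nat * w ^ (k + n)) (S n)).
    { apply (Ccv_subseq (csum _) _ S); auto. }
    intros n. rewrite csum_S_l, Nat.add_0_r.
    assert (T1 : (Cmod (csum (fun j => c (k + S j)%nat * w ^ (k + S j))%C n)
        <= Cmod (w ^ k) * (Cmod (c k) / 2))%R).
    { apply Rle_trans with (1 := Cmod_csum_le _ _).
      apply Rle_trans with (rsum (fun j => Cmod (w ^ k) * (B * t) * t ^ j) n)%R.
      - apply rsum_le. intros j _. rewrite Cmod_mult, Cpow_add_r, Cmod_mult, (Cmod_pow w (S j)).
        pose proof (HB (S j)) as K.
        replace (Cmod w ^ S j)%R with (w0 ^ S j * t ^ S j)%R.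
        + replace (Cmod (c (k + S j)%nat) * (Cmod (w ^ k) * (w0 ^ S j * t ^ S j)))%R
            with (Cmod (w ^ k) * ((Cmod (c (k + S j)%nat) * w0 ^ S j) * t ^ S j))%R by ring.
          replace (Cmod (w ^ k) * (B * t) * t ^ j)%R
            with (Cmod (w ^ k) * (B * t ^ S j))%R by (simpl; ring).
          apply Rmult_le_compat_l; [lra|].
          apply Rmult_le_compat_r; auto. apply pow_le. lra.
        + rewrite <- Rpow_mult_distr. f_equal. unfold t. field. lra.
      - rewrite rsum_scal.
        assert (G : (rsum (fun j => t ^ j) n <= 2)%R).
        { apply Rle_trans with (/ (1 - t))%R; [apply rsum_geom_le; lra|].
          replace 2%R with (/ (1 / 2))%R by field. apply Rinv_le_contravar; lra. }
        rewrite Rmult_assoc. apply Rmult_le_compat_l; [lra|].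
        apply Rle_trans with (B * t * 2)%R.
        + apply Rmult_le_compat_l; auto. apply Rmult_le_pos; lra.
        + apply Rle_trans with (B * (Cmod (c k) / (4 * B)) * 2)%R.
          * apply Rmult_le_compat_r; [lra|]. apply Rmult_le_compat_l; lra.
          * right. field. lra. }
    pose proof (Cmod_rev_triangle (c k * w ^ k)
      (- csum (fun j => c (k + S j)%nat * w ^ (k + S j)) n)) as T2.
    rewrite Cmod_opp, Cmod_mult in T2.
    replace (c k * w ^ k - - csum (fun j => c (k + S j)%nat * w ^ (k + S j)) n)
      with (c k * w ^ k + csum (fun j => c (k + S j)%nat * w ^ (k + S j)) n) in T2 by ring.
    apply Rle_trans with (2 := T2). lra.
Qed.

(** Clearing denominators turns the difference into an analytic germ. *)
Lemma meromorphic_dichotomy f g z0 : meromorphic_at f z0 -> meromorphic_at g z0 ->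
  (exists r, (0 < r)%R /\ forall z, z <> z0 -> (Cmod (z - z0) < r)%R -> f z = g z) \/
  (exists r, (0 < r)%R /\ forall z, z <> z0 -> (Cmod (z - z0) < r)%R -> f z <> g z).
Proof.
  intros (h & k & r & Hh & H) (h' & k' & r' & Hh' & H').
  assert (A : analytic_at (fun z => h z * (z - z0) ^ k' + (- (1) + 0 * z) * (h' z * (z - z0) ^ k)) z0).
  { apply analytic_plus; [now apply analytic_pow|]. apply analytic_linear. now apply analytic_pow. }
  assert (Hm : forall r1, (0 < r1)%R -> (0 < Rmin r1 (Rmin r r'))%R).
  { intros r1 Hr1. apply Rmin_pos; auto. apply Rmin_pos; apply cond_pos. }
  destruct (analytic_dichotomy _ _ A) as [(r1 & Hr1 & K)|(r1 & Hr1 & K)]; [left|right];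
    exists (Rmin r1 (Rmin r r')); (split; [auto|]); intros z Hz1 Hz;
    pose proof (Rmin_l r1 (Rmin r r')); pose proof (Rmin_r r1 (Rmin r r'));
    pose proof (Rmin_l r r'); pose proof (Rmin_r r r');
    rewrite H, H' by (auto; lra); pose proof (Cminus_nz _ _ Hz1) as N;
    pose proof (Cpow_nz _ k N) as N1; pose proof (Cpow_nz _ k' N) as N2.
  - specialize (K z ltac:(lra)).
    assert (E : h z * (z - z0) ^ k' = h' z * (z - z0) ^ k).
    { replace (h z * (z - z0) ^ k') with
       (h z * (z - z0) ^ k' + (- (1) + 0 * z) * (h' z * (z - z0) ^ k)
        + h' z * (z - z0) ^ k) by ring. rewrite K. ring. }
    replace (h z / (z - z0) ^ k) with (h z * (z - z0) ^ k' / ((z - z0) ^ k * (z - z0) ^ k'))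
      by (field; auto). rewrite E. field. auto.
  - specialize (K z Hz1 ltac:(lra)). intros E. apply K.
    replace (h z) with (h z / (z - z0) ^ k * (z - z0) ^ k) by (field; auto).
    rewrite E. field. auto.
Qed.

(** Along the segment from 0 to [z], the set of parameters near which the two
    functions agree is open and, by [meromorphic_dichotomy], closed.  The segment may
    run through poles, since agreement is only asked on punctured neighbourhoods. *)
Theorem mero_cont_unique P c f g z :
  is_mero_cont P c f -> is_mero_cont P c g -> ~ P z -> f z = g z.
Proof.
  intros ((rf & F0) & F1 & F2) ((rg & G0) & G1 & G2) Hz.
  assert (MF : forall w, meromorphic_at f w).
  { intros w. destruct (excluded_middle_informative (P w)); auto using analytic_meromorphic. }
  assert (MG : forall w, meromorphic_at g w).
  { intros w. destruct (excluded_middle_informative (P w)); auto using analytic_meromorphic. }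
  assert (Z0 : forall w, (Cmod w < Rmin rf rg)%R -> f w = g w).
  { intros w Hw. pose proof (Rmin_l rf rg). pose proof (Rmin_r rf rg).
    specialize (F0 w ltac:(lra)). specialize (G0 w ltac:(lra)).
    apply is_power_sum_Cser in F0. apply is_power_sum_Cser in G0.
    apply (Cser_unique _ _ _ F0 G0). }
  assert (Hm : (0 < Rmin rf rg)%R) by (apply Rmin_pos; apply cond_pos).
  destruct (excluded_middle_informative (z = 0)) as [->|Hz0].
  { apply Z0. now rewrite Cmod_0. }
  pose proof (Cmod_pos _ Hz0) as Hz0'.
  set (E := fun t : R => exists r, (0 < r)%R /\
     forall w, w <> t * z -> (Cmod (w - t * z) < r)%R -> f w = g w).
  set (N := fun t : R => exists r, (0 < r)%R /\
     forall w, w <> t * z -> (Cmod (w - t * z) < r)%R -> f w <> g w).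
  assert (D : forall t, E t \/ N t).
  { intros t. destruct (meromorphic_dichotomy f g (t * z) (MF _) (MG _)); [left|right]; auto. }
  assert (dist : forall s t : R, Cmod (s * z - t * z) = (Rabs (s - t) * Cmod z)%R).
  { intros s t. replace (s * z - t * z) with (RtoC (s - t) * z) by (rewrite RtoC_minus; ring).
    now rewrite Cmod_mult, Cmod_R. }
  assert (neq : forall s t : R, s <> t -> s * z <> t * z).
  { intros s t Hst K. assert (K' : Cmod (s * z - t * z) = 0%R).
    { rewrite K. replace (t * z - t * z) with (RtoC 0) by ring. apply Cmod_0. }
    rewrite dist in K'. apply Rmult_integral in K'. destruct K' as [K'|K']; [|lra].
    apply Rabs_eq_0 in K'. lra. }
  (* A point of agreement cannot lie inside a region of disagreement. *)
  assert (EN : forall s t r, s <> t -> (0 < r)%R -> E s ->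
     (forall w, w <> t * z -> (Cmod (w - t * z) < r)%R -> f w <> g w) ->
     (Cmod (s * z - t * z) < r)%R -> False).
  { intros s t r Hst Hr (r1 & Hr1 & Es) Nt Hd.
    pose proof (neq _ _ Hst) as Hne. pose proof (Cmod_pos _ (Cminus_nz _ _ Hne)) as Hp.
    set (e := (Rmin r1 (Rmin (r - Cmod (s * z - t * z)) (Cmod (s * z - t * z))) / 2)%R).
    pose proof (Rmin_l r1 (Rmin (r - Cmod (s * z - t * z)) (Cmod (s * z - t * z)))).
    pose proof (Rmin_r r1 (Rmin (r - Cmod (s * z - t * z)) (Cmod (s * z - t * z)))).
    pose proof (Rmin_l (r - Cmod (s * z - t * z)) (Cmod (s * z - t * z))).
    pose proof (Rmin_r (r - Cmod (s * z - t * z)) (Cmod (s * z - t * z))).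
    assert (He : (0 < e)%R).
    { unfold e. apply Rdiv_lt_0_compat; [|lra]. apply Rmin_pos; auto. apply Rmin_pos; lra. }
    assert (Ce : Cmod e = e) by (rewrite Cmod_R; apply Rabs_pos_eq; lra).
    assert (e0 : RtoC e <> 0) by (intros K; apply RtoC_inj in K; lra).
    apply (Nt (s * z + e)).
    - intros K. assert (K' : Cmod (s * z - t * z) = e).
      { rewrite <- K. replace (s * z - (s * z + e)) with (- e) by ring. now rewrite Cmod_opp. }
      unfold e in *. lra.
    - replace (s * z + e - t * z) with ((s * z - t * z) + e) by ring.
      pose proof (Cmod_triangle (s * z - t * z) e). unfold e in *. lra.
    - apply Es.
      + intros K. apply e0. replace (RtoC e) with (s * z + e - s * z) by ring. rewrite K. ring.
      + replace (s * z + e - s * z) with (RtoC e) by ring. rewrite Ce. unfold e in *. lra. }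
  assert (start : (0 <= 0 <= 1)%R /\ forall s, (0 <= s <= 0)%R -> E s).
  { split; [lra|]. intros s Hs. exists (Rmin rf rg). split; auto.
    intros w _ Hw. apply Z0. replace s with 0%R in Hw by lra.
    replace (w - 0 * z) with w in Hw by ring. exact Hw. }
  assert (E01 : E 1%R).
  { destruct (completeness (fun t => (0 <= t <= 1)%R /\ forall s, (0 <= s <= t)%R -> E s))
      as [m [Hm1 Hm2]].
    { exists 1%R. intros t [Ht _]. lra. }
    { exists 0%R. exact start. }
    assert (Hm01 : (0 <= m <= 1)%R).
    { split.
      - apply Hm1. exact start.
      - apply Hm2. intros t [Ht _]. lra. }
    assert (app : forall d, (0 < d)%R -> exists t, (m - d < t <= m)%R /\
              (0 <= t <= 1)%R /\ forall s, (0 <= s <= t)%R -> E s).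
    { intros d Hd. apply NNPP. intros K. assert (m <= m - d)%R; [|lra].
      apply Hm2. intros t Ht. apply Rnot_lt_le. intros L. apply K. exists t.
      pose proof (Hm1 t Ht). split; [lra|exact Ht]. }
    assert (Em : E m).
    { destruct (D m) as [Em|(r & Hr & Nm)]; auto.
      destruct (app (r / Cmod z)%R) as (t & Ht1 & Ht2 & Ht3).
      { now apply Rdiv_lt_0_compat. }
      assert (Et := Ht3 t ltac:(lra)).
      destruct (Req_dec t m) as [->|Htm]; auto. exfalso.
      apply (EN t m r Htm Hr Et Nm). rewrite dist, Rabs_left by lra.
      replace r with (r / Cmod z * Cmod z)%R by (field; lra).
      apply Rmult_lt_compat_r; lra. }
    destruct Em as (r & Hr & Em).
    assert (near : forall s, (Rabs (s - m) * Cmod z < r)%R -> E s).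
    { intros s Hs. destruct (Req_dec s m) as [->|Hsm]; [exists r; auto|].
      pose proof (neq _ _ Hsm) as Hne. pose proof (Cmod_pos _ (Cminus_nz _ _ Hne)) as Hp.
      rewrite <- dist in Hs.
      exists (Rmin (r - Cmod (s * z - m * z)) (Cmod (s * z - m * z))).
      pose proof (Rmin_l (r - Cmod (s * z - m * z)) (Cmod (s * z - m * z))).
      pose proof (Rmin_r (r - Cmod (s * z - m * z)) (Cmod (s * z - m * z))).
      split; [apply Rmin_pos; lra|]. intros w Hw1 Hw. apply Em.
      - intros ->. rewrite Cmod_minus_sym in Hw. lra.
      - pose proof (Cmod_triangle (w - s * z) (s * z - m * z)) as T.
        replace (w - s * z + (s * z - m * z)) with (w - m * z) in T by ring. lra. }
    destruct (Req_dec m 1) as [->|Hm1']; [now exists r|]. exfalso.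
    set (d := (Rmin (r / Cmod z) (1 - m) / 2)%R).
    pose proof (Rmin_l (r / Cmod z) (1 - m)). pose proof (Rmin_r (r / Cmod z) (1 - m)).
    assert (Hrz : (0 < r / Cmod z)%R) by now apply Rdiv_lt_0_compat.
    assert (Hd : (0 < d)%R).
    { unfold d. apply Rdiv_lt_0_compat; [|lra]. apply Rmin_pos; lra. }
    destruct (app d Hd) as (t & Ht1 & Ht2 & Ht3).
    assert (m + d <= m)%R; [|lra]. apply Hm1. split; [unfold d in *; lra|].
    intros s Hs. destruct (Rle_dec s t) as [L|L]; [apply Ht3; lra|].
    apply near. replace r with (r / Cmod z * Cmod z)%R by (field; lra).
    apply Rmult_lt_compat_r; auto. unfold d in *. apply Rabs_def1; lra. }
  destruct E01 as (r & Hr & E1).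
  assert (A : analytic_at (fun w => f w + (- (1) + 0 * w) * g w) z).
  { apply analytic_plus; auto. apply analytic_linear. auto. }
  destruct (analytic_dichotomy _ _ A) as [(r1 & Hr1 & K)|(r1 & Hr1 & K)].
  - specialize (K z). replace (z - z) with (RtoC 0) in K by ring. rewrite Cmod_0 in K.
    specialize (K Hr1). replace (f z) with (f z + (- (1) + 0 * z) * g z + g z) by ring.
    rewrite K. ring.
  - exfalso. pose proof (Rmin_pos r r1 Hr Hr1). pose proof (Rmin_l r r1). pose proof (Rmin_r r r1).
    set (e := (Rmin r r1 / 2)%R) in *.
    assert (He : (0 < e)%R) by (unfold e; lra).
    assert (Ce : Cmod e = e) by (rewrite Cmod_R; apply Rabs_pos_eq; lra).
    assert (e0 : z + e <> z).
    { intros K1. assert (K2 : RtoC e = 0) by (replace (RtoC e) with (z + e - z) by ring; rewrite K1; ring).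
      apply RtoC_inj in K2. lra. }
    assert (de : Cmod (z + e - z) = e) by (replace (z + e - z) with (RtoC e) by ring; exact Ce).
    apply (K (z + e)); auto; [rewrite de; unfold e; lra|].
    rewrite (E1 (z + e)); [ring| |].
    + replace (1 * z) with z by ring. auto.
    + replace (z + e - 1 * z) with (z + e - z) by ring. rewrite de. unfold e. lra.
Qed.

(** * Continuation by a q-difference equation *)

Lemma qpoles_shift (q z : C) k : q <> 0 -> qpoles q (q ^ k * z) -> qpoles q z.
Proof.
  intros Hq [n E]. exists (n + k)%nat. rewrite Cpow_add_r.
  replace z with (q ^ k * z / q ^ k) by (field; now apply Cpow_nz).
  rewrite E. field. split; now apply Cpow_nz.
Qed.

Lemma qpoles_Cmod (q z : C) : (0 < Cmod q < 1)%R -> qpoles q z -> (1 <= Cmod z)%R.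
Proof.
  intros Hq [n ->]. pose proof (q_nz q Hq). rewrite Cmod_inv by now apply Cpow_nz.
  rewrite Cmod_pow. rewrite <- Rinv_1 at 1. apply Rinv_le_contravar.
  - apply pow_lt. lra.
  - rewrite <- (pow1 n). apply pow_incr. lra.
Qed.

Lemma bounded_power_summable c z B : (forall n, (Cmod (c n) <= B)%R) -> (Cmod z < 1)%R ->
  csummable (fun n => c n * z ^ n).
Proof.
  intros HB Hz. apply csummable_le with (fun n => B * Cmod z ^ n)%R.
  - intros n. rewrite Cmod_mult, Cmod_pow. apply Rmult_le_compat_r; auto.
    apply pow_le, Cmod_ge_0.
  - apply rsummable_scal.
    + specialize (HB O). pose proof (Cmod_ge_0 (c O)). lra.
    + apply rsummable_geom. split; auto using Cmod_ge_0.
Qed.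

Section Continuation.
Context (q s al1 al2 al3 be1 be2 be3 : C) (c : nat -> C).
Context (hq : (0 < Cmod q < 1)%R) (hs : Cmod s = 1%R).
Context (B : R) (hB : forall n, (Cmod (c n) <= B)%R).
Context (hbe : 1 + be1 + be2 + be3 = 0).
Context (hrec : forall n,
  (1 + be1 * q ^ S n + be2 * (q ^ S n) ^ 2 + be3 * (q ^ S n) ^ 3) * c (S n)
  = s * (1 + al1 * q ^ n + al2 * (q ^ n) ^ 2 + al3 * (q ^ n) ^ 3) * c n).

(** The q-difference equation, solved for the value at the point farthest from
    the origin. *)
Definition qstep (F : C -> C) (z : C) : C :=
  ((- be1 + s * al1 * z) * F (q * z) + (- be2 + s * al2 * z) * F (q ^ 2 * z)
   + (- be3 + s * al3 * z) * F (q ^ 3 * z)) / (1 - s * z).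

(** Each application of [qstep] enlarges by the factor [1 / |q|] the disc on which
    the function is the continuation; beyond that disc the values are meaningless. *)
Fixpoint qextend (k : nat) : C -> C :=
  match k with
  | O => fun z => CSeries (fun n => c n * z ^ n)
  | S j => qstep (qextend j)
  end.

Lemma qpow_Cmod_le z i : (Cmod (q ^ i * z) <= Cmod z)%R.
Proof using hq.
  rewrite Cmod_mult, Cmod_pow. pose proof (Cmod_ge_0 z).
  pose proof (pow_01 (Cmod q) i ltac:(lra)).
  nra.
Qed.

Lemma qextend_0_Cser z : (Cmod z < 1)%R -> Cser (fun n => c n * z ^ n) (qextend 0 z).
Proof using hB. intros Hz. apply csummable_Cser. now apply bounded_power_summable with B. Qed.

Lemma qextend_0_scaled z i : (Cmod z < 1)%R ->
  Cser (fun n => c n * ((q ^ n) ^ i * z ^ n)) (qextend 0 (q ^ i * z)).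
Proof using hq hB.
  intros Hz. assert (Hz' : (Cmod (q ^ i * z) < 1)%R) by (pose proof (qpow_Cmod_le z i); lra).
  generalize (qextend_0_Cser _ Hz'). apply Cser_ext. intros n.
  now rewrite Cpow_mult_l, <- !Cpow_mult_r, (Nat.mul_comm i n).
Qed.

Lemma disc_not_pole z : (Cmod z < 1)%R -> 1 - s * z <> 0.
Proof using hs.
  intros Hz. apply Cmod_pos_nz. pose proof (Cmod_rev_triangle 1 (s * z)) as T.
  rewrite Cmod_mult, hs, Cmod_1 in T. lra.
Qed.

(** In the disc of convergence the functional equation is the recurrence of the
    coefficients, read termwise. *)
Lemma qextend_0_step z : (Cmod z < 1)%R -> qstep (qextend 0) z = qextend 0 z.
Proof using hq hs hB hbe hrec.
  intros Hz.
  pose proof (qextend_0_Cser z Hz) as S0.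
  pose proof (qextend_0_scaled z 1 Hz) as S1. pose proof (qextend_0_scaled z 2 Hz) as S2.
  pose proof (qextend_0_scaled z 3 Hz) as S3.
  replace (q ^ 1 * z) with (q * z) in S1 by (simpl; ring).
  assert (L := Cser_plus _ _ _ _ (Cser_plus _ _ _ _ S0 (Cser_scal be1 _ _ S1))
     (Cser_plus _ _ _ _ (Cser_scal be2 _ _ S2) (Cser_scal be3 _ _ S3))).
  assert (R := Cser_scal (s * z) _ _ (Cser_plus _ _ _ _
     (Cser_plus _ _ _ _ S0 (Cser_scal al1 _ _ S1))
     (Cser_plus _ _ _ _ (Cser_scal al2 _ _ S2) (Cser_scal al3 _ _ S3)))).
  cbv beta in L, R. apply Cser_S_inv in L. cbv beta in L.
  set (f := qextend 0) in *. unfold qstep.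
  match type of L with Cser ?a ?l => match type of R with Cser ?b ?m =>
    assert (E : l = m); [apply (Cser_unique b); [|exact R];
      revert L; apply Cser_ext|] end end.
  { intros n. rewrite !Cpow_1_r.
    transitivity ((1 + be1 * q ^ S n + be2 * (q ^ S n) ^ 2 + be3 * (q ^ S n) ^ 3) * c (S n)
                   * (z * z ^ n)); [rewrite (Cpow_S z n); ring|].
    rewrite hrec. ring. }
  assert (E0 : c O * z ^ 0 + be1 * (c O * ((q ^ 0) ^ 1 * z ^ 0)) +
     (be2 * (c O * ((q ^ 0) ^ 2 * z ^ 0)) + be3 * (c O * ((q ^ 0) ^ 3 * z ^ 0))) = 0).
  { transitivity ((1 + be1 + be2 + be3) * c O); [simpl; ring|]. rewrite hbe. ring. }
  rewrite E0 in E. pose proof (disc_not_pole z Hz) as N.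
  match goal with |- ?x / _ = _ => replace x with (f z * (1 - s * z)) end.
  - field. auto.
  - transitivity (f z - s * z * (f z + al1 * f (q * z) + (al2 * f (q ^ 2 * z) + al3 * f (q ^ 3 * z)))
       + s * z * (al1 * f (q * z) + (al2 * f (q ^ 2 * z) + al3 * f (q ^ 3 * z)))); [ring|].
    rewrite <- E. ring.
Qed.

(** [qstep] only looks at [q z], [q^2 z], [q^3 z], where the previous step already
    stabilises.  At a pole both sides are the same division by zero. *)
Lemma qextend_step_eq k z : (Cmod z * Cmod q ^ k < 1)%R ->
  qextend (S k) z = qextend k z.
Proof using hq hs hB hbe hrec.
  revert z. induction k as [|k IH]; intros z Hz.
  - apply qextend_0_step. simpl in Hz. lra.
  - change (qextend (S (S k)) z) with (qstep (qextend (S k)) z).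
    change (qextend (S k) z) with (qstep (qextend k) z). unfold qstep.
    assert (K : forall i, (1 <= i)%nat -> qextend (S k) (q ^ i * z) = qextend k (q ^ i * z)).
    { intros i Hi. apply IH. destruct i as [|i]; [lia|].
      replace (q ^ S i * z) with (q ^ i * (q * z)) by (simpl; ring).
      pose proof (qpow_Cmod_le (q * z) i) as T. rewrite (Cmod_mult q z) in T. simpl in Hz.
      assert (0 <= Cmod q ^ k)%R by (apply pow_le; lra). nra. }
    pose proof (K 1%nat ltac:(lia)) as K1. replace (q ^ 1 * z) with (q * z) in K1 by (simpl; ring).
    rewrite K1, !K by lia. reflexivity.
Qed.

Lemma qextend_stable k j z : (Cmod z * Cmod q ^ k < 1)%R -> qextend (k + j) z = qextend k z.
Proof using hq hs hB hbe hrec.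
  intros Hz. induction j as [|j IH]; [now rewrite Nat.add_0_r|].
  rewrite Nat.add_succ_r, qextend_step_eq; auto. rewrite pow_add.
  pose proof (pow_01 (Cmod q) j ltac:(lra)).
  assert (0 <= Cmod z * Cmod q ^ k)%R.
  { apply Rmult_le_pos; [apply Cmod_ge_0|apply pow_le; lra]. }
  rewrite <- Rmult_assoc. nra.
Qed.

(** Scaling, multiplication by linear factors and addition preserve the class of
    germs; only the division by [1 - s z] can create a pole. *)
Lemma qextend_germ k z :
  (Cmod z * Cmod q ^ k < 1)%R ->
  meromorphic_at (qextend k) z /\ (~ qpoles q (s * z) -> analytic_at (qextend k) z).
Proof using hq hs hB.
  pose proof (q_nz q hq) as Hq.
  assert (Hs0 : s <> 0) by (apply Cmod_pos_nz; lra).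
  revert z. induction k as [|k IH]; intros z Hz.
  - assert (A : analytic_at (qextend 0) z).
    { apply (power_sum_analytic c _ 1); [|simpl in Hz; lra].
      intros w Hw. apply is_power_sum_Cser. now apply qextend_0_Cser. }
    split; auto using analytic_meromorphic.
  - assert (K : forall i, (1 <= i)%nat -> (Cmod (q ^ i * z) * Cmod q ^ k < 1)%R).
    { intros i Hi. destruct i as [|i]; [lia|].
      replace (q ^ S i * z) with (q ^ i * (q * z)) by (simpl; ring).
      pose proof (qpow_Cmod_le (q * z) i) as T. rewrite (Cmod_mult q z) in T. simpl in Hz.
      assert (0 <= Cmod q ^ k)%R by (apply pow_le; lra). nra. }
    change (qextend (S k)) with (qstep (qextend k)).
    assert (M : forall i u v, (1 <= i)%nat ->
      meromorphic_at (fun w => (u + v * w) * qextend k (q ^ i * w)) z).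
    { intros i u v Hi.
      apply (meromorphic_linear u v (fun w => qextend k (q ^ i * w))).
      apply meromorphic_scale; [now apply Cpow_nz|]. apply IH. auto. }
    assert (A : forall i u v, (1 <= i)%nat -> ~ qpoles q (s * z) ->
      analytic_at (fun w => (u + v * w) * qextend k (q ^ i * w)) z).
    { intros i u v Hi Hp.
      apply (analytic_linear u v (fun w => qextend k (q ^ i * w))).
      apply analytic_scale; [now apply Cpow_nz|]. apply IH; auto.
      intros P. apply Hp. apply (qpoles_shift q _ i); auto.
      now replace (q ^ i * (s * z)) with (s * (q ^ i * z)) by ring. }
    assert (E : forall w, qstep (qextend k) w =
       ((- be1 + s * al1 * w) * qextend k (q ^ 1 * w) + (- be2 + s * al2 * w) * qextend k (q ^ 2 * w)
       + (- be3 + s * al3 * w) * qextend k (q ^ 3 * w)) / (1 - s * w)).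
    { intros w. unfold qstep. now replace (q ^ 1 * w) with (q * w) by (simpl; ring). }
    split.
    + apply (meromorphic_ext _ _ _ 1 Rlt_0_1 (fun w _ => E w)).
      apply meromorphic_div; auto; [lra|].
      apply meromorphic_plus; [apply meromorphic_plus|]; apply M; lia.
    + intros Hp. apply (analytic_ext _ _ _ 1 Rlt_0_1 (fun w _ => E w)).
      apply analytic_div; [lra| |].
      * intros E1. apply Hp. exists O. rewrite E1. simpl. field.
      * apply analytic_plus; [apply analytic_plus|]; apply A; auto; lia.
Qed.

(** The continuation at [z] is the common value of all late enough [qextend k].
    By uniqueness the function selected by [mero_cont] agrees with it off [P], so it
    inherits the q-difference equation. *)
Theorem qdiff_continuation (P : C -> Prop) :
  (forall z, P z <-> qpoles q (s * z)) ->
  let f := mero_cont P c in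
  (forall z, (Cmod z < 1)%R -> Cser (fun n => c n * z ^ n) (f z)) /\
  (forall z, ~ qpoles q (s * z) ->
     f z + be1 * f (q * z) + be2 * f (q ^ 2 * z) + be3 * f (q ^ 3 * z)
     = s * z * (f z + al1 * f (q * z) + al2 * f (q ^ 2 * z) + al3 * f (q ^ 3 * z))).
Proof using hq hs hB hbe hrec.
  intros HP f. pose proof (q_nz q hq) as Hq.
  assert (Hs0 : s <> 0) by (apply Cmod_pos_nz; lra).
  assert (Hlev : forall z, exists k, (Cmod z * Cmod q ^ k < 1)%R).
  { intros z. pose proof (Cmod_ge_0 z).
    destruct (pow_small (Cmod q) (/ (Cmod z + 1))) as [N HN]; [lra|apply Rinv_0_lt_compat; lra|].
    exists N. specialize (HN N (le_n N)).
    apply Rle_lt_trans with (Cmod z * / (Cmod z + 1))%R; [apply Rmult_le_compat_l; lra|].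
    apply Rmult_lt_reg_r with (Cmod z + 1)%R; [lra|].
    rewrite Rmult_assoc, Rinv_l by lra. lra. }
  set (lev := fun z => epsilon (inhabits O) (fun k => (Cmod z * Cmod q ^ k < 1)%R)).
  assert (Hl : forall z, (Cmod z * Cmod q ^ lev z < 1)%R).
  { intros z. unfold lev. apply epsilon_spec. apply Hlev. }
  set (F := fun z => qextend (lev z) z).
  assert (HF : forall k z, (Cmod z * Cmod q ^ k < 1)%R -> F z = qextend k z).
  { intros k z Hz. unfold F. rewrite <- (qextend_stable (lev z) k) by auto.
    rewrite Nat.add_comm. now apply qextend_stable. }
  assert (HFloc : forall z0, exists k, (Cmod z0 * Cmod q ^ k < 1)%R /\
      forall z, (Cmod (z - z0) < 1)%R -> F z = qextend k z).
  { intros z0. destruct (Hlev (RtoC (Cmod z0 + 1))) as [k Hk]. exists k.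
    pose proof (Cmod_ge_0 z0). rewrite Cmod_R, Rabs_pos_eq in Hk by lra.
    assert (Hp : (0 < Cmod q ^ k)%R) by (apply pow_lt; lra).
    split; [nra|]. intros z Hz. apply HF.
    pose proof (Cmod_rev_triangle z z0). nra. }
  assert (HFP : is_mero_cont P c F).
  { split; [|split].
    - exists (mkposreal 1 Rlt_0_1). simpl. intros z Hz. apply is_power_sum_Cser.
      rewrite (HF O) by (simpl; lra). now apply qextend_0_Cser.
    - intros z Hz. destruct (HFloc z) as (k & Hk & E).
      apply (analytic_ext _ (qextend k) _ 1 Rlt_0_1 E). apply qextend_germ; auto.
      intros K. apply Hz. now apply HP.
    - intros z Hz. destruct (HFloc z) as (k & Hk & E).
      apply (meromorphic_ext _ (qextend k) _ 1 Rlt_0_1 E). now apply qextend_germ. }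
  assert (Hf : is_mero_cont P c f).
  { unfold f, mero_cont. apply epsilon_spec. now exists F. }
  assert (HfF : forall z, ~ qpoles q (s * z) -> f z = F z).
  { intros z Hz. apply (mero_cont_unique P c); auto. intros K. apply Hz. now apply HP. }
  split.
  - intros z Hz. rewrite HfF.
    + rewrite (HF O) by (simpl; lra). now apply qextend_0_Cser.
    + intros K. apply (qpoles_Cmod q _ hq) in K. rewrite Cmod_mult, hs in K. lra.
  - intros z Hz.
    assert (Hi : forall i, f (q ^ i * z) = F (q ^ i * z)).
    { intros i. apply HfF. intros K. apply Hz. apply (qpoles_shift q _ i); auto.
      now replace (q ^ i * (s * z)) with (s * (q ^ i * z)) by ring. }
    pose proof (Hi 1%nat) as H1. replace (q ^ 1 * z) with (q * z) in H1 by (simpl; ring).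
    rewrite H1, !Hi, HfF by auto. clear H1 Hi.
    destruct (Hlev z) as [k Hk].
    assert (Hi : forall i, F (q ^ i * z) = qextend k (q ^ i * z)).
    { intros i. apply HF. pose proof (qpow_Cmod_le z i).
      assert (0 <= Cmod q ^ k)%R by (apply pow_le; lra). nra. }
    pose proof (Hi 1%nat) as H1. replace (q ^ 1 * z) with (q * z) in H1 by (simpl; ring).
    rewrite H1, !Hi, (HF k z) by auto.
    set (g := qextend k) in *.
    assert (E : qstep g z = g z) by (apply qextend_step_eq; auto).
    unfold qstep in E.
    assert (N : 1 - s * z <> 0).
    { apply Cminus_nz. intros K. apply Hz. exists O. rewrite <- K. simpl. field. }
    match type of E with ?x / _ = _ => assert (E2 : x = g z * (1 - s * z)) end.
    { rewrite <- E. field. auto. }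
    match type of E2 with ?x = _ => transitivity (s * z * (g z + al1 * g (q * z) +
        al2 * g (q ^ 2 * z) + al3 * g (q ^ 3 * z)) + (g z * (1 - s * z) - x)); [ring|] end.
    rewrite E2. ring.
Qed.
End Continuation.

(** * Partial fractions *)

Fixpoint cprod (f : nat -> C) (n : nat) : C :=
  match n with O => 1 | S m => cprod f m * f m end.

(** The product with the factor of index [i] left out. *)
Definition cprodx (i : nat) (f : nat -> C) (n : nat) : C :=
  cprod (fun k => if (k =? i)%nat then 1 else f k) n.

(** Consecutive numbering of two families, the first of length [M].  It lets
    [partial_fractions] be applied to families of nodes given by different
    formulas. *)
Definition glue {A : Type} (M : nat) (f g : nat -> A) (i : nat) : A :=
  if (i <? M)%nat then f i else g (i - M)%nat.

Lemma cprod_ext f g n : (forall k, (k < n)%nat -> f k = g k) -> cprod f n = cprod g n.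
Proof.
  induction n as [|n IH]; intros H; simpl; [auto|].
  rewrite IH by (intros; apply H; lia). now rewrite H by lia.
Qed.

Lemma cprod_app f n m : cprod f (n + m) = cprod f n * cprod (fun k => f (n + k)%nat) m.
Proof.
  induction m as [|m IH]; [rewrite Nat.add_0_r; simpl; ring|].
  rewrite Nat.add_succ_r. simpl. rewrite IH. ring.
Qed.

Lemma cprod_mult f g n : cprod (fun k => f k * g k) n = cprod f n * cprod g n.
Proof. induction n as [|n IH]; simpl; [|rewrite IH]; ring. Qed.

Lemma cprod_const c n : cprod (fun _ => c) n = c ^ n.
Proof. induction n as [|n IH]; simpl; [|rewrite IH]; ring. Qed.

Lemma cprod_nz (f : nat -> C) n : (forall k, (k < n)%nat -> f k <> 0) -> cprod f n <> 0.
Proof.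
  induction n as [|n IH]; intros H; simpl; [apply C1_nz|].
  apply Cmult_neq_0; [apply IH; intros|]; apply H; lia.
Qed.

Lemma cprodx_nz (f : nat -> C) i n :
  (forall k, (k < n)%nat -> k <> i -> f k <> 0) -> cprodx i f n <> 0.
Proof.
  intros H. apply cprod_nz. intros k Hk. destruct (Nat.eqb_spec k i); auto using C1_nz.
Qed.

Lemma cprodx_ext i f g n : (forall k, (k < n)%nat -> f k = g k) -> cprodx i f n = cprodx i g n.
Proof. intros H. apply cprod_ext. intros k Hk. now rewrite H. Qed.

Lemma cprodx_S i f n : i <> n -> cprodx i f (S n) = cprodx i f n * f n.
Proof. intros H. unfold cprodx. simpl. destruct (Nat.eqb_spec n i); [lia|auto]. Qed.

Lemma cprodx_out i f n : (n <= i)%nat -> cprodx i f n = cprod f n.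
Proof.
  intros H. apply cprod_ext. intros k Hk. destruct (Nat.eqb_spec k i); [lia|auto].
Qed.

Lemma cprodx_last n f : cprodx n f (S n) = cprod f n.
Proof.
  unfold cprodx. simpl. rewrite Nat.eqb_refl.
  fold (cprodx n f n). rewrite cprodx_out by lia. ring.
Qed.

Lemma glue_l {A} M (f g : nat -> A) i : (i < M)%nat -> glue M f g i = f i.
Proof. intros H. unfold glue. destruct (Nat.ltb_spec i M); [auto|lia]. Qed.

Lemma glue_r {A} M (f g : nat -> A) i : glue M f g (M + i) = g i.
Proof.
  unfold glue. destruct (Nat.ltb_spec (M + i) M); [lia|]. f_equal. lia.
Qed.

Lemma cprod_glue M f g n : cprod (glue M f g) (M + n) = cprod f M * cprod g n.
Proof.
  rewrite cprod_app. f_equal; apply cprod_ext; intros k Hk; [now apply glue_l|apply glue_r].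
Qed.

Lemma cprodx_glue_l M f g n i : (i < M)%nat ->
  cprodx i (glue M f g) (M + n) = cprodx i f M * cprod g n.
Proof.
  intros Hi. unfold cprodx. rewrite cprod_app. f_equal; apply cprod_ext; intros k Hk.
  - now rewrite glue_l.
  - destruct (Nat.eqb_spec (M + k) i); [lia|apply glue_r].
Qed.

Lemma cprodx_glue_r M f g n i :
  cprodx (M + i) (glue M f g) (M + n) = cprod f M * cprodx i g n.
Proof.
  unfold cprodx. rewrite cprod_app. f_equal; apply cprod_ext; intros k Hk.
  - destruct (Nat.eqb_spec k (M + i)); [lia|now apply glue_l].
  - rewrite glue_r. destruct (Nat.eqb_spec (M + k) (M + i)), (Nat.eqb_spec k i); auto; lia.
Qed.

(** Induction on the number of nodes.  Adding the node [x_M] splits each old term by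
    [l(x_i)/(d_M(x_i) d_i(t)) = (l(t)/d_i(t) - l(x_M)/d_i(x_M)) / d_M(t)],
    where [l] is the new factor of the numerator and [d_i(t) = v_i (t - x_i)]; the
    expansion at [t = x_M], known by induction, collects the subtracted parts.  The
    normalisations [v_i] are free because the factors will be [t - q^n] and
    [1 - a q^m t]. *)
Lemma partial_fractions (x v p r : nat -> C) N t :
  (forall i, (i <= N)%nat -> v i <> 0) ->
  (forall i j, (i <= N)%nat -> (j <= N)%nat -> i <> j -> x i <> x j) ->
  (forall i, (i <= N)%nat -> t <> x i) ->
  csum (fun i => cprod (fun s => p s + r s * x i) N /
          (cprodx i (fun k => v k * (x i - x k)) (S N) * (v i * (t - x i)))) (S N)
  = cprod (fun s => p s + r s * t) N / cprod (fun k => v k * (t - x k)) (S N).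
Proof.
  revert t. induction N as [|N IH]; intros t Hv Hx Ht.
  - simpl. rewrite cprodx_last. simpl. field. split.
    + apply Cminus_nz. apply Ht. lia.
    + apply Hv. lia.
  - set (M := S N) in *.
    assert (dnz : forall i j, (i <= M)%nat -> (j <= M)%nat -> i <> j -> v i * (x j - x i) <> 0).
    { intros i j Hi Hj Hij. apply Cmult_neq_0; [now apply Hv|]. apply Cminus_nz.
      apply Hx; auto. }
    assert (tnz : forall i, (i <= M)%nat -> v i * (t - x i) <> 0).
    { intros i Hi. apply Cmult_neq_0; [now apply Hv|]. apply Cminus_nz. auto. }
    pose proof (IH t ltac:(intros; apply Hv; lia) ltac:(intros; apply Hx; lia)
      ltac:(intros; apply Ht; lia)) as IHt.
    pose proof (IH (x M) ltac:(intros; apply Hv; lia) ltac:(intros; apply Hx; lia)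
      ltac:(intros; apply Hx; lia)) as IHM.
    cbn [csum]. fold (csum (fun i => cprod (fun s => p s + r s * x i) M /
          (cprodx i (fun k => v k * (x i - x k)) (S M) * (v i * (t - x i)))) M).
    rewrite (csum_ext _ (fun i =>
       (p N + r N * t) / (v M * (t - x M)) *
          (cprod (fun s => p s + r s * x i) N /
          (cprodx i (fun k => v k * (x i - x k)) M * (v i * (t - x i)))) +
       - ((p N + r N * x M) / (v M * (t - x M))) *
          (cprod (fun s => p s + r s * x i) N /
          (cprodx i (fun k => v k * (x i - x k)) M * (v i * (x M - x i)))))).
    + rewrite csum_plus, !csum_scal, IHt, IHM.
      rewrite cprodx_last. cbn [cprod].
      change (cprod (fun s => p s + r s * x M) M)
        with (cprod (fun s => p s + r s * x M) N * (p N + r N * x M)).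
      change (cprod (fun s => p s + r s * t) M)
        with (cprod (fun s => p s + r s * t) N * (p N + r N * t)).
      assert (N1 : cprod (fun k => v k * (t - x k)) M <> 0).
      { apply cprod_nz. intros k Hk. apply tnz. lia. }
      assert (N2 : cprod (fun k => v k * (x M - x k)) M <> 0).
      { apply cprod_nz. intros k Hk. apply dnz; lia. }
      assert (N3 : t - x M <> 0) by (apply Cminus_nz; apply Ht; lia).
      assert (N4 : v M <> 0) by (apply Hv; lia).
      field. auto.
    + intros i Hi. rewrite cprodx_S by lia.
      change (cprod (fun s => p s + r s * x i) M)
        with (cprod (fun s => p s + r s * x i) N * (p N + r N * x i)).
      assert (N1 : cprodx i (fun k => v k * (x i - x k)) M <> 0).
      { apply cprodx_nz. intros k Hk Hki. apply dnz; lia. }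
      assert (N2 : t - x M <> 0) by (apply Cminus_nz; apply Ht; lia).
      assert (N3 : t - x i <> 0) by (apply Cminus_nz; apply Ht; lia).
      assert (N4 : x M - x i <> 0) by (apply Cminus_nz; apply Hx; lia).
      assert (N4' : x i - x M <> 0) by (apply Cminus_nz; apply Hx; lia).
      assert (N5 : v M <> 0) by (apply Hv; lia).
      assert (N6 : v i <> 0) by (apply Hv; lia).
      field. repeat split; auto.
Qed.

(** * Residues of the truncated products *)

Lemma cprod_qpoch q a t n : cprod (fun k => 1 - a * q ^ k * t) n = qpoch (a * t) q n.
Proof. induction n as [|n IH]; simpl; [auto|]. rewrite IH. ring. Qed.

Lemma cprod_qpoch_inv (q xi t : C) n : t <> 0 ->
  cprod (fun k => xi * q ^ k + t) n = t ^ n * qpoch (- xi / t) q n.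
Proof. intros Ht. induction n as [|n IH]; simpl; [ring|]. rewrite IH. field. auto. Qed.

(** The product of [1 - q^(k-m)] over [k < M], without its vanishing factor
    [k = m]. *)
Definition qpoch_omit (q : C) (M m : nat) : C :=
  qpoch (/ q ^ m) q m * qpoch q q (M - 1 - m).

Lemma cprodx_qpoch_omit (q : C) M m : q <> 0 -> (m < M)%nat ->
  cprodx m (fun k => 1 - q ^ k * / q ^ m) M = qpoch_omit q M m.
Proof.
  intros Hq Hm. replace M with (m + S (M - 1 - m))%nat at 1 by lia.
  unfold cprodx. rewrite cprod_app. unfold qpoch_omit. f_equal.
  - transitivity (qpoch (1 * / q ^ m) q m); [|f_equal; ring].
    rewrite <- cprod_qpoch. apply cprod_ext. intros k Hk.
    destruct (Nat.eqb_spec k m); [lia|]. ring.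
  - change (S (M - 1 - m)) with (1 + (M - 1 - m))%nat. rewrite cprod_app. simpl.
    rewrite Nat.add_0_r, Nat.eqb_refl.
    transitivity (1 * 1 * qpoch (q * 1) q (M - 1 - m)); [|rewrite (Cmult_1_r q); ring].
    rewrite <- cprod_qpoch. f_equal. apply cprod_ext. intros k Hk.
    destruct (Nat.eqb_spec (m + S k) m); [lia|].
    rewrite Cpow_add_r, Cpow_S. field. now apply Cpow_nz.
Qed.

Lemma cprodx_scal m c f M : (m < M)%nat ->
  cprodx m (fun k => c * f k) M = c ^ (M - 1) * cprodx m f M.
Proof.
  intros Hm. induction M as [|M IH]; [lia|].
  destruct (Nat.eq_dec m M) as [->|N].
  - rewrite !cprodx_last, cprod_mult, cprod_const. do 2 f_equal. lia.
  - rewrite !cprodx_S, IH by lia. replace (S M - 1)%nat with (S (M - 1)) by lia.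
    rewrite Cpow_S. ring.
Qed.

Lemma qpoch_omit_nz (q : C) M m : (0 < Cmod q < 1)%R -> qpoch_omit q M m <> 0.
Proof.
  intros H. pose proof (q_nz q H) as Hq. apply Cmult_neq_0; [|now apply qpochq_nz].
  rewrite qpoch_reverse_1 by auto. apply Cdiv_nz; [|now apply tri_nz].
  apply Cmult_neq_0; [|now apply qpochq_nz]. apply Cpow_nz. apply Copp_nz, C1_nz.
Qed.

Section Residues.
Context (q a1 a2 a3 b1 xi : C) (hq : (0 < Cmod q < 1)%R) (hxi : xi <> 0).
Context (ha1 : a1 <> 0) (ha2 : a2 <> 0) (ha3 : a3 <> 0).
Context (g1 : forall n, a1 * q ^ n <> 1) (g2 : forall n, a2 * q ^ n <> 1)
  (g3 : forall n, a3 * q ^ n <> 1).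
Context (h12 : ~ spiral 1 q (a1 / a2)) (h13 : ~ spiral 1 q (a1 / a3))
  (h23 : ~ spiral 1 q (a2 / a3)).
Context (h21 : ~ spiral 1 q (a2 / a1)) (h31 : ~ spiral 1 q (a3 / a1))
  (h32 : ~ spiral 1 q (a3 / a2)).

(** Numerator, as a polynomial in [t], of the truncation to [M] factors of
    [(b1 t, -q t/xi, -xi/t; q)_oo / (a1 t, a2 t, a3 t, 1/t; q)_oo]; the factors
    [-xi/t] and [1/t] have both been multiplied by [t]. *)
Definition residue_num (M : nat) (t : C) : C :=
  qpoch (b1 * t) q M * (qpoch (- (q / xi) * t) q M * cprod (fun s => xi * q ^ s + t) M).

(** Contribution of the node [q^n] to the partial fractions at [t = 0], with the
    sign changed. *)
Definition residue_q (M n : nat) : C :=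
  qpoch (b1 * q ^ n) q M * (qpoch (- (q / xi) * q ^ n) q M * qpoch (- xi / q ^ n) q M)
  / (qpoch_omit q M n *
     (qpoch (a1 * q ^ n) q M * (qpoch (a2 * q ^ n) q M * qpoch (a3 * q ^ n) q M))).

(** Contribution of the node [1 / (a q^m)]; the other two parameters are [a'] and
    [a'']. *)
Definition residue_a (a a' a'' : C) (M m : nat) : C :=
  let x := / (a * q ^ m) in
  qpoch (b1 * x) q M * (qpoch (- (q / xi) * x) q M * qpoch (- xi / x) q M)
  / (qpoch (1 / x) q M * (qpoch_omit q M m * (qpoch (a' * x) q M * qpoch (a'' * x) q M))).

Lemma spiral_node (a a' : C) m m' : a <> 0 -> a' <> 0 -> ~ spiral 1 q (a / a') ->
  / (a * q ^ m) <> / (a' * q ^ m').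
Proof using hq.
  intros Ha Ha' H E. pose proof (q_nz q hq) as Hq. apply H.
  exists (Z.of_nat m' - Z.of_nat m)%Z. unfold Z.sub.
  rewrite Cpowz_add, Cpowz_neg, Cpowz_nat by auto.
  assert (Hm : q ^ m <> 0) by now apply Cpow_nz.
  assert (Hm' : q ^ m' <> 0) by now apply Cpow_nz.
  assert (E' : a * q ^ m = a' * q ^ m').
  { replace (a * q ^ m) with (/ / (a * q ^ m)) by (field; auto). rewrite E. field. auto. }
  replace a with (a * q ^ m / q ^ m) by (field; auto). rewrite E'. field. auto.
Qed.

Lemma residue_a_value (a a' a'' : C) M m : a <> 0 -> a' <> 0 -> a'' <> 0 -> (m < M)%nat ->
  (forall n, a * q ^ n <> 1) ->
  ~ spiral 1 q (a / a') -> ~ spiral 1 q (a / a'') ->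
  let t := / (a * q ^ m) in
  residue_num M t / (cprod (fun k => t - q ^ k) M *
    (cprodx m (fun k => 1 - a * q ^ k * t) M *
      (cprod (fun k => 1 - a' * q ^ k * t) M * cprod (fun k => 1 - a'' * q ^ k * t) M)))
  = residue_a a a' a'' M m.
Proof using hq hxi.
  intros Ha Ha' Ha'' Hm Hg H' H'' t. pose proof (q_nz q hq) as Hq.
  assert (qn : forall n, q ^ n <> 0) by (intros; now apply Cpow_nz).
  assert (Ht : t <> 0) by (apply Cinv_nz; now apply Cmult_neq_0).
  unfold residue_num. rewrite cprod_qpoch_inv, !cprod_qpoch by auto.
  rewrite (cprod_ext _ (fun k => - (1) * q ^ k + t)) by (intros; ring).
  rewrite cprod_qpoch_inv by auto.
  rewrite (cprodx_ext m _ (fun k => 1 - q ^ k * / q ^ m)).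
  2: { intros k _. unfold t. field. auto. }
  rewrite cprodx_qpoch_omit by auto. unfold residue_a. fold t.
  replace (- - (1) / t) with (1 / t) by (field; auto).
  assert (W : forall b : C, b <> 0 -> ~ spiral 1 q (a / b) -> qpoch (b * t) q M <> 0).
  { intros b Hb Hs. apply qpoch_nz. intros k _ E. revert Hs. 
    apply (fun X => X (spiral_node a b m k Ha Hb)). intros K Hs. apply (K Hs).
    unfold t in E. replace (/ (a * q ^ m)) with (b * / (a * q ^ m) * q ^ k / (b * q ^ k)).
    - rewrite E. field. auto.
    - field. auto. }
  pose proof (W a' Ha' H'). pose proof (W a'' Ha'' H'').
  assert (qpoch (1 / t) q M <> 0).
  { apply qpoch_nz. intros k _ E. apply (Hg (m + k)%nat). rewrite <- E, Cpow_add_r.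
    unfold t. field. auto. }
  pose proof (qpoch_omit_nz q M m hq). pose proof (Cpow_nz t M Ht).
  field. repeat split; auto.
Qed.

(** Partial fractions at [t = 0], where the rational function takes the value
    [(-xi)^M]. *)
Lemma residue_sum M : (1 <= M)%nat ->
  csum (residue_q M) M =
  csum (residue_a a1 a2 a3 M) M + csum (residue_a a2 a1 a3 M) M + csum (residue_a a3 a1 a2 M) M
  - (- xi) ^ M.
Proof using hq hxi ha1 ha2 ha3 g1 g2 g3 h12 h13 h23 h21 h31 h32.
  intros HM. pose proof (q_nz q hq) as Hq.
  assert (qn : forall n, q ^ n <> 0) by (intros; now apply Cpow_nz).
  set (x := glue M (fun n => q ^ n) (glue M (fun m => / (a1 * q ^ m))
        (glue M (fun m => / (a2 * q ^ m)) (fun m => / (a3 * q ^ m))))).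
  set (v := glue M (fun _ => RtoC 1) (glue M (fun m => - (a1 * q ^ m))
        (glue M (fun m => - (a2 * q ^ m)) (fun m => - (a3 * q ^ m))))).
  set (p := glue M (fun _ => RtoC 1) (glue M (fun _ => RtoC 1)
        (glue M (fun s => xi * q ^ s) (fun _ => RtoC 1)))).
  set (r := glue M (fun s => - b1 * q ^ s) (glue M (fun s => q / xi * q ^ s)
        (glue M (fun _ => RtoC 1) (fun _ => RtoC 0)))).
  set (N := (M + (M + (M + (M - 1))))%nat).
  assert (SN : S N = (M + (M + (M + M)))%nat) by (unfold N; lia).
  assert (Hnum : forall t, cprod (fun s => p s + r s * t) N = residue_num M t).
  { intros t. unfold N.
    rewrite (cprod_ext _ (glue M (fun s => 1 - b1 * q ^ s * t)
       (glue M (fun s => 1 - (- (q / xi)) * q ^ s * t)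
         (glue M (fun s => xi * q ^ s + t) (fun _ => 1))))).
    - rewrite !cprod_glue, !cprod_qpoch, cprod_const, Cpow_1_l. unfold residue_num. ring.
    - intros k _. unfold p, r, glue. repeat destruct (_ <? M)%nat; ring. }
  assert (Hden : forall t k, v k * (t - x k) = glue M (fun k => t - q ^ k)
     (glue M (fun k => 1 - a1 * q ^ k * t) (glue M (fun k => 1 - a2 * q ^ k * t)
        (fun k => 1 - a3 * q ^ k * t))) k).
  { intros t k. unfold v, x, glue. repeat destruct (_ <? M)%nat; field; auto. }
  pose proof (partial_fractions x v p r N 0) as PF.
  assert (V : forall i, v i <> 0).
  { intros i. unfold v, glue. repeat destruct (_ <? M)%nat; auto using C1_nz, Copp_nz, Cmult_neq_0. }
  assert (inj : forall i j, q ^ i = q ^ j -> i = j).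
  { intros i j E. destruct (Nat.lt_trichotomy i j) as [L|[L|L]]; auto; exfalso.
    - apply (qpow_neq1 q (j - i) hq ltac:(lia)).
      replace (q ^ (j - i)) with (q ^ j / q ^ i).
      + rewrite <- E. field. auto.
      + replace j with (i + (j - i))%nat at 1 by lia. rewrite Cpow_add_r. field. auto.
    - apply (qpow_neq1 q (i - j) hq ltac:(lia)).
      replace (q ^ (i - j)) with (q ^ i / q ^ j).
      + rewrite E. field. auto.
      + replace i with (j + (i - j))%nat at 1 by lia. rewrite Cpow_add_r. field. auto. }
  assert (mix : forall (a : C) i j, a <> 0 -> (forall n, a * q ^ n <> 1) -> q ^ i <> / (a * q ^ j)).
  { intros a i j Ha Hg E. apply (Hg (i + j)%nat). rewrite Cpow_add_r, E. field. auto. }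
  assert (inja : forall (a : C) i j, a <> 0 -> / (a * q ^ i) = / (a * q ^ j) -> i = j).
  { intros a i j Ha E. apply inj.
    replace (q ^ i) with (/ / (a * q ^ i) / a) by (field; auto). rewrite E. field. auto. }
  assert (X : forall i j, i <> j -> x i <> x j).
  { intros i j Hij. unfold x, glue.
    destruct (Nat.ltb_spec i M), (Nat.ltb_spec j M);
      try destruct (Nat.ltb_spec (i - M) M); try destruct (Nat.ltb_spec (j - M) M);
      try destruct (Nat.ltb_spec (i - M - M) M); try destruct (Nat.ltb_spec (j - M - M) M);
      auto using spiral_node;
      try (intros E; first [apply inj in E|apply inja in E]; auto; lia);
      apply not_eq_sym; auto using spiral_node. }
  assert (T0 : forall i, (RtoC 0) <> x i).
  { intros i. apply not_eq_sym. unfold x, glue.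
    repeat destruct (_ <? M)%nat; auto using Cinv_nz, Cmult_neq_0. }
  specialize (PF (fun i _ => V i) (fun i j _ _ => X i j) (fun i _ => T0 i)).
  rewrite Hnum in PF. rewrite (csum_ext _ (fun i => residue_num M (x i) /
      (cprodx i (glue M (fun k => x i - q ^ k) (glue M (fun k => 1 - a1 * q ^ k * x i)
         (glue M (fun k => 1 - a2 * q ^ k * x i) (fun k => 1 - a3 * q ^ k * x i)))) (S N)
       * (v i * (0 - x i))))) in PF.
  2: { intros i _. rewrite Hnum, (cprodx_ext i _ _ (S N) (fun k _ => Hden (x i) k)). reflexivity. }
  rewrite (cprod_ext _ _ (S N) (fun k _ => Hden 0 k)) in PF.
  rewrite SN, !csum_app, !cprod_glue in PF.
  assert (D0 : forall t : C, t <> 0 -> cprod (fun k => t - q ^ k) M = t ^ M * qpoch (1 / t) q M).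
  { intros t Ht. replace (1 / t) with (- - (1) / t) by (field; auto).
    rewrite <- cprod_qpoch_inv by auto. apply cprod_ext. intros; ring. }
  assert (RHS : residue_num M 0 / (cprod (fun k => 0 - q ^ k) M *
     (cprod (fun k => 1 - a1 * q ^ k * 0) M * (cprod (fun k => 1 - a2 * q ^ k * 0) M *
      cprod (fun k => 1 - a3 * q ^ k * 0) M))) = (- xi) ^ M).
  { unfold residue_num. rewrite !cprod_qpoch, !Cmult_0_r, !qpoch_0.
    rewrite (cprod_ext (fun s => xi * q ^ s + 0) (fun s => - xi * (0 - q ^ s)))
      by (intros; ring).
    rewrite cprod_mult, cprod_const. field.
    apply cprod_nz. intros k _ E. apply (qn k). replace (q ^ k) with (- (0 - q ^ k)) by ring.
    rewrite E. ring. }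
  rewrite RHS in PF. clear RHS.
  assert (Q : forall n, (n < M)%nat -> residue_num M (x n) /
      (cprodx n (glue M (fun k => x n - q ^ k) (glue M (fun k => 1 - a1 * q ^ k * x n)
         (glue M (fun k => 1 - a2 * q ^ k * x n) (fun k => 1 - a3 * q ^ k * x n))))
           (M + (M + (M + M)))
       * (v n * (0 - x n))) = - (1) * residue_q M n).
  { intros n Hn. rewrite cprodx_glue_l, !cprod_glue, !cprod_qpoch by auto.
    unfold x at 1 2 3 4 5 6, v. rewrite !glue_l by auto.
    unfold residue_num. rewrite cprod_qpoch_inv by auto.
    rewrite (cprodx_ext n _ (fun k => q ^ n * (1 - q ^ k * / q ^ n))).
    2: { intros k _. field. auto. }
    rewrite cprodx_scal, cprodx_qpoch_omit by auto. unfold residue_q.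
    replace ((q ^ n) ^ M) with (q ^ n * (q ^ n) ^ (M - 1)).
    2: { rewrite <- Cpow_S. f_equal. lia. }
    pose proof (qpoch_omit_nz q M n hq).
    assert (W : forall a : C, (forall n, a * q ^ n <> 1) -> qpoch (a * q ^ n) q M <> 0).
    { intros a Hg. apply qpoch_nz. intros k _. rewrite <- Cmult_assoc, <- Cpow_add_r. apply Hg. }
    pose proof (W a1 g1). pose proof (W a2 g2). pose proof (W a3 g3).
    pose proof (Cpow_nz (q ^ n) (M - 1) (qn n)).
    field. repeat split; auto. }
  assert (R1 : forall m, (m < M)%nat -> residue_num M (x (M + m)%nat) /
      (cprodx (M + m)%nat (glue M (fun k => x (M + m)%nat - q ^ k)
         (glue M (fun k => 1 - a1 * q ^ k * x (M + m)%nat)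
         (glue M (fun k => 1 - a2 * q ^ k * x (M + m)%nat) (fun k => 1 - a3 * q ^ k * x (M + m)%nat))))
           (M + (M + (M + M)))
       * (v (M + m)%nat * (0 - x (M + m)%nat))) = residue_a a1 a2 a3 M m).
  { intros m Hm. rewrite cprodx_glue_r, cprodx_glue_l, !cprod_glue by auto.
    assert (Ex : x (M + m)%nat = / (a1 * q ^ m)) by (unfold x; now rewrite glue_r, glue_l).
    assert (Ev : v (M + m)%nat * (0 - x (M + m)%nat) = 1).
    { rewrite Ex. unfold v. rewrite glue_r, glue_l by auto. field. auto. }
    rewrite Ev, Cmult_1_r, Ex. apply residue_a_value; auto. }
  assert (R2 : forall m, (m < M)%nat -> residue_num M (x (M + (M + m))%nat) /
      (cprodx (M + (M + m))%nat (glue M (fun k => x (M + (M + m))%nat - q ^ k)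
         (glue M (fun k => 1 - a1 * q ^ k * x (M + (M + m))%nat)
         (glue M (fun k => 1 - a2 * q ^ k * x (M + (M + m))%nat)
                 (fun k => 1 - a3 * q ^ k * x (M + (M + m))%nat))))
           (M + (M + (M + M)))
       * (v (M + (M + m))%nat * (0 - x (M + (M + m))%nat))) = residue_a a2 a1 a3 M m).
  { intros m Hm. rewrite !cprodx_glue_r, cprodx_glue_l by auto.
    assert (Ex : x (M + (M + m))%nat = / (a2 * q ^ m)) by (unfold x; now rewrite !glue_r, glue_l).
    assert (Ev : v (M + (M + m))%nat * (0 - x (M + (M + m))%nat) = 1).
    { rewrite Ex. unfold v. rewrite !glue_r, glue_l by auto. field. auto. }
    rewrite Ev, Cmult_1_r, Ex. rewrite <- (residue_a_value a2 a1 a3) by auto.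
    f_equal. ring. }
  assert (R3 : forall m, (m < M)%nat -> residue_num M (x (M + (M + (M + m)))%nat) /
      (cprodx (M + (M + (M + m)))%nat (glue M (fun k => x (M + (M + (M + m)))%nat - q ^ k)
         (glue M (fun k => 1 - a1 * q ^ k * x (M + (M + (M + m)))%nat)
         (glue M (fun k => 1 - a2 * q ^ k * x (M + (M + (M + m)))%nat)
                 (fun k => 1 - a3 * q ^ k * x (M + (M + (M + m)))%nat))))
           (M + (M + (M + M)))
       * (v (M + (M + (M + m)))%nat * (0 - x (M + (M + (M + m)))%nat))) = residue_a a3 a1 a2 M m).
  { intros m Hm. rewrite !cprodx_glue_r.
    assert (Ex : x (M + (M + (M + m)))%nat = / (a3 * q ^ m)) by (unfold x; now rewrite !glue_r).
    assert (Ev : v (M + (M + (M + m)))%nat * (0 - x (M + (M + (M + m)))%nat) = 1).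
    { rewrite Ex. unfold v. rewrite !glue_r. field. auto. }
    rewrite Ev, Cmult_1_r, Ex. rewrite <- (residue_a_value a3 a1 a2) by auto.
    f_equal. ring. }
  rewrite (csum_ext _ _ M Q), (csum_ext _ _ M R1), (csum_ext _ _ M R2), (csum_ext _ _ M R3),
    csum_scal in PF.
  rewrite <- PF. change (csum (fun n => ?f n) M) with (csum f M). ring.
Qed.
End Residues.

(** * The connection formula inside the unit disc *)

Definition borelcoef (a1 a2 a3 b1 q : C) (n : nat) : C :=
  qpoch a1 q n * qpoch a2 q n * qpoch a3 q n / (qpoch b1 q n * qpoch q q n).

(** Coefficients of the [3phi2] in the solution at infinity attached to the
    parameter [a]; [a'] and [a''] are the other two parameters. *)
Definition solcoef (a a' a'' b1 q : C) (m : nat) : C :=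
  qpoch a q m * qpoch (a * q / b1) q m
  / (qpoch (a * q / a') q m * qpoch (a * q / a'') q m * qpoch q q m).

Definition conncoef (a a' a'' b1 q : C) : C :=
  qpoch_inf a' q * qpoch_inf a'' q * qpoch_inf (b1 / a) q
  / (qpoch_inf b1 q * qpoch_inf (a' / a) q * qpoch_inf (a'' / a) q).

(** Terms of that solution without its theta factors.  The Gaussian factor makes
    the series entire in [1 / xi]. *)
Definition solterm (a a' a'' b1 q xi : C) (m : nat) : C :=
  solcoef a a' a'' b1 q m * (tri q (S m) * (q * b1 / (a' * a'' * xi)) ^ m).

Definition solser (a a' a'' b1 q xi : C) : C := CSeries (solterm a a' a'' b1 q xi).

Lemma spiral_qpow_neq (q x : C) : q <> 0 -> ~ spiral 1 q x -> forall n, x * q ^ n <> 1.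
Proof.
  intros Hq H n E. apply H. exists (- Z.of_nat n)%Z. rewrite Cpowz_neg.
  replace x with (x * q ^ n / q ^ n) by (field; now apply Cpow_nz). rewrite E. field.
  now apply Cpow_nz.
Qed.

Lemma spiral_qshift_neq (q a a' : C) : q <> 0 -> ~ spiral 1 q (a / a') ->
  forall n, a * q / a' * q ^ n <> 1.
Proof.
  intros Hq H n E. apply (spiral_qpow_neq q (a / a') Hq H (S n)). rewrite <- E.
  rewrite Cpow_S. unfold Cdiv. ring.
Qed.

Lemma qpoch_cv_along (a q : C) (h : nat -> nat) k : (Cmod q < 1)%R ->
  (forall M, (M <= h M + k)%nat) -> Ccv (fun M => qpoch a q (h M)) (qpoch_inf a q).
Proof.
  intros Hq Hh eps He. destruct (qpoch_cv a q Hq eps He) as [N HN]. exists (N + k)%nat.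
  intros n Hn. apply HN. specialize (Hh n). lia.
Qed.

Lemma qpoch_inf_shift (a q : C) n : (Cmod q < 1)%R -> (forall n, a * q ^ n <> 1) ->
  qpoch_inf (a * q ^ n) q = qpoch_inf a q / qpoch a q n.
Proof.
  intros Hq H. rewrite (qpoch_inf_split a q n Hq). field. apply qpoch_nz. auto.
Qed.

Lemma solcoef_bounded (a a' a'' b1 q : C) : (0 < Cmod q < 1)%R ->
  ~ spiral 1 q (a / a') -> ~ spiral 1 q (a / a'') ->
  exists B, (0 < B)%R /\ forall m, (Cmod (solcoef a a' a'' b1 q m) <= B)%R.
Proof.
  intros H H' H''. pose proof (q_nz q H) as Hq. assert (Hq1 : (Cmod q < 1)%R) by lra.
  destruct (qpoch_bound q (Cmod a) Hq1) as (B1 & P1 & K1).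
  destruct (qpoch_bound q (Cmod (a * q / b1)) Hq1) as (B2 & P2 & K2).
  destruct (qpoch_inv_bound (a * q / a') q Hq1 (spiral_qshift_neq q a a' Hq H')) as (B3 & P3 & K3).
  destruct (qpoch_inv_bound (a * q / a'') q Hq1 (spiral_qshift_neq q a a'' Hq H'')) as (B4 & P4 & K4).
  destruct (qpoch_inv_bound q q Hq1 (qq_nz q H)) as (B5 & P5 & K5).
  exists (B1 * B2 * (B3 * B4 * B5))%R. split; [repeat apply Rmult_lt_0_compat; auto|].
  intros m. unfold solcoef.
  replace (qpoch a q m * qpoch (a * q / b1) q m
    / (qpoch (a * q / a') q m * qpoch (a * q / a'') q m * qpoch q q m)) with
    (qpoch a q m * qpoch (a * q / b1) q m *
     (/ qpoch (a * q / a') q m * / qpoch (a * q / a'') q m * / qpoch q q m)).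
  - rewrite !Cmod_mult.
    repeat (apply Rmult_le_compat; auto using Cmod_ge_0, Rmult_le_pos);
      [apply K1|apply K2]; lra.
  - field. repeat split; apply qpoch_nz; intros k _;
      auto using spiral_qshift_neq, qq_nz.
Qed.

Lemma tri_S_summable (q : C) (w : R) : (0 < Cmod q < 1)%R -> (0 <= w)%R ->
  rsummable (fun m => Cmod (tri q (S m)) * w ^ m)%R.
Proof.
  intros H Hw. apply rsummable_ext with (fun n => (w * Cmod q) ^ n * Cmod (tri q n))%R.
  - intros n. cbn [tri]. rewrite Cmod_mult, Cmod_pow, Rpow_mult_distr. ring.
  - apply tri_summable; auto. apply Rmult_le_pos; lra.
Qed.

Lemma solterm_summable (a a' a'' b1 q xi : C) : (0 < Cmod q < 1)%R ->
  ~ spiral 1 q (a / a') -> ~ spiral 1 q (a / a'') -> csummable (solterm a a' a'' b1 q xi).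
Proof.
  intros H H' H''. destruct (solcoef_bounded a a' a'' b1 q H H' H'') as (B & HB0 & HB).
  apply csummable_le with
    (fun m => B * (Cmod (tri q (S m)) * Cmod (q * b1 / (a' * a'' * xi)) ^ m))%R.
  - intros m. unfold solterm. rewrite !Cmod_mult, Cmod_pow. apply Rmult_le_compat_r; auto.
    apply Rmult_le_pos; [apply Cmod_ge_0|apply pow_le, Cmod_ge_0].
  - apply rsummable_scal; [lra|]. apply tri_S_summable; auto using Cmod_ge_0.
Qed.

Lemma solser_Cser (a a' a'' b1 q xi : C) : (0 < Cmod q < 1)%R ->
  ~ spiral 1 q (a / a') -> ~ spiral 1 q (a / a'') ->
  Cser (solterm a a' a'' b1 q xi) (solser a a' a'' b1 q xi).
Proof. intros. apply csummable_Cser. now apply solterm_summable. Qed.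

Lemma borelcoef_bounded (a1 a2 a3 b1 q : C) : (0 < Cmod q < 1)%R ->
  (forall n, b1 * q ^ n <> 1) ->
  exists B, (0 < B)%R /\ forall n, (Cmod (borelcoef a1 a2 a3 b1 q n) <= B)%R.
Proof.
  intros H Hb. assert (Hq1 : (Cmod q < 1)%R) by lra.
  destruct (qpoch_bound q (Cmod a1) Hq1) as (B1 & P1 & K1).
  destruct (qpoch_bound q (Cmod a2) Hq1) as (B2 & P2 & K2).
  destruct (qpoch_bound q (Cmod a3) Hq1) as (B3 & P3 & K3).
  destruct (qpoch_inv_bound b1 q Hq1 Hb) as (B4 & P4 & K4).
  destruct (qpoch_inv_bound q q Hq1 (qq_nz q H)) as (B5 & P5 & K5).
  exists (B1 * B2 * B3 * (B4 * B5))%R. split; [repeat apply Rmult_lt_0_compat; auto|].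
  intros n. unfold borelcoef.
  replace (qpoch a1 q n * qpoch a2 q n * qpoch a3 q n / (qpoch b1 q n * qpoch q q n)) with
    (qpoch a1 q n * qpoch a2 q n * qpoch a3 q n * (/ qpoch b1 q n * / qpoch q q n)).
  - rewrite !Cmod_mult.
    repeat (apply Rmult_le_compat; auto using Cmod_ge_0, Rmult_le_pos);
      [apply K1|apply K2|apply K3]; lra.
  - field. split; apply qpoch_nz; auto using qq_nz.
Qed.

Section Limits.
Context (q b1 xi : C) (hq : (0 < Cmod q < 1)%R) (hxi : xi <> 0) (hxi1 : (Cmod xi < 1)%R).
Context (hb1 : b1 <> 0) (hbq : forall n, b1 * q ^ n <> 1).

(** Isolates the part that depends on [M], which is bounded and convergent; what
    remains decays geometrically because [|xi| < 1]. *)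
Lemma residue_q_form (a1 a2 a3 : C) M n :
  (forall n, a1 * q ^ n <> 1) -> (forall n, a2 * q ^ n <> 1) -> (forall n, a3 * q ^ n <> 1) ->
  (n < M)%nat ->
  residue_q q a1 a2 a3 b1 xi M n = (- xi) ^ n *
   (qpoch (b1 * q ^ n) q M * qpoch (- (q / xi)) q (n + M) * qpoch (- xi) q (M - n)
    / (qpoch q q n * qpoch q q (M - 1 - n) *
       (qpoch (a1 * q ^ n) q M * qpoch (a2 * q ^ n) q M * qpoch (a3 * q ^ n) q M))).
Proof using hq hxi.
  intros g1 g2 g3 Hn. pose proof (q_nz q hq) as Hq.
  unfold residue_q, qpoch_omit.
  assert (W : forall a : C, (forall n, a * q ^ n <> 1) -> qpoch (a * q ^ n) q M <> 0).
  { intros a Hg. apply qpoch_nz. intros k _. rewrite <- Cmult_assoc, <- Cpow_add_r. apply Hg. }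
  pose proof (W a1 g1). pose proof (W a2 g2). pose proof (W a3 g3).
  rewrite qpoch_reverse_1 by auto.
  replace M with (n + (M - n))%nat at 3 by lia.
  rewrite qpoch_reverse_add by auto using Copp_nz.
  rewrite (qpoch_add (- (q / xi)) q n M).
  replace (q / - xi) with (- (q / xi)) by (field; auto).
  replace (- - xi) with xi by ring.
  replace (- xi) with (- (1) * xi) by ring. rewrite (Cpow_mult_l (- (1)) xi n).
  pose proof (tri_nz q (S n) Hq). pose proof (qpochq_nz q n hq).
  pose proof (qpochq_nz q (M - 1 - n) hq).
  assert (S1 : (- (1)) ^ n * (- (1)) ^ n = 1).
  { rewrite <- Cpow_mult_l. replace (- (1) * - (1)) with (RtoC 1) by ring. apply Cpow_1_l. }
  assert (S0 : (- (1)) ^ n <> 0) by (apply Cpow_nz, Copp_nz, C1_nz).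
  match goal with |- ?L = _ => transitivity (((- (1)) ^ n * (- (1)) ^ n) * L) end.
  { rewrite S1. ring. }
  field. repeat split; auto.
Qed.

Lemma residue_q_limit (a1 a2 a3 : C) :
  (forall n, a1 * q ^ n <> 1) -> (forall n, a2 * q ^ n <> 1) -> (forall n, a3 * q ^ n <> 1) ->
  Ccv (fun M => csum (residue_q q a1 a2 a3 b1 xi M) M)
   (qpoch_inf b1 q * theta q xi /
    (qpoch_inf q q * qpoch_inf q q * (qpoch_inf a1 q * qpoch_inf a2 q * qpoch_inf a3 q))
    * CSeries (fun n => borelcoef a1 a2 a3 b1 q n * (- xi) ^ n)).
Proof using hq hxi hxi1 hbq.
  intros g1 g2 g3. pose proof (q_nz q hq) as Hq. assert (Hq1 : (Cmod q < 1)%R) by lra.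
  pose proof (qpoch_inf_nz a1 q Hq1 g1) as I1. pose proof (qpoch_inf_nz a2 q Hq1 g2) as I2.
  pose proof (qpoch_inf_nz a3 q Hq1 g3) as I3. pose proof (qpoch_inf_nz q q Hq1 (qq_nz q hq)) as I0.
  set (K := qpoch_inf b1 q * theta q xi /
    (qpoch_inf q q * qpoch_inf q q * (qpoch_inf a1 q * qpoch_inf a2 q * qpoch_inf a3 q))).
  destruct (borelcoef_bounded a1 a2 a3 b1 q hq hbq) as (Bc & Pc & Kc).
  assert (Hs : csummable (fun n => borelcoef a1 a2 a3 b1 q n * (- xi) ^ n)).
  { apply csummable_le with (fun n => Bc * Cmod xi ^ n)%R.
    - intros n. rewrite Cmod_mult, Cmod_pow, Cmod_opp. apply Rmult_le_compat_r; auto.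
      apply pow_le, Cmod_ge_0.
    - apply rsummable_scal; [lra|]. apply rsummable_geom. split; auto using Cmod_ge_0. }
  rewrite <- (Cser_CSeries _ _ (Cser_scal K _ _ (csummable_Cser _ Hs))).
  destruct (qpoch_shift_bound b1 q Hq1) as (B1 & P1 & K1).
  destruct (qpoch_bound q (Cmod (- (q / xi))) Hq1) as (B2 & P2 & K2).
  destruct (qpoch_bound q (Cmod (- xi)) Hq1) as (B3 & P3 & K3).
  destruct (qpoch_inv_bound q q Hq1 (qq_nz q hq)) as (B5 & P5 & K5).
  destruct (qpoch_shift_inv_bound a1 q Hq1 g1) as (B6 & P6 & K6).
  destruct (qpoch_shift_inv_bound a2 q Hq1 g2) as (B7 & P7 & K7).
  destruct (qpoch_shift_inv_bound a3 q Hq1 g3) as (B8 & P8 & K8).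
  assert (W : forall (a : C) n M, (forall n, a * q ^ n <> 1) -> qpoch (a * q ^ n) q M <> 0).
  { intros a n M Hg. apply qpoch_nz. intros k _. rewrite <- Cmult_assoc, <- Cpow_add_r. apply Hg. }
  apply (tannery_fin _ _ (fun n => (B1 * B2 * B3 * (B5 * B5 * (B6 * B7 * B8))) * Cmod xi ^ n)%R
            (fun M => M)); auto.
  - apply rsummable_scal; [repeat apply Rmult_le_pos; lra|].
    apply rsummable_geom. split; auto using Cmod_ge_0.
  - intros M n Hn. rewrite residue_q_form, Cmod_mult, Cmod_pow, Cmod_opp, Rmult_comm by auto.
    apply Rmult_le_compat_r; [apply pow_le, Cmod_ge_0|].
    match goal with |- (Cmod (?x / (?y1 * ?y2 * (?y3 * ?y4 * ?y5))) <= _)%R =>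
      replace (x / (y1 * y2 * (y3 * y4 * y5))) with
        (x * (/ y1 * / y2 * (/ y3 * / y4 * / y5))) end.
    + rewrite !Cmod_mult.
      repeat (apply Rmult_le_compat; auto using Cmod_ge_0, Rmult_le_pos);
        [apply K2|apply K3]; lra.
    + field. repeat split; auto using qpochq_nz.
  - intros n.
    apply (Ccv_ext_loc (fun M => (- xi) ^ n *
     (qpoch (b1 * q ^ n) q M * qpoch (- (q / xi)) q (n + M) * qpoch (- xi) q (M - n)
      / (qpoch q q n * qpoch q q (M - 1 - n) *
       (qpoch (a1 * q ^ n) q M * qpoch (a2 * q ^ n) q M * qpoch (a3 * q ^ n) q M)))) _ _ (S n)).
    { intros M HM. now rewrite residue_q_form. }
    replace (K * (borelcoef a1 a2 a3 b1 q n * (- xi) ^ n)) with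
     ((- xi) ^ n * (qpoch_inf (b1 * q ^ n) q * qpoch_inf (- (q / xi)) q * qpoch_inf (- xi) q
      / (qpoch q q n * qpoch_inf q q *
        (qpoch_inf (a1 * q ^ n) q * qpoch_inf (a2 * q ^ n) q * qpoch_inf (a3 * q ^ n) q)))).
    + apply Ccv_scal.
      assert (I : forall a : C, (forall n, a * q ^ n <> 1) -> qpoch_inf (a * q ^ n) q <> 0).
      { intros a Hg. rewrite qpoch_inf_shift by auto. apply Cdiv_nz; [now apply qpoch_inf_nz|].
        apply qpoch_nz. auto. }
      apply Ccv_div.
      * repeat apply Cmult_neq_0; auto using qpochq_nz.
      * apply Ccv_mult; [apply Ccv_mult|].
        -- now apply qpoch_cv.
        -- apply (qpoch_cv_along _ q (fun M => (n + M)%nat) 0); auto. intros; lia.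
        -- apply (qpoch_cv_along _ q (fun M => (M - n)%nat) n); auto. intros; lia.
      * apply Ccv_mult; [apply Ccv_scal|].
        -- apply (qpoch_cv_along _ q (fun M => (M - 1 - n)%nat) (S n)); auto. intros; lia.
        -- apply Ccv_mult; [apply Ccv_mult|]; now apply qpoch_cv.
    + unfold K. rewrite jacobi_triple_product, !qpoch_inf_shift by auto. unfold borelcoef.
      replace (- q / xi) with (- (q / xi)) by (unfold Cdiv; ring).
      field. repeat split; auto using qpochq_nz; apply qpoch_nz; auto.
Qed.

(** Reversing the products with base [q^(-m)] produces two Gaussian factors in the
    denominator and three in the numerator; the one left over gives summability. *)
Lemma residue_a_form (a a' a'' : C) M m : a <> 0 -> a' <> 0 -> a'' <> 0 ->
  (forall n, a * q ^ n <> 1) ->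
  ~ spiral 1 q (a / a') -> ~ spiral 1 q (a / a'') ->
  ~ spiral 1 q (a' / a) -> ~ spiral 1 q (a'' / a) -> (m < M)%nat ->
  residue_a q b1 xi a a' a'' M m =
  tri q (S m) * (q * b1 / (a' * a'' * xi)) ^ m *
  (qpoch (a * q / b1) q m
     / (qpoch (a * q / a') q m * qpoch (a * q / a'') q m * qpoch q q m)) *
  (qpoch (b1 / a) q (M - m) * qpoch (- (q / (a * xi))) q (M - m)
     * qpoch (- (a * xi)) q (m + M)
   / (qpoch (a * q ^ m) q M * qpoch q q (M - 1 - m)
      * (qpoch (a' / a) q (M - m) * qpoch (a'' / a) q (M - m)))).
Proof using hq hxi hb1.
  intros Ha Ha' Ha'' Hg H1 H2 H3 H4 Hm. pose proof (q_nz q hq) as Hq.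
  assert (qm : q ^ m <> 0) by now apply Cpow_nz.
  unfold residue_a, qpoch_omit.
  assert (EM : M = (m + (M - m))%nat) by lia.
  replace (b1 * / (a * q ^ m)) with (b1 / a / q ^ m) by (field; auto).
  replace (a' * / (a * q ^ m)) with (a' / a / q ^ m) by (field; auto).
  replace (a'' * / (a * q ^ m)) with (a'' / a / q ^ m) by (field; auto).
  replace (- (q / xi) * / (a * q ^ m)) with (- (q / (a * xi)) / q ^ m) by (field; auto).
  replace (- xi / / (a * q ^ m)) with (- (a * xi) * q ^ m) by (field; auto).
  replace (1 / / (a * q ^ m)) with (a * q ^ m) by (field; auto).
  assert (Rv : forall b : C, b <> 0 -> qpoch (b / q ^ m) q M =
     (- b) ^ m * qpoch (q / b) q m / tri q (S m) * qpoch b q (M - m)).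
  { intros b Hb. rewrite EM at 1. now rewrite qpoch_reverse_add. }
  rewrite !Rv by (auto using Cdiv_nz, Copp_nz, Cmult_neq_0).
  rewrite qpoch_reverse_1 by auto.
  rewrite (qpoch_add (- (a * xi)) q m M).
  replace (q / (b1 / a)) with (a * q / b1) by (field; auto).
  replace (q / (a' / a)) with (a * q / a') by (field; auto).
  replace (q / (a'' / a)) with (a * q / a'') by (field; auto).
  replace (q / - (q / (a * xi))) with (- (a * xi)) by (field; auto).
  assert (Pw : (- (b1 / a)) ^ m * (- - (q / (a * xi))) ^ m =
     (q * b1 / (a' * a'' * xi)) ^ m * ((- (1)) ^ m * ((- (a' / a)) ^ m * (- (a'' / a)) ^ m))).
  { rewrite <- !Cpow_mult_l. f_equal. field. auto. }
  assert (N1 : qpoch (a * q / a') q m <> 0).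
  { apply qpoch_nz. intros k _. now apply spiral_qshift_neq. }
  assert (N2 : qpoch (a * q / a'') q m <> 0).
  { apply qpoch_nz. intros k _. now apply spiral_qshift_neq. }
  assert (N3 : qpoch (a' / a) q (M - m) <> 0).
  { apply qpoch_nz. intros k _. now apply spiral_qpow_neq. }
  assert (N4 : qpoch (a'' / a) q (M - m) <> 0).
  { apply qpoch_nz. intros k _. now apply spiral_qpow_neq. }
  assert (N5 : qpoch (a * q ^ m) q M <> 0).
  { apply qpoch_nz. intros k _. rewrite <- Cmult_assoc, <- Cpow_add_r. apply Hg. }
  pose proof (tri_nz q (S m) Hq) as N6. pose proof (qpochq_nz q m hq) as N7.
  pose proof (qpochq_nz q (M - 1 - m) hq) as N8.
  assert (N9 : (- (1)) ^ m <> 0) by (apply Cpow_nz, Copp_nz, C1_nz).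
  assert (N10 : (- (a' / a)) ^ m <> 0) by (apply Cpow_nz, Copp_nz, Cdiv_nz; auto).
  assert (N11 : (- (a'' / a)) ^ m <> 0) by (apply Cpow_nz, Copp_nz, Cdiv_nz; auto).
  set (T := tri q (S m)) in *.
  set (X := (q * b1 / (a' * a'' * xi)) ^ m) in *.
  set (s := (- (1)) ^ m) in *. set (u := (- (a' / a)) ^ m) in *. set (w := (- (a'' / a)) ^ m) in *.
  set (P1 := (- (b1 / a)) ^ m) in *. set (P2 := (- - (q / (a * xi))) ^ m) in *.
  replace X with (P1 * P2 / (s * (u * w))).
  - field. repeat split; auto.
  - rewrite Pw. field. auto.
Qed.

Lemma residue_a_limit (a a' a'' : C) : a <> 0 -> a' <> 0 -> a'' <> 0 ->
  (forall n, a * q ^ n <> 1) ->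
  ~ spiral 1 q (a / a') -> ~ spiral 1 q (a / a'') ->
  ~ spiral 1 q (a' / a) -> ~ spiral 1 q (a'' / a) ->
  Ccv (fun M => csum (residue_a q b1 xi a a' a'' M) M)
   (qpoch_inf (b1 / a) q * theta q (a * xi) /
    (qpoch_inf q q * qpoch_inf q q *
      (qpoch_inf a q * qpoch_inf (a' / a) q * qpoch_inf (a'' / a) q))
    * solser a a' a'' b1 q xi).
Proof using hq hxi hb1.
  intros Ha Ha' Ha'' Hg H1 H2 H3 H4.
  pose proof (q_nz q hq) as Hq. assert (Hq1 : (Cmod q < 1)%R) by lra.
  pose proof (qpoch_inf_nz q q Hq1 (qq_nz q hq)) as I0.
  pose proof (qpoch_inf_nz a q Hq1 Hg) as I1.
  pose proof (spiral_qpow_neq q _ Hq H3) as g3. pose proof (spiral_qpow_neq q _ Hq H4) as g4.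
  pose proof (qpoch_inf_nz _ q Hq1 g3) as I3. pose proof (qpoch_inf_nz _ q Hq1 g4) as I4.
  set (K := qpoch_inf (b1 / a) q * theta q (a * xi) /
    (qpoch_inf q q * qpoch_inf q q *
      (qpoch_inf a q * qpoch_inf (a' / a) q * qpoch_inf (a'' / a) q))).
  rewrite <- (Cser_CSeries _ _ (Cser_scal K _ _ (solser_Cser a a' a'' b1 q xi hq H1 H2))).
  destruct (qpoch_bound q (Cmod (b1 / a)) Hq1) as (B1 & P1 & K1).
  destruct (qpoch_bound q (Cmod (- (q / (a * xi)))) Hq1) as (B2 & P2 & K2).
  destruct (qpoch_bound q (Cmod (- (a * xi))) Hq1) as (B3 & P3 & K3).
  destruct (qpoch_shift_inv_bound a q Hq1 Hg) as (B4 & P4 & K4).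
  destruct (qpoch_inv_bound q q Hq1 (qq_nz q hq)) as (B5 & P5 & K5).
  destruct (qpoch_inv_bound _ q Hq1 g3) as (B6 & P6 & K6).
  destruct (qpoch_inv_bound _ q Hq1 g4) as (B7 & P7 & K7).
  destruct (qpoch_bound q (Cmod (a * q / b1)) Hq1) as (B8 & P8 & K8).
  pose proof (spiral_qshift_neq q _ _ Hq H1) as g1. pose proof (spiral_qshift_neq q _ _ Hq H2) as g2.
  destruct (qpoch_inv_bound _ q Hq1 g1) as (B9 & P9 & K9).
  destruct (qpoch_inv_bound _ q Hq1 g2) as (B10 & P10 & K10).
  assert (W : forall n M, qpoch (a * q ^ n) q M <> 0).
  { intros n M. apply qpoch_nz. intros k _. rewrite <- Cmult_assoc, <- Cpow_add_r. apply Hg. }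
  set (w := Cmod (q * b1 / (a' * a'' * xi))).
  apply (tannery_fin _ _ (fun m => (B8 * (B9 * B10 * B5)) * (B1 * B2 * B3 * (B4 * B5 * (B6 * B7)))
            * (Cmod (tri q (S m)) * w ^ m))%R (fun M => M)); auto.
  - apply rsummable_scal; [repeat apply Rmult_le_pos; lra|].
    apply tri_S_summable; auto. apply Cmod_ge_0.
  - intros M m Hm. rewrite residue_a_form by auto. rewrite !Cmod_mult, Cmod_pow. fold w.
    rewrite (Rmult_assoc (Cmod (tri q (S m)) * w ^ m)), (Rmult_comm (Cmod (tri q (S m)) * w ^ m)).
    apply Rmult_le_compat_r.
    { apply Rmult_le_pos; [apply Cmod_ge_0|apply pow_le, Cmod_ge_0]. }
    match goal with |- (Cmod (?x / (?y1 * ?y2 * ?y3)) * _ <= _)%R =>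
      replace (x / (y1 * y2 * y3)) with (x * (/ y1 * / y2 * / y3)) end.
    2: { field. repeat split; auto using qpochq_nz; apply qpoch_nz; auto. }
    match goal with |- (_ * Cmod (?x / (?y1 * ?y2 * (?y3 * ?y4))) <= _)%R =>
      replace (x / (y1 * y2 * (y3 * y4))) with (x * (/ y1 * / y2 * (/ y3 * / y4))) end.
    2: { field. repeat split; auto using qpochq_nz; apply qpoch_nz; auto. }
    rewrite !Cmod_mult.
    repeat (apply Rmult_le_compat; auto using Cmod_ge_0, Rmult_le_pos);
      [apply K8|apply K1|apply K2|apply K3]; lra.
  - intros m.
    apply (Ccv_ext_loc (fun M => tri q (S m) * (q * b1 / (a' * a'' * xi)) ^ m *
      (qpoch (a * q / b1) q m
        / (qpoch (a * q / a') q m * qpoch (a * q / a'') q m * qpoch q q m)) *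
      (qpoch (b1 / a) q (M - m) * qpoch (- (q / (a * xi))) q (M - m)
         * qpoch (- (a * xi)) q (m + M)
       / (qpoch (a * q ^ m) q M * qpoch q q (M - 1 - m)
        * (qpoch (a' / a) q (M - m) * qpoch (a'' / a) q (M - m))))) _ _ (S m)).
    { intros M HM. now rewrite residue_a_form. }
    replace (K * solterm a a' a'' b1 q xi m) with
     (tri q (S m) * (q * b1 / (a' * a'' * xi)) ^ m *
      (qpoch (a * q / b1) q m
        / (qpoch (a * q / a') q m * qpoch (a * q / a'') q m * qpoch q q m)) *
      (qpoch_inf (b1 / a) q * qpoch_inf (- (q / (a * xi))) q * qpoch_inf (- (a * xi)) q
       / (qpoch_inf (a * q ^ m) q * qpoch_inf q q
        * (qpoch_inf (a' / a) q * qpoch_inf (a'' / a) q)))).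
    + apply Ccv_scal. apply Ccv_div.
      * repeat apply Cmult_neq_0; auto. rewrite qpoch_inf_shift by auto.
        apply Cdiv_nz; auto. apply qpoch_nz. auto.
      * apply Ccv_mult; [apply Ccv_mult|].
        -- apply (qpoch_cv_along _ q (fun M => (M - m)%nat) m); auto. intros; lia.
        -- apply (qpoch_cv_along _ q (fun M => (M - m)%nat) m); auto. intros; lia.
        -- apply (qpoch_cv_along _ q (fun M => (m + M)%nat) 0); auto. intros; lia.
      * apply Ccv_mult; [apply Ccv_mult|apply Ccv_mult].
        -- now apply qpoch_cv.
        -- apply (qpoch_cv_along _ q (fun M => (M - 1 - m)%nat) (S m)); auto. intros; lia.
        -- apply (qpoch_cv_along _ q (fun M => (M - m)%nat) m); auto. intros; lia.
        -- apply (qpoch_cv_along _ q (fun M => (M - m)%nat) m); auto. intros; lia.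
    + unfold K, solterm, solcoef.
      rewrite jacobi_triple_product, qpoch_inf_shift by (auto using Cmult_neq_0).
      replace (- q / (a * xi)) with (- (q / (a * xi))) by (unfold Cdiv; ring).
      field. repeat split; auto using qpochq_nz; apply qpoch_nz; auto.
Qed.

End Limits.

(** * The terminating case and the connection formula *)

Lemma qpoch_drop (a q : C) m N : q <> 0 -> a <> 0 -> (m <= N)%nat ->
  qpoch a q (N - m) * ((- (a * q ^ N)) ^ m * qpoch (q / (a * q ^ N)) q m)
  = qpoch a q N * tri q (S m).
Proof.
  intros Hq Ha Hm. replace N with (N - m + m)%nat at 4 by lia. rewrite qpoch_add.
  assert (qm : q ^ m <> 0) by now apply Cpow_nz.
  assert (qN : q ^ N <> 0) by now apply Cpow_nz.
  replace (a * q ^ (N - m)) with (a * q ^ N / q ^ m).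
  - rewrite qpoch_reverse by (auto using Cmult_neq_0). field. now apply tri_nz.
  - replace N with (N - m + m)%nat at 1 by lia. rewrite Cpow_add_r. field. auto.
Qed.

Lemma qpoch_terminates (a q : C) N n : a * q ^ N = 1 -> (N < n)%nat -> qpoch a q n = 0.
Proof.
  intros H Hn. replace n with (S N + (n - S N))%nat by lia. rewrite qpoch_add. simpl.
  rewrite H. ring.
Qed.

Lemma m1_pow_sq n : (- (1)) ^ n * (- (1)) ^ n = 1.
Proof.
  rewrite <- Cpow_mult_l. replace (- (1) * - (1)) with (RtoC 1) by ring. apply Cpow_1_l.
Qed.

(** When the series terminates, reading its coefficients backwards gives the
    expansion at infinity, up to a monomial in [xi]. *)
Lemma terminating_reverse (q b1 xi a a' a'' : C) N m :
  (0 < Cmod q < 1)%R -> xi <> 0 -> b1 <> 0 -> (forall n, b1 * q ^ n <> 1) ->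
  a <> 0 -> a' <> 0 -> a'' <> 0 ->
  ~ spiral 1 q (a / a') -> ~ spiral 1 q (a / a'') ->
  ~ spiral 1 q (a' / a) -> ~ spiral 1 q (a'' / a) ->
  a * q ^ N = 1 -> (m <= N)%nat ->
  borelcoef a a' a'' b1 q (N - m) * (- xi) ^ (N - m) =
  conncoef a a' a'' b1 q * (xi ^ N / tri q (S N)) * solterm a a' a'' b1 q xi m.
Proof.
  intros hq hxi hb1 hbq Ha Ha' Ha'' H1 H2 H3 H4 HN Hm.
  pose proof (q_nz q hq) as Hq. assert (Hq1 : (Cmod q < 1)%R) by lra.
  assert (qN : q ^ N <> 0) by now apply Cpow_nz.
  assert (EN : q ^ N = / a).
  { replace (q ^ N) with (a * q ^ N / a) by (field; auto). rewrite HN. field. auto. }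
  pose proof (spiral_qpow_neq q _ Hq H3) as g3. pose proof (spiral_qpow_neq q _ Hq H4) as g4.
  pose proof (spiral_qshift_neq q _ _ Hq H1) as g1. pose proof (spiral_qshift_neq q _ _ Hq H2) as g2.
  assert (Econn : conncoef a a' a'' b1 q = qpoch a' q N * qpoch a'' q N / qpoch b1 q N).
  { unfold conncoef. rewrite (qpoch_inf_split a' q N), (qpoch_inf_split a'' q N) by auto.
    rewrite (qpoch_inf_split b1 q N) by auto. rewrite EN.
    replace (a' * / a) with (a' / a) by reflexivity.
    replace (a'' * / a) with (a'' / a) by reflexivity.
    replace (b1 * / a) with (b1 / a) by reflexivity.
    assert (qpoch b1 q N <> 0) by (apply qpoch_nz; auto).
    assert (qpoch_inf (b1 / a) q <> 0).
    { apply qpoch_inf_nz; auto. intros n.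
      unfold Cdiv. rewrite <- EN, <- Cmult_assoc, <- Cpow_add_r. auto. }
    pose proof (qpoch_inf_nz _ q Hq1 g3). pose proof (qpoch_inf_nz _ q Hq1 g4).
    field. repeat split; auto. }
  assert (EaN : qpoch a q N = (- (1)) ^ N * qpoch q q N / tri q (S N)).
  { rewrite <- qpoch_reverse_1 by auto. f_equal. rewrite EN. field. auto. }
  pose proof (qpoch_drop a q m N Hq Ha Hm) as D.
  pose proof (qpoch_drop a' q m N Hq Ha' Hm) as D'.
  pose proof (qpoch_drop a'' q m N Hq Ha'' Hm) as D''.
  pose proof (qpoch_drop b1 q m N Hq hb1 Hm) as Db.
  pose proof (qpoch_drop q q m N Hq Hq Hm) as Dq.
  rewrite HN in D. rewrite EN in D', D'', Db, Dq.
  replace (q / 1) with q in D by field.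
  replace (q / (a' * / a)) with (a * q / a') in D' by (field; auto).
  replace (q / (a'' * / a)) with (a * q / a'') in D'' by (field; auto).
  replace (q / (b1 * / a)) with (a * q / b1) in Db by (field; auto).
  replace (q / (q * / a)) with a in Dq by (field; auto).
  pose proof (tri_nz q (S m) Hq) as NT. pose proof (tri_nz q (S N) Hq) as NTN.
  assert (Nb : qpoch b1 q N <> 0) by (apply qpoch_nz; auto).
  assert (Nbm : qpoch b1 q (N - m) <> 0) by (apply qpoch_nz; auto).
  pose proof (qpochq_nz q N hq) as NqN. pose proof (qpochq_nz q m hq) as Nqm.
  pose proof (qpochq_nz q (N - m) hq) as NqNm.
  assert (Ng1 : qpoch (a * q / a') q m <> 0) by (apply qpoch_nz; auto).
  assert (Ng2 : qpoch (a * q / a'') q m <> 0) by (apply qpoch_nz; auto).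
  assert (S0 : (- (1)) ^ m <> 0) by (apply Cpow_nz, Copp_nz, C1_nz).
  assert (U' : (- (a' * / a)) ^ m <> 0) by (apply Cpow_nz, Copp_nz, Cdiv_nz; auto).
  assert (U'' : (- (a'' * / a)) ^ m <> 0) by (apply Cpow_nz, Copp_nz, Cdiv_nz; auto).
  assert (Ub : (- (b1 * / a)) ^ m <> 0) by (apply Cpow_nz, Copp_nz, Cdiv_nz; auto).
  assert (Uq : (- (q * / a)) ^ m <> 0) by (apply Cpow_nz, Copp_nz, Cdiv_nz; auto).
  assert (Nab : qpoch (a * q / b1) q m <> 0).
  { intros E. rewrite E in Db. apply (Cmult_neq_0 _ _ Nb NT). rewrite <- Db. ring. }
  assert (Na : qpoch a q m <> 0).
  { intros E. rewrite E in Dq. apply (Cmult_neq_0 _ _ NqN NT). rewrite <- Dq. ring. }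
  assert (Pw : (- (b1 * / a)) ^ m * (- (q * / a)) ^ m =
     (q * b1 / (a' * a'' * xi)) ^ m * (xi ^ m * ((- (a' * / a)) ^ m * (- (a'' * / a)) ^ m))).
  { rewrite <- !Cpow_mult_l. f_equal. field. auto. }
  assert (Px : (- xi) ^ (N - m) = (- (1)) ^ N * (- (1)) ^ m * (xi ^ N / xi ^ m)).
  { replace (- xi) with (- (1) * xi) by ring. rewrite Cpow_mult_l.
    replace N with (N - m + m)%nat at 3 4 by lia. rewrite !Cpow_add_r.
    transitivity ((- (1)) ^ (N - m) * xi ^ (N - m) * ((- (1)) ^ m * (- (1)) ^ m)).
    - rewrite m1_pow_sq. ring.
    - field. now apply Cpow_nz. }
  unfold borelcoef, solterm, solcoef. rewrite Econn, Px.
  assert (Xm : xi ^ m <> 0) by now apply Cpow_nz.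
  set (T := tri q (S m)) in *. set (X := (q * b1 / (a' * a'' * xi)) ^ m) in *.
  set (s := (- (1)) ^ m) in *. set (u' := (- (a' * / a)) ^ m) in *.
  set (u'' := (- (a'' * / a)) ^ m) in *.
  set (ub := (- (b1 * / a)) ^ m) in *. set (uq := (- (q * / a)) ^ m) in *.
  replace (qpoch a q (N - m)) with (qpoch a q N * T / (s * qpoch q q m))
    by (rewrite <- D; field; auto).
  replace (qpoch a' q (N - m)) with (qpoch a' q N * T / (u' * qpoch (a * q / a') q m))
    by (rewrite <- D'; field; auto).
  replace (qpoch a'' q (N - m)) with (qpoch a'' q N * T / (u'' * qpoch (a * q / a'') q m))
    by (rewrite <- D''; field; auto).
  replace (qpoch b1 q (N - m)) with (qpoch b1 q N * T / (ub * qpoch (a * q / b1) q m))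
    by (rewrite <- Db; field; auto).
  replace (qpoch q q (N - m)) with (qpoch q q N * T / (uq * qpoch a q m))
    by (rewrite <- Dq; field; auto).
  rewrite EaN. replace X with (ub * uq / (xi ^ m * (u' * u''))) by (rewrite Pw; field; auto).
  pose proof (m1_pow_sq N) as SN. set (sN := (- (1)) ^ N) in *.
  match goal with |- _ = ?R => transitivity ((sN * sN) * R); [|rewrite SN; ring] end.
  field. repeat split; auto.
Qed.

Lemma connection_terminating (q b1 xi a a' a'' : C) N :
  (0 < Cmod q < 1)%R -> xi <> 0 -> b1 <> 0 -> (forall n, b1 * q ^ n <> 1) ->
  a <> 0 -> a' <> 0 -> a'' <> 0 ->
  ~ spiral 1 q (a / a') -> ~ spiral 1 q (a / a'') ->
  ~ spiral 1 q (a' / a) -> ~ spiral 1 q (a'' / a) ->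
  a * q ^ N = 1 ->
  theta q xi * CSeries (fun n => borelcoef a a' a'' b1 q n * (- xi) ^ n) =
  conncoef a a' a'' b1 q * theta q (a * xi) * solser a a' a'' b1 q xi.
Proof.
  intros hq hxi hb1 hbq Ha Ha' Ha'' H1 H2 H3 H4 HN.
  pose proof (q_nz q hq) as Hq. assert (qN : q ^ N <> 0) by now apply Cpow_nz.
  assert (Eth : theta q (a * xi) = theta q xi * (xi ^ N / tri q (S N))).
  { replace (a * xi) with (xi * Cpowz q (- Z.of_nat N)).
    - rewrite theta_qshift, qtri_neg, Cpowz_neg by auto.
      replace (Z.of_nat N + 1)%Z with (Z.of_nat (S N)) by lia. rewrite qtri_nat by auto.
      pose proof (tri_nz q (S N) Hq). pose proof (Cpow_nz xi N hxi). field. auto.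
    - rewrite Cpowz_neg. replace a with (a * q ^ N / q ^ N) by (field; auto).
      rewrite HN. field. auto. }
  rewrite (Cser_CSeries _ (csum (fun n => borelcoef a a' a'' b1 q n * (- xi) ^ n) (S N))).
  2: { apply (Cser_fin (fun n => borelcoef a a' a'' b1 q n * (- xi) ^ n)). intros n Hn.
       unfold borelcoef. rewrite (qpoch_terminates a q N n) by (auto; lia).
       unfold Cdiv. ring. }
  unfold solser. rewrite (Cser_CSeries _ (csum (solterm a a' a'' b1 q xi) (S N))).
  2: { apply Cser_fin. intros n Hn.
       unfold solterm, solcoef. rewrite (qpoch_terminates a q N n) by (auto; lia).
       unfold Cdiv. ring. }
  rewrite Eth, csum_rev.
  rewrite (csum_ext _ (fun m => conncoef a a' a'' b1 q * (xi ^ N / tri q (S N)) *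
             solterm a a' a'' b1 q xi m)).
  - rewrite csum_scal. ring.
  - intros m Hm. replace (S N - 1 - m)%nat with (N - m)%nat by lia.
    apply terminating_reverse; auto. lia.
Qed.

Lemma conn_zero_l (a a' a'' b1 q : C) N : (Cmod q < 1)%R -> a' * q ^ N = 1 ->
  conncoef a a' a'' b1 q = 0.
Proof.
  intros Hq H. unfold conncoef. rewrite (qpoch_inf_zero a' q N) by auto. unfold Cdiv. ring.
Qed.

Lemma conn_zero_r (a a' a'' b1 q : C) N : (Cmod q < 1)%R -> a'' * q ^ N = 1 ->
  conncoef a a' a'' b1 q = 0.
Proof.
  intros Hq H. unfold conncoef. rewrite (qpoch_inf_zero a'' q N) by auto. unfold Cdiv. ring.
Qed.

(** If no [a_j] is of the form [q^(-N)] this is the limit of [residue_sum].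
    Otherwise the nodes [q^n] and [q^(-m) / a_j] collide; but then the series
    terminates, and the coefficients of the other two solutions vanish. *)
Theorem connection_disc (q a1 a2 a3 b1 xi : C) :
  (0 < Cmod q < 1)%R -> a1 <> 0 -> a2 <> 0 -> a3 <> 0 -> b1 <> 0 ->
  ~ spiral 1 q (a1 / a2) -> ~ spiral 1 q (a2 / a1) ->
  ~ spiral 1 q (a1 / a3) -> ~ spiral 1 q (a3 / a1) ->
  ~ spiral 1 q (a2 / a3) -> ~ spiral 1 q (a3 / a2) ->
  (forall n, b1 * q ^ n <> 1) -> xi <> 0 -> (Cmod xi < 1)%R ->
  theta q xi * CSeries (fun n => borelcoef a1 a2 a3 b1 q n * (- xi) ^ n) =
  conncoef a1 a2 a3 b1 q * theta q (a1 * xi) * solser a1 a2 a3 b1 q xi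
  + conncoef a2 a1 a3 b1 q * theta q (a2 * xi) * solser a2 a1 a3 b1 q xi
  + conncoef a3 a1 a2 b1 q * theta q (a3 * xi) * solser a3 a1 a2 b1 q xi.
Proof.
  intros hq ha1 ha2 ha3 hb1 h12 h21 h13 h31 h23 h32 hbq hxi hxi1.
  pose proof (q_nz q hq) as Hq. assert (Hq1 : (Cmod q < 1)%R) by lra.
  destruct (excluded_middle_informative (exists N, a1 * q ^ N = 1)) as [[N E]|g1].
  { rewrite (connection_terminating q b1 xi a1 a2 a3 N) by auto.
    rewrite (conn_zero_l a2 a1 a3 b1 q N), (conn_zero_l a3 a1 a2 b1 q N) by auto. ring. }
  destruct (excluded_middle_informative (exists N, a2 * q ^ N = 1)) as [[N E]|g2].
  { rewrite (CSeries_ext _ (fun n => borelcoef a2 a1 a3 b1 q n * (- xi) ^ n)).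
    2: { intros n. unfold borelcoef, Cdiv. ring. }
    rewrite (connection_terminating q b1 xi a2 a1 a3 N) by auto.
    rewrite (conn_zero_l a1 a2 a3 b1 q N), (conn_zero_r a3 a1 a2 b1 q N) by auto. ring. }
  destruct (excluded_middle_informative (exists N, a3 * q ^ N = 1)) as [[N E]|g3].
  { rewrite (CSeries_ext _ (fun n => borelcoef a3 a1 a2 b1 q n * (- xi) ^ n)).
    2: { intros n. unfold borelcoef, Cdiv. ring. }
    rewrite (connection_terminating q b1 xi a3 a1 a2 N) by auto.
    rewrite (conn_zero_r a1 a2 a3 b1 q N), (conn_zero_r a2 a1 a3 b1 q N) by auto. ring. }
  assert (g1' : forall n, a1 * q ^ n <> 1) by (intros n E; apply g1; now exists n).
  assert (g2' : forall n, a2 * q ^ n <> 1) by (intros n E; apply g2; now exists n).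
  assert (g3' : forall n, a3 * q ^ n <> 1) by (intros n E; apply g3; now exists n).
  pose proof (residue_q_limit q b1 xi hq hxi hxi1 hbq a1 a2 a3 g1' g2' g3') as L.
  pose proof (residue_a_limit q b1 xi hq hxi hb1 a1 a2 a3 ha1 ha2 ha3 g1' h12 h13 h21 h31) as L1.
  pose proof (residue_a_limit q b1 xi hq hxi hb1 a2 a1 a3 ha2 ha1 ha3 g2' h21 h23 h12 h32) as L2.
  pose proof (residue_a_limit q b1 xi hq hxi hb1 a3 a1 a2 ha3 ha1 ha2 g3' h31 h32 h13 h23) as L3.
  assert (L0 : Ccv (fun M => - (- xi) ^ M) 0).
  { apply Ccv_zero_geom with 1%R (Cmod xi); [split; auto using Cmod_ge_0|].
    intros n. rewrite Cmod_opp, Cmod_pow, Cmod_opp. lra. }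
  pose proof (Ccv_plus _ _ _ _ (Ccv_plus _ _ _ _ (Ccv_plus _ _ _ _ L1 L2) L3) L0) as R.
  apply (Ccv_ext_loc _ (fun M => csum (residue_q q a1 a2 a3 b1 xi M) M) _ 1) in R.
  2: { intros M HM. cbv beta.
       rewrite (residue_sum q a1 a2 a3 b1 xi) by auto. ring. }
  pose proof (Ccv_unique _ _ _ L R) as E.
  pose proof (qpoch_inf_nz q q Hq1 (qq_nz q hq)) as I0.
  pose proof (qpoch_inf_nz b1 q Hq1 hbq) as Ib.
  pose proof (qpoch_inf_nz a1 q Hq1 g1') as I1. pose proof (qpoch_inf_nz a2 q Hq1 g2') as I2.
  pose proof (qpoch_inf_nz a3 q Hq1 g3') as I3.
  assert (I : forall x, ~ spiral 1 q x -> qpoch_inf x q <> 0).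
  { intros x Hx. apply qpoch_inf_nz; auto. now apply spiral_qpow_neq. }
  pose proof (I _ h12). pose proof (I _ h21). pose proof (I _ h13). pose proof (I _ h31).
  pose proof (I _ h23). pose proof (I _ h32).
  set (psi := CSeries (fun n => borelcoef a1 a2 a3 b1 q n * (- xi) ^ n)) in *.
  set (K := qpoch_inf b1 q / (qpoch_inf q q * qpoch_inf q q *
              (qpoch_inf a1 q * qpoch_inf a2 q * qpoch_inf a3 q))).
  assert (HK : K <> 0).
  { apply Cdiv_nz; auto. repeat apply Cmult_neq_0; auto. }
  transitivity ((K * theta q xi * psi) / K); [field; auto|].
  replace (K * theta q xi * psi) with (qpoch_inf b1 q * theta q xi /
    (qpoch_inf q q * qpoch_inf q q * (qpoch_inf a1 q * qpoch_inf a2 q * qpoch_inf a3 q)) * psi)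
    by (unfold K, Cdiv; ring).
  rewrite E. unfold K, conncoef. field. repeat split; auto.
Qed.

(** * The two series and their q-difference equations *)

Lemma qBorel_coef (a1 a2 a3 b1 q : C) n : (0 < Cmod q < 1)%R ->
  qBorel q (phi_coef [a1; a2; a3] (b1 :: nil) q) n = borelcoef a1 a2 a3 b1 q n * (- (1)) ^ n.
Proof.
  intros H. pose proof (q_nz q H) as Hq.
  unfold qBorel, phi_coef, qpochs, borelcoef.
  change (1 + Z.of_nat (length (b1 :: nil)) - Z.of_nat (length [a1; a2; a3]))%Z with (-1)%Z.
  cbn [map Cprod fold_right]. cbn [Cpowz Pos.to_nat Pos.iter_op]. rewrite Cpow_1_r.
  rewrite qtri_nat by auto.
  pose proof (tri_nz q n Hq). pose proof (m1_pow_sq n) as S1.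
  assert (S0 : (- (1)) ^ n <> 0) by (apply Cpow_nz, Copp_nz, C1_nz).
  assert (E : / ((- (1)) ^ n * tri q n) * tri q n = (- (1)) ^ n).
  { transitivity (((- (1)) ^ n * (- (1)) ^ n) * (/ ((- (1)) ^ n * tri q n) * tri q n)).
    - rewrite S1. ring.
    - field. auto. }
  rewrite <- Cmult_assoc, E. unfold Cdiv. rewrite !Cmult_1_r. ring.
Qed.

Lemma phi_coef_solcoef (a a' a'' b1 q : C) n :
  phi_coef [a; a * q / b1; RtoC 0] [a * q / a'; a * q / a''] q n = solcoef a a' a'' b1 q n.
Proof.
  unfold phi_coef, qpochs, solcoef.
  match goal with |- context [Cpowz _ ?k] => change k with 0%Z end.
  cbn [map Cprod fold_right Cpowz]. rewrite qpoch_0, !Cmult_1_r. unfold Cdiv. ring.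
Qed.

Lemma qpow_S_neq1 (q : C) n : (0 < Cmod q < 1)%R -> 1 - q * q ^ n <> 0.
Proof. intros H. apply Cminus_nz. apply not_eq_sym. now apply qq_nz. Qed.

(** With [(T f)(xi) = f(q xi)], the equation is
    [(1 - T)(1 - (b1/q) T) psi = - xi (1 - a1 T)(1 - a2 T)(1 - a3 T) psi],
    the generating form of the first-order recurrence of the coefficients. *)
Lemma psi_spec (q a1 a2 a3 b1 : C) : (0 < Cmod q < 1)%R -> (forall n, b1 * q ^ n <> 1) ->
  let psi := mero_cont (fun xi => qpoles q (- xi)) (qBorel q (phi_coef [a1; a2; a3] (b1 :: nil) q)) in
  (forall xi, (Cmod xi < 1)%R -> Cser (fun n => borelcoef a1 a2 a3 b1 q n * (- xi) ^ n) (psi xi)) /\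
  (forall xi, ~ qpoles q (- xi) ->
     psi xi + - (1 + b1 / q) * psi (q * xi) + b1 / q * psi (q ^ 2 * xi)
     = - xi * (psi xi + - (a1 + a2 + a3) * psi (q * xi)
         + (a1 * a2 + a1 * a3 + a2 * a3) * psi (q ^ 2 * xi)
         + - (a1 * a2 * a3) * psi (q ^ 3 * xi))).
Proof.
  intros H Hb psi. pose proof (q_nz q H) as Hq.
  destruct (borelcoef_bounded a1 a2 a3 b1 q H Hb) as (B & _ & HB).
  destruct (qdiff_continuation q (- (1)) (- (a1 + a2 + a3)) (a1 * a2 + a1 * a3 + a2 * a3)
    (- (a1 * a2 * a3)) (- (1 + b1 / q)) (b1 / q) 0
    (qBorel q (phi_coef [a1; a2; a3] (b1 :: nil) q)) H) with (B := B)
    (P := fun xi => qpoles q (- xi)) as [F1 F2].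
  - rewrite Cmod_opp. apply Cmod_1.
  - intros n. rewrite qBorel_coef, Cmod_mult, Cmod_pow, Cmod_opp, Cmod_1, pow1 by auto.
    rewrite Rmult_1_r. auto.
  - ring.
  - intros n. rewrite !qBorel_coef by auto. unfold borelcoef. cbn [qpoch]. rewrite !Cpow_S.
    assert (N1 : qpoch b1 q n <> 0) by (apply qpoch_nz; auto).
    pose proof (qpochq_nz q n H) as N2. pose proof (qpow_S_neq1 q n H) as N3.
    assert (N4 : 1 - b1 * q ^ n <> 0) by (apply Cminus_nz; apply not_eq_sym; auto).
    field. auto.
  - intros z. replace (- (1) * z) with (- z) by ring. tauto.
  - fold psi in F1, F2. split.
    + intros xi Hx. specialize (F1 xi Hx). revert F1. apply Cser_ext. intros n.
      rewrite qBorel_coef by auto. replace (- xi) with (- (1) * xi) by ring.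
      rewrite Cpow_mult_l. ring.
    + intros xi Hx. specialize (F2 xi). replace (- (1) * xi) with (- xi) in F2 by ring.
      specialize (F2 Hx). rewrite <- F2. ring.
Qed.

(** With [(T f)(z) = f(q z)], the equation is
    [(1 - T)(1 - (a/a') T)(1 - (a/a'') T) f = z (1 - a T)(1 - (a q/b1) T) f]. *)
Lemma phi_spec (q a a' a'' b1 : C) : (0 < Cmod q < 1)%R ->
  a <> 0 -> a' <> 0 -> a'' <> 0 -> b1 <> 0 ->
  ~ spiral 1 q (a / a') -> ~ spiral 1 q (a / a'') ->
  let f := phi [a; a * q / b1; RtoC 0] [a * q / a'; a * q / a''] q in
  (forall z, (Cmod z < 1)%R -> Cser (fun n => solcoef a a' a'' b1 q n * z ^ n) (f z)) /\
  (forall z, ~ qpoles q z ->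
     f z + - (1 + a / a' + a / a'') * f (q * z)
     + (a / a' + a / a'' + a / a' * (a / a'')) * f (q ^ 2 * z)
     + - (a / a' * (a / a'')) * f (q ^ 3 * z)
     = z * (f z + - (a + a * q / b1) * f (q * z) + a * (a * q / b1) * f (q ^ 2 * z))).
Proof.
  intros H Ha Ha' Ha'' Hb H1 H2 f. pose proof (q_nz q H) as Hq.
  destruct (solcoef_bounded a a' a'' b1 q H H1 H2) as (B & _ & HB).
  set (c := phi_coef [a; a * q / b1; RtoC 0] [a * q / a'; a * q / a''] q).
  destruct (qdiff_continuation q 1 (- (a + a * q / b1)) (a * (a * q / b1)) 0
    (- (1 + a / a' + a / a'')) (a / a' + a / a'' + a / a' * (a / a'')) (- (a / a' * (a / a'')))
    c H) with (B := B) (P := qpoles q) as [F1 F2].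
  - apply Cmod_1.
  - intros n. unfold c. rewrite phi_coef_solcoef. auto.
  - ring.
  - intros n. unfold c. rewrite !phi_coef_solcoef. unfold solcoef. cbn [qpoch]. rewrite !(Cpow_S q n).
    assert (N0 : forall n, 1 - a * q / a' * q ^ n <> 0).
    { intros m. apply Cminus_nz, not_eq_sym. now apply spiral_qshift_neq. }
    assert (N1 : forall n, 1 - a * q / a'' * q ^ n <> 0).
    { intros m. apply Cminus_nz, not_eq_sym. now apply spiral_qshift_neq. }
    assert (N2 : qpoch (a * q / a') q n <> 0).
    { apply qpoch_nz. intros k _. now apply spiral_qshift_neq. }
    assert (N3 : qpoch (a * q / a'') q n <> 0).
    { apply qpoch_nz. intros k _. now apply spiral_qshift_neq. }
    pose proof (qpochq_nz q n H) as N4. pose proof (qpow_S_neq1 q n H) as N5.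
    specialize (N0 n). specialize (N1 n).
    set (g1 := qpoch (a * q / a') q n) in *. set (g2 := qpoch (a * q / a'') q n) in *.
    replace (1 + - (1 + a / a' + a / a'') * (q * q ^ n) +
      (a / a' + a / a'' + a / a' * (a / a'')) * (q * q ^ n) ^ 2 +
       - (a / a' * (a / a'')) * (q * q ^ n) ^ 3)
      with ((1 - a * q / a' * q ^ n) * (1 - a * q / a'' * q ^ n) * (1 - q * q ^ n))
      by (simpl; field; auto).
    match goal with |- ?L = ?R => replace L with
      (qpoch a q n * (1 - a * q ^ n) * (qpoch (a * q / b1) q n * (1 - a * q / b1 * q ^ n))
        / (g1 * g2 * qpoch q q n)) end.
    + simpl. field. auto.
    + set (d1 := 1 - a * q / a' * q ^ n) in *. set (d2 := 1 - a * q / a'' * q ^ n) in *.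
      simpl. field. repeat split; auto.
  - intros z. rewrite Cmult_1_l. tauto.
  - change (mero_cont (qpoles q) c) with f in F1, F2. split.
    + intros z Hz. specialize (F1 z Hz). revert F1. apply Cser_ext. intros n.
      unfold c. now rewrite phi_coef_solcoef.
    + intros z Hz. specialize (F2 z). rewrite Cmult_1_l in F2.
      rewrite F2 by auto. ring.
Qed.

(** A factor with [g(q xi) = g(xi) / a] turns [solser] into a solution of the
    equation of [psi].  In the termwise comparison the right-hand side has one more
    term, which vanishes because [1 / a] is a root of
    [(1 - a t)(1 - a' t)(1 - a'' t)]. *)
Lemma solser_qdiff (q a a' a'' b1 xi : C) : (0 < Cmod q < 1)%R ->
  a <> 0 -> a' <> 0 -> a'' <> 0 -> b1 <> 0 -> xi <> 0 ->
  ~ spiral 1 q (a / a') -> ~ spiral 1 q (a / a'') ->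
  let E := solser a a' a'' b1 q in
  E xi + - (1 + b1 / q) / a * E (q * xi) + b1 / q / a ^ 2 * E (q ^ 2 * xi)
  = - xi * (E xi + - (a + a' + a'') / a * E (q * xi)
      + (a * a' + a * a'' + a' * a'') / a ^ 2 * E (q ^ 2 * xi)
      + - (a * a' * a'') / a ^ 3 * E (q ^ 3 * xi)).
Proof.
  intros H Ha Ha' Ha'' Hb Hxi H1 H2 E. pose proof (q_nz q H) as Hq.
  assert (qn : forall n, q ^ n <> 0) by (intros; now apply Cpow_nz).
  set (e := fun m => solcoef a a' a'' b1 q m * (tri q (S m) * (q * b1 / (a' * a'')) ^ m)).
  assert (S : forall i, Cser (fun m => e m / xi ^ m / (q ^ m) ^ i) (E (q ^ i * xi))).
  { intros i. generalize (solser_Cser a a' a'' b1 q (q ^ i * xi) H H1 H2). apply Cser_ext.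
    intros m. unfold solterm, e.
    replace (q * b1 / (a' * a'' * (q ^ i * xi))) with (q * b1 / (a' * a'') * (/ xi * / q ^ i))
      by (field; auto).
    rewrite !Cpow_mult_l, !Cpow_inv by auto.
    rewrite <- !Cpow_mult_r, (Nat.mul_comm i m). field.
    split; now apply Cpow_nz. }
  pose proof (S 0%nat) as S0. pose proof (S 1%nat) as S1. pose proof (S 2%nat) as S2.
  pose proof (S 3%nat) as S3. clear S.
  replace (q ^ 0 * xi) with xi in S0 by (simpl; ring).
  replace (q ^ 1 * xi) with (q * xi) in S1 by (simpl; ring).
  pose proof (Cser_plus _ _ _ _ (Cser_plus _ _ _ _ S0 (Cser_scal (- (1 + b1 / q) / a) _ _ S1))
    (Cser_scal (b1 / q / a ^ 2) _ _ S2)) as L.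
  pose proof (Cser_scal (- xi) _ _ (Cser_plus _ _ _ _ (Cser_plus _ _ _ _
    (Cser_plus _ _ _ _ S0 (Cser_scal (- (a + a' + a'') / a) _ _ S1))
    (Cser_scal ((a * a' + a * a'' + a' * a'') / a ^ 2) _ _ S2))
    (Cser_scal (- (a * a' * a'') / a ^ 3) _ _ S3))) as R.
  apply Cser_S_inv in R. cbv beta in L, R.
  match type of R with Cser ?b ?r => match type of L with Cser ?c ?l =>
    assert (EQ : l = r); [apply (Cser_unique b); [|exact R]; revert L; apply Cser_ext|] end end.
  - intros m.
    assert (Erec : e (S m) * ((1 - a * q ^ S m / a') * (1 - a * q ^ S m / a'') * (1 - q ^ S m))
      = e m * ((1 - a * q ^ m) * (1 - a * q ^ S m / b1)) * (q ^ S m * (q * b1 / (a' * a'')))).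
    { unfold e, solcoef. cbn [qpoch]. change (tri q (S (S m))) with (tri q (S m) * q ^ S m).
      rewrite !(Cpow_S (q * b1 / (a' * a''))).
      assert (N0 : 1 - a * q / a' * q ^ m <> 0).
      { apply Cminus_nz, not_eq_sym. now apply spiral_qshift_neq. }
      assert (N1 : 1 - a * q / a'' * q ^ m <> 0).
      { apply Cminus_nz, not_eq_sym. now apply spiral_qshift_neq. }
      assert (N2 : qpoch (a * q / a') q m <> 0).
      { apply qpoch_nz. intros k _. now apply spiral_qshift_neq. }
      assert (N3 : qpoch (a * q / a'') q m <> 0).
      { apply qpoch_nz. intros k _. now apply spiral_qshift_neq. }
      pose proof (qpochq_nz q m H) as N4. pose proof (qpow_S_neq1 q m H) as N5.
      replace (1 - a * q ^ S m / a') with (1 - a * q / a' * q ^ m) by (rewrite Cpow_S; field; auto).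
      replace (1 - a * q ^ S m / a'') with (1 - a * q / a'' * q ^ m) by (rewrite Cpow_S; field; auto).
      replace (1 - a * q ^ S m / b1) with (1 - a * q / b1 * q ^ m) by (rewrite Cpow_S; field; auto).
      replace (1 - q ^ S m) with (1 - q * q ^ m) by (rewrite Cpow_S; ring).
      set (d1 := 1 - a * q / a' * q ^ m) in *. set (d2 := 1 - a * q / a'' * q ^ m) in *.
      set (g1 := qpoch (a * q / a') q m) in *. set (g2 := qpoch (a * q / a'') q m) in *.
      set (X := (q * b1 / (a' * a'')) ^ m). set (g3 := qpoch (a * q / b1) q m).
      set (T := tri q (S m)). set (Q := q ^ S m).
      field. repeat split; auto. }
    assert (Xm : xi ^ m <> 0) by now apply Cpow_nz. specialize (qn m).
    transitivity (e m * ((1 - a * q ^ m) * (1 - a * q ^ S m / b1)) * (q ^ S m * (q * b1 / (a' * a'')))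
       * (a' * a'' / (a ^ 2 * q ^ S m * q ^ S m * q ^ S m * xi ^ m))).
    + rewrite !(Cpow_S q m). field. repeat split; auto.
    + transitivity (e (S m) * ((1 - a * q ^ S m / a') * (1 - a * q ^ S m / a'') * (1 - q ^ S m))
         * (a' * a'' / (a ^ 2 * q ^ S m * q ^ S m * q ^ S m * xi ^ m))).
      * rewrite Erec. reflexivity.
      * rewrite (Cpow_S xi m), !(Cpow_S q m). field. repeat split; auto.
  - rewrite EQ. simpl. field. auto.
Qed.

(** * The connection formula along the spiral of [lam] *)

Lemma Z_descent (P : Z -> Prop) (K : nat) :
  (forall n, (K <= n)%nat -> P (Z.of_nat n)) ->
  (forall k, P (k + 1)%Z -> P (k + 2)%Z -> P (k + 3)%Z -> P k) -> forall k, P k.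
Proof.
  intros H0 HS k.
  assert (A : forall (n : nat) k, (Z.of_nat K - Z.of_nat n <= k)%Z -> P k).
  { induction n as [|n IH]; intros j Hj.
    - rewrite <- (Z2Nat.id j) by lia. apply H0. lia.
    - apply HS; apply IH; lia. }
  apply (A (Z.to_nat (Z.of_nat K - k))). lia.
Qed.

Lemma spiral_small (q lam : C) (e : R) : (0 < Cmod q < 1)%R -> (0 < e)%R ->
  exists K, forall n, (K <= n)%nat -> (Cmod (lam * q ^ n) < e)%R.
Proof.
  intros H He. pose proof (Cmod_ge_0 lam).
  destruct (pow_small (Cmod q) (e / (Cmod lam + 1))) as [K HK]; [lra| |].
  { apply Rdiv_lt_0_compat; lra. }
  exists K. intros n Hn. specialize (HK n Hn). rewrite Cmod_mult, Cmod_pow.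
  apply Rle_lt_trans with (Cmod lam * (e / (Cmod lam + 1)))%R; [apply Rmult_le_compat_l; lra|].
  replace e with ((Cmod lam + 1) * (e / (Cmod lam + 1)))%R at 2 by (field; lra).
  apply Rmult_lt_compat_r; [apply Rdiv_lt_0_compat|]; lra.
Qed.

Lemma spiral_not_pole (q lam : C) k : (0 < Cmod q < 1)%R -> lam <> 0 ->
  ~ spiral (- (1)) q lam -> ~ qpoles q (- (lam * Cpowz q k)).
Proof.
  intros H Hl Hs [n E]. pose proof (q_nz q H) as Hq. apply Hs.
  exists (- Z.of_nat n - k)%Z. unfold Z.sub.
  rewrite Cpowz_add, Cpowz_neg, Cpowz_opp by auto. rewrite <- E. field. now apply Cpowz_nz.
Qed.

Lemma bounded_from (u : nat -> C) (K : nat) B :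
  (forall n, (K <= n)%nat -> (Cmod (u n) <= B)%R) ->
  exists B', (0 <= B')%R /\ forall n, (Cmod (u n) <= B')%R.
Proof.
  intros H. revert B H. induction K as [|K IH]; intros B H.
  - exists B. split; [|intros; apply H; lia].
    specialize (H O (le_n _)). pose proof (Cmod_ge_0 (u O)). lra.
  - apply (IH (Rmax B (Cmod (u K)))). intros n Hn.
    destruct (Nat.eq_dec n K) as [->|N]; [apply Rmax_r|].
    apply Rle_trans with B; [apply H; lia|apply Rmax_l].
Qed.

Section Spiral.
Context (q a1 a2 a3 b1 lam : C) (hq : (0 < Cmod q < 1)%R).
Context (ha1 : a1 <> 0) (ha2 : a2 <> 0) (ha3 : a3 <> 0) (hb1 : b1 <> 0).
Context (h12 : ~ spiral 1 q (a1 / a2)) (h21 : ~ spiral 1 q (a2 / a1)).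
Context (h13 : ~ spiral 1 q (a1 / a3)) (h31 : ~ spiral 1 q (a3 / a1)).
Context (h23 : ~ spiral 1 q (a2 / a3)) (h32 : ~ spiral 1 q (a3 / a2)).
Context (hbq : forall n, b1 * q ^ n <> 1).
Context (hlam : lam <> 0) (hlamq : ~ spiral (- (1)) q lam).

Definition borelval (k : Z) : C :=
  mero_cont (fun xi => qpoles q (- xi)) (qBorel q (phi_coef [a1; a2; a3] (b1 :: nil) q))
    (lam * Cpowz q k).

(** [1 / a^k] is, up to a constant, the theta quotient [theta_q(a xi) / theta_q(xi)] at
    [xi = lam q^k]. *)
Definition solval (a a' a'' : C) (k : Z) : C :=
  solser a a' a'' b1 q (lam * Cpowz q k) / Cpowz a k.

(** Coefficients of the three solutions in [theta_q(lam) borelval]. *)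
Definition weight (a a' a'' : C) : C := conncoef a a' a'' b1 q * theta q (a * lam).

(** The equation of [psi], read along the spiral. *)
Definition spiral_rec (y : Z -> C) : Prop := forall k,
  y k + - (1 + b1 / q) * y (k + 1)%Z + b1 / q * y (k + 2)%Z
  = - (lam * Cpowz q k) * (y k + - (a1 + a2 + a3) * y (k + 1)%Z
      + (a1 * a2 + a1 * a3 + a2 * a3) * y (k + 2)%Z + - (a1 * a2 * a3) * y (k + 3)%Z).

Lemma Cpowz_plus_nat (x : C) k n : x <> 0 -> Cpowz x (k + Z.of_nat n) = Cpowz x k * x ^ n.
Proof. intros Hx. now rewrite Cpowz_add, Cpowz_nat. Qed.

Lemma borelval_rec : spiral_rec borelval.
Proof using hq hbq hlam hlamq.
  intros k. pose proof (q_nz q hq) as Hq.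
  pose proof (psi_spec q a1 a2 a3 b1 hq hbq) as [_ P].
  specialize (P (lam * Cpowz q k) (spiral_not_pole q lam k hq hlam hlamq)).
  assert (E : forall n : nat, borelval (k + Z.of_nat n) =
    mero_cont (fun xi => qpoles q (- xi)) (qBorel q (phi_coef [a1; a2; a3] (b1 :: nil) q))
    (q ^ n * (lam * Cpowz q k))).
  { intros n. unfold borelval. f_equal. rewrite Cpowz_plus_nat by auto. ring. }
  pose proof (E 1%nat) as E1. pose proof (E 2%nat) as E2. pose proof (E 3%nat) as E3.
  replace (q ^ 1 * (lam * Cpowz q k)) with (q * (lam * Cpowz q k)) in E1 by (simpl; ring).
  change (Z.of_nat 1) with 1%Z in E1. change (Z.of_nat 2) with 2%Z in E2.
  change (Z.of_nat 3) with 3%Z in E3. rewrite E1, E2, E3. exact P.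
Qed.

Lemma solval_rec (a a' a'' : C) :
  a <> 0 -> a' <> 0 -> a'' <> 0 -> ~ spiral 1 q (a / a') -> ~ spiral 1 q (a / a'') ->
  a + a' + a'' = a1 + a2 + a3 -> a * a' + a * a'' + a' * a'' = a1 * a2 + a1 * a3 + a2 * a3 ->
  a * a' * a'' = a1 * a2 * a3 -> spiral_rec (solval a a' a'').
Proof using hq hb1 hlam.
  intros Ha Ha' Ha'' H1 H2 E1 E2 E3 k. pose proof (q_nz q hq) as Hq.
  assert (Hx : lam * Cpowz q k <> 0) by (apply Cmult_neq_0; auto using Cpowz_nz).
  pose proof (solser_qdiff q a a' a'' b1 (lam * Cpowz q k) hq Ha Ha' Ha'' hb1 Hx H1 H2) as P.
  cbv zeta in P. rewrite E1, E2, E3 in P.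
  assert (E : forall n : nat, solval a a' a'' (k + Z.of_nat n) =
    solser a a' a'' b1 q (q ^ n * (lam * Cpowz q k)) / (Cpowz a k * a ^ n)).
  { intros n. unfold solval. rewrite !Cpowz_plus_nat by auto. f_equal. f_equal. ring. }
  pose proof (E 1%nat) as F1. pose proof (E 2%nat) as F2. pose proof (E 3%nat) as F3.
  replace (q ^ 1 * (lam * Cpowz q k)) with (q * (lam * Cpowz q k)) in F1 by (simpl; ring).
  change (Z.of_nat 1) with 1%Z in F1. change (Z.of_nat 2) with 2%Z in F2.
  change (Z.of_nat 3) with 3%Z in F3. rewrite F1, F2, F3. unfold solval.
  set (x := lam * Cpowz q k) in *. pose proof (Cpowz_nz a k Ha) as Hk.
  match type of P with ?l = ?r => transitivity (l / Cpowz a k);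
    [|rewrite P] end; simpl; field; auto.
Qed.

(** [connection_disc] applies far enough inside; the common recurrence carries the
    formula outwards because [1 + lam q^k] never vanishes. *)
Theorem connection_spiral k :
  theta q lam * borelval k = weight a1 a2 a3 * solval a1 a2 a3 k
    + weight a2 a1 a3 * solval a2 a1 a3 k + weight a3 a1 a2 * solval a3 a1 a2 k.
Proof using hq ha1 ha2 ha3 hb1 h12 h21 h13 h31 h23 h32 hbq hlam hlamq.
  pose proof (q_nz q hq) as Hq. revert k.
  destruct (spiral_small q lam 1 hq Rlt_0_1) as [K HK].
  apply Z_descent with K.
  - intros n Hn. specialize (HK n Hn).
    assert (Hx : lam * q ^ n <> 0) by (apply Cmult_neq_0; auto; now apply Cpow_nz).
    pose proof (connection_disc q a1 a2 a3 b1 (lam * q ^ n) hq ha1 ha2 ha3 hb1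
      h12 h21 h13 h31 h23 h32 hbq Hx HK) as D.
    pose proof (psi_spec q a1 a2 a3 b1 hq hbq) as [P _]. specialize (P _ HK).
    apply Cser_CSeries in P. rewrite P in D.
    unfold borelval, solval, weight. rewrite !Cpowz_nat.
    assert (T : forall a : C, a <> 0 -> theta q (a * (lam * q ^ n)) =
      theta q (a * lam) / (tri q n * (lam ^ n * a ^ n))).
    { intros a Ha. replace (a * (lam * q ^ n)) with (a * lam * Cpowz q (Z.of_nat n))
        by (rewrite Cpowz_nat; ring).
      rewrite theta_qshift, qtri_nat, Cpowz_nat, Cpow_mult_l by (auto using Cmult_neq_0).
      f_equal. ring. }
    rewrite !T in D by auto.
    pose proof (T 1 C1_nz) as T1. rewrite !Cmult_1_l, Cpow_1_l, Cmult_1_r in T1.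
    rewrite T1 in D.
    assert (N1 : tri q n <> 0) by now apply tri_nz.
    assert (N2 : lam ^ n <> 0) by now apply Cpow_nz.
    assert (N3 : a1 ^ n <> 0) by now apply Cpow_nz.
    assert (N4 : a2 ^ n <> 0) by now apply Cpow_nz.
    assert (N5 : a3 ^ n <> 0) by now apply Cpow_nz.
    set (F := mero_cont (fun xi => qpoles q (- xi))
       (qBorel q (phi_coef [a1; a2; a3] (b1 :: nil) q)) (lam * q ^ n)) in *.
    match type of D with ?l = ?r =>
      transitivity (l * (tri q n * lam ^ n)); [field; auto|rewrite D; field; repeat split; auto] end.
  - intros k D1 D2 D3.
    pose proof (borelval_rec k) as R.
    pose proof (solval_rec a1 a2 a3 ha1 ha2 ha3 h12 h13 eq_refl eq_refl eq_refl k) as R1.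
    pose proof (solval_rec a2 a1 a3 ha2 ha1 ha3 h21 h23 ltac:(ring) ltac:(ring) ltac:(ring) k) as R2.
    pose proof (solval_rec a3 a1 a2 ha3 ha1 ha2 h31 h32 ltac:(ring) ltac:(ring) ltac:(ring) k) as R3.
    set (x := lam * Cpowz q k) in *.
    set (A1 := a1 + a2 + a3) in *. set (A2 := a1 * a2 + a1 * a3 + a2 * a3) in *.
    set (A3 := a1 * a2 * a3) in *.
    set (W := fun j => weight a1 a2 a3 * solval a1 a2 a3 j
      + weight a2 a1 a3 * solval a2 a1 a3 j + weight a3 a1 a2 * solval a3 a1 a2 j).
    fold (W (k + 1)%Z) in D1. fold (W (k + 2)%Z) in D2. fold (W (k + 3)%Z) in D3. fold (W k).
    assert (N : 1 + x <> 0).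
    { intros E. apply hlamq. exists (- k)%Z. rewrite Cpowz_opp by auto.
      replace lam with (x / Cpowz q k) by (unfold x; field; now apply Cpowz_nz).
      replace x with (1 + x - 1) by ring. rewrite E. field. now apply Cpowz_nz. }
    (* Both sides solve the recurrence for the value at [k] in the same way. *)
    assert (Sv : forall u0 u1 u2 u3 : C,
      u0 + - (1 + b1 / q) * u1 + b1 / q * u2 = - x * (u0 + - A1 * u1 + A2 * u2 + - A3 * u3) ->
      u0 = - (- (1 + b1 / q) * u1 + b1 / q * u2 + x * (- A1 * u1 + A2 * u2 + - A3 * u3)) / (1 + x)).
    { intros u0 u1 u2 u3 U.
      replace u0 with ((u0 + - (1 + b1 / q) * u1 + b1 / q * u2
         - (- (1 + b1 / q) * u1 + b1 / q * u2) + x * u0) / (1 + x)) at 1 by (field; auto).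
      rewrite U. field. auto. }
    assert (RW : W k + - (1 + b1 / q) * W (k + 1)%Z + b1 / q * W (k + 2)%Z
      = - x * (W k + - A1 * W (k + 1)%Z + A2 * W (k + 2)%Z + - A3 * W (k + 3)%Z)).
    { unfold W.
      match type of R1 with ?l1 = ?r1 => match type of R2 with ?l2 = ?r2 =>
        match type of R3 with ?l3 = ?r3 =>
        transitivity (weight a1 a2 a3 * l1 + weight a2 a1 a3 * l2 + weight a3 a1 a2 * l3);
        [ring|rewrite R1, R2, R3; ring] end end end. }
    rewrite (Sv _ _ _ _ RW), <- D1, <- D2, <- D3, (Sv _ _ _ _ R). field. auto.
Qed.

Lemma solval_growth (a a' a'' : C) :
  a <> 0 -> ~ spiral 1 q (a / a') -> ~ spiral 1 q (a / a'') -> a' <> 0 -> a'' <> 0 ->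
  exists B, (0 <= B)%R /\
    forall n, (Cmod (solval a a' a'' (- Z.of_nat n)) <= B * Cmod a ^ n)%R.
Proof using hq hlam.
  intros Ha H1 H2 Ha' Ha''. pose proof (q_nz q hq) as Hq.
  pose proof (solterm_summable a a' a'' b1 q lam hq H1 H2) as S.
  destruct (rsum_exists_bound _ S) as (B & HB0 & HB).
  exists B. split; [lra|]. intros n. unfold solval.
  rewrite !Cpowz_neg, Cmod_div by (apply Cinv_nz; now apply Cpow_nz).
  rewrite (Cmod_inv (a ^ n)), Cmod_pow by now apply Cpow_nz.
  unfold Rdiv. rewrite Rinv_inv.
  apply Rmult_le_compat_r; [apply pow_le, Cmod_ge_0|].
  unfold solser. apply CSeries_bound; [now apply solterm_summable|].
  intros N. apply Rle_trans with (2 := HB N). apply rsum_le. intros m _.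
  unfold solterm. rewrite !Cmod_mult. repeat (apply Rmult_le_compat_l; [apply Cmod_ge_0|]).
  rewrite !Cmod_pow. apply pow_incr. split; [apply Cmod_ge_0|].
  replace (q * b1 / (a' * a'' * (lam * / q ^ n))) with (q * b1 / (a' * a'' * lam) * q ^ n)
    by (field; repeat split; auto; now apply Cpow_nz).
  rewrite Cmod_mult, Cmod_pow. pose proof (Cmod_ge_0 (q * b1 / (a' * a'' * lam))).
  pose proof (pow_01 (Cmod q) n ltac:(lra)).
  nra.
Qed.

(** Towards the origin [psi] is bounded by its power series; towards infinity the
    connection formula gives geometric growth. *)
Lemma borelval_growth : expgrowth borelval.
Proof using hq ha1 ha2 ha3 hb1 h12 h21 h13 h31 h23 h32 hbq hlam hlamq.
  pose proof (q_nz q hq) as Hq.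
  destruct (borelcoef_bounded a1 a2 a3 b1 q hq hbq) as (Bc & Pc & Kc).
  destruct (spiral_small q lam (1 / 2) hq ltac:(lra)) as [K HK].
  destruct (bounded_from (fun n => borelval (Z.of_nat n)) K (Bc * 2)) as (B0 & P0 & K0).
  { intros n Hn. specialize (HK n Hn). unfold borelval. rewrite Cpowz_nat.
    pose proof (psi_spec q a1 a2 a3 b1 hq hbq) as [P _].
    specialize (P (lam * q ^ n) ltac:(lra)). apply Cser_CSeries in P. rewrite <- P.
    apply CSeries_bound.
    - apply bounded_power_summable with Bc; auto. rewrite Cmod_opp. lra.
    - intros N. apply Rle_trans with (rsum (fun k => Bc * (1 / 2) ^ k)%R N).
      + apply rsum_le. intros k _. rewrite Cmod_mult, Cmod_pow, Cmod_opp.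
        apply Rmult_le_compat; auto using Cmod_ge_0.
        * apply pow_le, Cmod_ge_0.
        * apply pow_incr. split; [apply Cmod_ge_0|lra].
      + rewrite rsum_scal. apply Rmult_le_compat_l; [lra|].
        apply Rle_trans with (/ (1 - 1 / 2))%R; [apply (rsum_geom_le (1 / 2) N); lra|].
        right. field. }
  destruct (solval_growth a1 a2 a3) as (B1 & P1 & K1); auto.
  destruct (solval_growth a2 a1 a3) as (B2 & P2 & K2); auto.
  destruct (solval_growth a3 a1 a2) as (B3 & P3 & K3); auto.
  assert (Ht : theta q lam <> 0).
  { intros E. apply hlamq. now apply theta_zero. }
  set (c1 := Cmod (weight a1 a2 a3 / theta q lam)). set (c2 := Cmod (weight a2 a1 a3 / theta q lam)).
  set (c3 := Cmod (weight a3 a1 a2 / theta q lam)).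
  assert (0 <= c1 /\ 0 <= c2 /\ 0 <= c3)%R as (C1 & C2 & C3) by (repeat split; apply Cmod_ge_0).
  set (w := (1 + Cmod a1 + Cmod a2 + Cmod a3)%R).
  pose proof (Cmod_ge_0 a1). pose proof (Cmod_ge_0 a2). pose proof (Cmod_ge_0 a3).
  exists (B0 + c1 * B1 + c2 * B2 + c3 * B3)%R, w.
  assert (0 <= c1 * B1 /\ 0 <= c2 * B2 /\ 0 <= c3 * B3)%R as (D1 & D2 & D3)
    by (repeat split; apply Rmult_le_pos; auto).
  split; [lra|]. split; [unfold w; lra|]. intros n.
  assert (Hw : (1 <= w ^ n)%R).
  { rewrite <- (pow1 n). apply pow_incr. unfold w. lra. }
  split.
  - specialize (K0 n). apply Rle_trans with (1 := K0).
    apply Rle_trans with (B0 * w ^ n)%R; [|apply Rmult_le_compat_r; lra].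
    rewrite <- (Rmult_1_r B0) at 1. apply Rmult_le_compat_l; auto.
  - replace (borelval (- Z.of_nat n)) with (weight a1 a2 a3 / theta q lam * solval a1 a2 a3 (- Z.of_nat n)
      + weight a2 a1 a3 / theta q lam * solval a2 a1 a3 (- Z.of_nat n)
      + weight a3 a1 a2 / theta q lam * solval a3 a1 a2 (- Z.of_nat n)).
    2: { transitivity (theta q lam * borelval (- Z.of_nat n) / theta q lam).
         - rewrite connection_spiral. field. auto.
         - field. auto. }
    assert (M : forall (c : C) (B : R) (a : C) (v : C), (0 <= B)%R -> (Cmod a <= w)%R ->
       (Cmod v <= B * Cmod a ^ n)%R -> (Cmod (c * v) <= Cmod c * B * w ^ n)%R).
    { intros c B a v HB Ha Hv. rewrite Cmod_mult, Rmult_assoc.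
      apply Rmult_le_compat_l; [apply Cmod_ge_0|]. apply Rle_trans with (1 := Hv).
      apply Rmult_le_compat_l; auto. apply pow_incr. split; auto using Cmod_ge_0. }
    pose proof (M (weight a1 a2 a3 / theta q lam) B1 a1 _ P1 ltac:(unfold w; lra) (K1 n)) as M1.
    pose proof (M (weight a2 a1 a3 / theta q lam) B2 a2 _ P2 ltac:(unfold w; lra) (K2 n)) as M2.
    pose proof (M (weight a3 a1 a2 / theta q lam) B3 a3 _ P3 ltac:(unfold w; lra) (K3 n)) as M3.
    fold c1 in M1. fold c2 in M2. fold c3 in M3.
    eapply Rle_trans; [apply Cmod_triangle|].
    eapply Rle_trans; [apply Rplus_le_compat_r, Cmod_triangle|].
    assert (0 <= B0 * w ^ n)%R by (apply Rmult_le_pos; lra). lra.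
Qed.
End Spiral.

(** * Summation of the q-Laplace series *)

Lemma rsum_S_l f n : rsum f (S n) = (f O + rsum (fun k => f (S k)) n)%R.
Proof. change (S n) with (1 + n)%nat. rewrite rsum_app. simpl. ring. Qed.

Lemma rsum_rev f n : rsum f n = rsum (fun k => f (n - 1 - k)%nat) n.
Proof.
  induction n as [|n IH]; [reflexivity|].
  rewrite rsum_S_l with (f := fun k => f (S n - 1 - k)%nat). cbn [rsum].
  rewrite IH. replace (S n - 1 - 0)%nat with n by lia.
  rewrite (rsum_ext (fun k => f (n - 1 - k)%nat) (fun k => f (S n - 1 - S k)%nat)).
  - ring.
  - intros k Hk. f_equal. lia.
Qed.

(** The sum over [k] of [|t(k - m)|] does not depend on [m], so [fubini] applies to
    each half of the bilateral series. *)
Lemma Zser_convolution (p : nat -> C) (t : Z -> C) (T : C) :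
  csummable p -> Zsummable t -> Zser t T ->
  Zser (fun k => CSeries (fun m => p m * t (k - Z.of_nat m)%Z)) (CSeries p * T).
Proof.
  intros Hp [Ht1 Ht2] HT.
  destruct (rsum_exists_bound _ Ht1) as (T1 & P1 & K1).
  destruct (rsum_exists_bound _ Ht2) as (T2 & P2 & K2).
  assert (B1 : forall m N, (rsum (fun n => Cmod (t (Z.of_nat n - Z.of_nat m)%Z)) N <= T2 + T1)%R).
  { intros m N. apply Rle_trans with (rsum (fun n => Cmod (t (Z.of_nat n - Z.of_nat m)%Z)) (m + N)).
    - apply rsum_mono; [intros; apply Cmod_ge_0|lia].
    - rewrite rsum_app. apply Rplus_le_compat.
      + rewrite rsum_rev. apply Rle_trans with (2 := K2 m). right. apply rsum_ext.
        intros k Hk. do 2 f_equal. lia.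
      + apply Rle_trans with (2 := K1 N). right. apply rsum_ext.
        intros k Hk. do 2 f_equal. lia. }
  assert (B2 : forall m N,
     (rsum (fun n => Cmod (t (- Z.of_nat (S n) - Z.of_nat m)%Z)) N <= T2 + T1)%R).
  { intros m N. apply Rle_trans with (rsum (fun n => Cmod (t (- Z.of_nat (S n))%Z)) (m + N)).
    - rewrite rsum_app.
      pose proof (rsum_nonneg (fun n => Cmod (t (- Z.of_nat (S n))%Z)) m (fun _ => Cmod_ge_0 _)).
      rewrite (rsum_ext (fun n => Cmod (t (- Z.of_nat (S n) - Z.of_nat m)%Z))
        (fun k => Cmod (t (- Z.of_nat (S (m + k)))%Z))); [lra|].
      intros k Hk. do 2 f_equal. lia.
    - specialize (K2 (m + N)%nat). lra. }
  (* Any window of consecutive terms of [t], of either half, has modulus sum at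
     most [T2 + T1]. *)
  set (M := fun m => ((T2 + T1) * Cmod (p m))%R).
  assert (HM : rsummable M) by (apply rsummable_scal; [lra|exact Hp]).
  assert (G : forall (s : nat -> nat -> Z), (forall m N, (rsum (fun n => Cmod (t (s m n))) N <= T2 + T1)%R) ->
     forall m N, (rsum (fun n => Cmod (p m * t (s m n))) N <= M m)%R).
  { intros s Hs m N. rewrite (rsum_ext _ (fun n => Cmod (p m) * Cmod (t (s m n)))%R).
    - rewrite rsum_scal. unfold M. rewrite (Rmult_comm (T2 + T1)).
      apply Rmult_le_compat_l; [apply Cmod_ge_0|auto].
    - intros; apply Cmod_mult. }
  pose proof (G (fun m n => (Z.of_nat n - Z.of_nat m)%Z) B1) as G1.
  pose proof (G (fun m n => (- Z.of_nat (S n) - Z.of_nat m)%Z) B2) as G2.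
  pose proof (fubini (fun m n => p m * t (Z.of_nat n - Z.of_nat m)%Z) M HM G1) as F1.
  pose proof (fubini (fun m n => p m * t (- Z.of_nat (S n) - Z.of_nat m)%Z) M HM G2) as F2.
  eexists _, _. split; [exact F1|]. split; [exact F2|].
  assert (HC : forall (s : nat -> nat -> Z), (forall m N, (rsum (fun n => Cmod (p m * t (s m n))) N <= M m)%R) ->
     csummable (fun m => CSeries (fun n => p m * t (s m n)))).
  { intros s Hs. apply csummable_le with M; auto. intros m. apply CSeries_bound; auto.
    split; [intros; apply Cmod_ge_0|]. exists (M m). auto. }
  rewrite (Cmult_comm (CSeries p)), <- (Cser_CSeries _ _ (Cser_scal T _ _ (csummable_Cser _ Hp))).
  apply Cser_CSeries.
  pose proof (Cser_plus _ _ _ _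
    (csummable_Cser _ (HC (fun m n => (Z.of_nat n - Z.of_nat m)%Z) G1))
    (csummable_Cser _ (HC (fun m n => (- Z.of_nat (S n) - Z.of_nat m)%Z) G2))) as R.
  revert R. apply Cser_ext. intros m.
  pose proof (Zser_scal (p m) _ _ (Zser_shift t T (- Z.of_nat m) HT)) as Z.
  apply Zser_CSeriesZ in Z. rewrite (Cmult_comm T), <- Z. reflexivity.
Qed.

Section Laplace.
Context (q a1 a2 a3 b1 lam : C) (hq : (0 < Cmod q < 1)%R).
Context (ha1 : a1 <> 0) (ha2 : a2 <> 0) (ha3 : a3 <> 0) (hb1 : b1 <> 0).
Context (h12 : ~ spiral 1 q (a1 / a2)) (h21 : ~ spiral 1 q (a2 / a1)).
Context (h13 : ~ spiral 1 q (a1 / a3)) (h31 : ~ spiral 1 q (a3 / a1)).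
Context (h23 : ~ spiral 1 q (a2 / a3)) (h32 : ~ spiral 1 q (a3 / a2)).
Context (hbq : forall n, b1 * q ^ n <> 1).
Context (hlam : lam <> 0) (hlamq : ~ spiral (- (1)) q lam).

(** Chosen so that the argument of the [3phi2] is [kappa u] when [u = lam / x]. *)
Definition kappa : C := q * b1 / (a1 * a2 * a3 * lam).

Definition solphi (a a' a'' : C) : C -> C :=
  phi [a; a * q / b1; RtoC 0] [a * q / a'; a * q / a''] q.

(** For [|kappa u| < 1], the Laplace transform of [solval] multiplied by
    [theta_q(u)]. *)
Definition sollap (a a' a'' u : C) : C := theta q (u / a) * solphi a a' a'' (kappa * u).

Definition borellap (u : C) : C := laurent (borelval q a1 a2 a3 b1 lam) q u.

(** The Gaussian factors of the Laplace kernel and of the solution combine with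
    [q^(-k m)] to one Gaussian factor in [k - m], so the double sum is the
    convolution of a theta series with the [3phi2]. *)
Lemma laplace_solval (a a' a'' u : C) : a <> 0 -> a' <> 0 -> a'' <> 0 ->
  ~ spiral 1 q (a / a') -> ~ spiral 1 q (a / a'') ->
  a * a' * a'' = a1 * a2 * a3 -> u <> 0 -> (Cmod (kappa * u) < 1)%R ->
  Zser (fun k => solval q b1 lam a a' a'' k * (qtri q k * Cpowz u k)) (sollap a a' a'' u).
Proof using hq hb1 hlam.
  intros Ha Ha' Ha'' H1 H2 E Hu Hk. pose proof (q_nz q hq) as Hq.
  destruct (phi_spec q a a' a'' b1 hq Ha Ha' Ha'' hb1 H1 H2) as [P _].
  specialize (P _ Hk). apply Cser_CSeries in P. fold (solphi a a' a'') in P.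
  assert (Hua : u / a <> 0) by now apply Cdiv_nz.
  destruct (solcoef_bounded a a' a'' b1 q hq H1 H2) as (B & _ & HB).
  assert (Sp : csummable (fun m => solcoef a a' a'' b1 q m * (kappa * u) ^ m))
    by (apply bounded_power_summable with B; auto).
  pose proof (Zser_convolution _ _ _ Sp (theta_summable q (u / a) hq Hua)
     (theta_Zser q (u / a) hq Hua)) as Cv.
  unfold sollap. rewrite <- P, Cmult_comm. revert Cv. apply Zser_ext. intros k.
  unfold solval.
  assert (Hx : lam * Cpowz q k <> 0) by (apply Cmult_neq_0; auto using Cpowz_nz).
  pose proof (solser_Cser a a' a'' b1 q (lam * Cpowz q k) hq H1 H2) as Es.
  transitivity (qtri q k * Cpowz u k / Cpowz a k * solser a a' a'' b1 q (lam * Cpowz q k));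
    [|unfold Cdiv; ring].
  apply Cser_CSeries. apply (Cser_scal (qtri q k * Cpowz u k / Cpowz a k)) in Es.
  revert Es. apply Cser_ext. intros m. unfold solterm.
  pose proof (Cpowz_nz q k Hq) as N1. pose proof (Cpowz_nz u k Hu) as N2.
  pose proof (Cpowz_nz a k Ha) as N3. pose proof (Cpow_nz u m Hu) as N4.
  pose proof (Cpow_nz a m Ha) as N5.
  unfold Z.sub. rewrite qtri_add, Cpowz_add, Cpowz_neg by auto.
  replace (Cpowz (u / a) k) with (Cpowz u k / Cpowz a k)
    by (unfold Cdiv; rewrite Cpowz_mult_l, Cpowz_inv by auto using Cinv_nz; reflexivity).
  rewrite qtri_neg. replace (Z.of_nat m + 1)%Z with (Z.of_nat (S m)) by lia.
  rewrite qtri_nat by auto.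
  replace (k * - Z.of_nat m)%Z with (k * Z.of_nat m * -1)%Z by ring.
  rewrite !Cpowz_mul, Cpowz_nat by auto. cbn [Cpowz Pos.to_nat Pos.iter_op].
  assert (N6 : Cpowz q k ^ m <> 0) by now apply Cpow_nz.
  assert (E2 : (q * b1 / (a' * a'' * (lam * Cpowz q k))) ^ m * (u / a) ^ m
     = (kappa * u) ^ m * / Cpowz q k ^ m).
  { rewrite <- Cpow_inv by auto. rewrite <- !Cpow_mult_l. f_equal. unfold kappa. rewrite <- E.
    field. auto. }
  assert (N7 : (u / a) ^ m <> 0) by now apply Cpow_nz.
  rewrite !Cpow_1_r.
  replace ((q * b1 / (a' * a'' * (lam * Cpowz q k))) ^ m)
    with ((kappa * u) ^ m * / Cpowz q k ^ m / (u / a) ^ m) by (rewrite <- E2; field; auto).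
  set (X := (u / a) ^ m) in *. field. repeat split; auto.
Qed.

Lemma borellap_Zser (u : C) : u <> 0 ->
  Zser (fun k => borelval q a1 a2 a3 b1 lam k * (qtri q k * Cpowz u k)) (borellap u).
Proof using hq ha1 ha2 ha3 hb1 h12 h21 h13 h31 h23 h32 hbq hlam hlamq.
  intros Hu. apply laurent_Zser; [exact hq|apply borelval_growth; auto|exact Hu].
Qed.

Definition sollap_sum (u : C) : C :=
  weight q b1 lam a1 a2 a3 * sollap a1 a2 a3 u + weight q b1 lam a2 a1 a3 * sollap a2 a1 a3 u
  + weight q b1 lam a3 a1 a2 * sollap a3 a1 a2 u.

Lemma laplace_small (u : C) : u <> 0 -> (Cmod (kappa * u) < 1)%R -> theta q lam * borellap u = sollap_sum u.
Proof using hq ha1 ha2 ha3 hb1 h12 h21 h13 h31 h23 h32 hbq hlam hlamq.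
  intros Hu Hk.
  pose proof (laplace_solval a1 a2 a3 u ha1 ha2 ha3 h12 h13 ltac:(ring) Hu Hk) as L1.
  pose proof (laplace_solval a2 a1 a3 u ha2 ha1 ha3 h21 h23 ltac:(ring) Hu Hk) as L2.
  pose proof (laplace_solval a3 a1 a2 u ha3 ha1 ha2 h31 h32 ltac:(ring) Hu Hk) as L3.
  pose proof (Zser_plus _ _ _ _ (Zser_plus _ _ _ _ (Zser_scal (weight q b1 lam a1 a2 a3) _ _ L1)
    (Zser_scal (weight q b1 lam a2 a1 a3) _ _ L2)) (Zser_scal (weight q b1 lam a3 a1 a2) _ _ L3)) as R.
  apply (Zser_unique (fun k => theta q lam *
     (borelval q a1 a2 a3 b1 lam k * (qtri q k * Cpowz u k)))).
  - apply Zser_scal. now apply borellap_Zser.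
  - revert R. apply Zser_ext. intros k.
    transitivity (theta q lam * borelval q a1 a2 a3 b1 lam k * (qtri q k * Cpowz u k)); [|ring].
    rewrite connection_spiral by auto. ring.
Qed.

(** * The q-difference equation in the Laplace variable *)

(** Vanishes for [F(u) = sum_k y_k q^(k(k-1)/2) u^k] when [y] satisfies [spiral_rec]:
    shifting [k] by [i] becomes replacing [u] by [u / q^i]. *)
Definition laplace_eq (F : C -> C) (u : C) : C :=
  F u + - (1 + b1 / q) * q / u * F (u / q) + b1 / q * q ^ 3 / u ^ 2 * F (u / q ^ 2)
  + lam * (F (u * q) + - (a1 + a2 + a3) / u * F u
    + (a1 * a2 + a1 * a3 + a2 * a3) * q / u ^ 2 * F (u / q)
    + - (a1 * a2 * a3) * q ^ 3 / u ^ 3 * F (u / q ^ 2)).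

Lemma borellap_shift (u : C) (i : nat) : u <> 0 ->
  Zser (fun k => borelval q a1 a2 a3 b1 lam (k + Z.of_nat i) * (qtri q k * Cpowz u k))
    (tri q (S i) / u ^ i * borellap (u / q ^ i)).
Proof using hq ha1 ha2 ha3 hb1 h12 h21 h13 h31 h23 h32 hbq hlam hlamq.
  intros Hu. pose proof (q_nz q hq) as Hq.
  assert (Hqi : q ^ i <> 0) by now apply Cpow_nz.
  assert (Hui : u ^ i <> 0) by now apply Cpow_nz.
  assert (Huq : u / q ^ i <> 0) by now apply Cdiv_nz.
  pose proof (Zser_scal (tri q (S i) / u ^ i) _ _ (Zser_shift _ _ (Z.of_nat i) (borellap_Zser _ Huq))) as Z.
  revert Z. apply Zser_ext. intros k. cbv beta.
  rewrite qtri_add, qtri_nat, Cpowz_mul, Cpowz_nat by auto.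
  rewrite (Cpowz_plus_nat (u / q ^ i)) by auto.
  replace (Cpowz (u / q ^ i) k) with (Cpowz u k / Cpowz (q ^ i) k)
    by (unfold Cdiv; rewrite Cpowz_mult_l, Cpowz_inv by auto using Cinv_nz; reflexivity).
  replace ((u / q ^ i) ^ i) with (u ^ i / (q ^ i) ^ i)
    by (unfold Cdiv; rewrite Cpow_mult_l, Cpow_inv by auto; reflexivity).
  replace (Cpowz (q ^ i) k) with (Cpowz q k ^ i).
  2: { rewrite <- (Cpowz_nat q i), <- Cpowz_mul, (Z.mul_comm (Z.of_nat i) k), Cpowz_mul, Cpowz_nat
         by auto. reflexivity. }
  cbn [tri]. rewrite <- (tri_square q i) by auto.
  pose proof (tri_nz q i Hq). assert (Cpowz q k ^ i <> 0) by (apply Cpow_nz; now apply Cpowz_nz).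
  field. repeat split; auto.
Qed.

Lemma borellap_eq (u : C) : u <> 0 -> laplace_eq borellap u = 0.
Proof using hq ha1 ha2 ha3 hb1 h12 h21 h13 h31 h23 h32 hbq hlam hlamq.
  intros Hu. pose proof (q_nz q hq) as Hq.
  assert (Huq : u * q <> 0) by now apply Cmult_neq_0.
  set (y := borelval q a1 a2 a3 b1 lam).
  pose proof (borellap_shift u 0 Hu) as S0. pose proof (borellap_shift u 1 Hu) as S1.
  pose proof (borellap_shift u 2 Hu) as S2.
  pose proof (borellap_shift (u * q) 0 Huq) as T0. pose proof (borellap_shift (u * q) 1 Huq) as T1.
  pose proof (borellap_shift (u * q) 2 Huq) as T2. pose proof (borellap_shift (u * q) 3 Huq) as T3.
  fold y in S0, S1, S2, T0, T1, T2, T3.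
  pose proof (Zser_plus _ _ _ _ (Zser_plus _ _ _ _ S0 (Zser_scal (- (1 + b1 / q)) _ _ S1))
     (Zser_scal (b1 / q) _ _ S2)) as L.
  pose proof (Zser_scal lam _ _ (Zser_plus _ _ _ _ (Zser_plus _ _ _ _ (Zser_plus _ _ _ _
     T0 (Zser_scal (- (a1 + a2 + a3)) _ _ T1))
     (Zser_scal (a1 * a2 + a1 * a3 + a2 * a3) _ _ T2)) (Zser_scal (- (a1 * a2 * a3)) _ _ T3))) as R.
  pose proof (Zser_plus _ _ _ _ L R) as A. clear S0 S1 S2 T0 T1 T2 T3 L R.
  cbv beta in A.
  match type of A with Zser ?f ?s => transitivity s; [|apply (Zser_unique f _ _ A)] end.
  - unfold laplace_eq. cbn [tri].
    replace (u / q ^ 0) with u by (simpl; field).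
    replace (u * q / q ^ 0) with (u * q) by (simpl; field).
    replace (u / q ^ 1) with (u / q) by (simpl; field; auto).
    replace (u * q / q ^ 1) with u by (simpl; field; auto).
    replace (u * q / q ^ 2) with (u / q) by (simpl; field; auto).
    replace (u * q / q ^ 3) with (u / q ^ 2) by (simpl; field; auto).
    set (g := borellap). simpl. field. auto.
  - generalize Zser_zero. apply Zser_ext. intros k. symmetry.
    pose proof (borelval_rec q a1 a2 a3 b1 lam hq hbq hlam hlamq k) as Y. fold y in Y.
    change (Z.of_nat 0) with 0%Z. change (Z.of_nat 1) with 1%Z.
    change (Z.of_nat 2) with 2%Z. change (Z.of_nat 3) with 3%Z. rewrite Z.add_0_r.
    rewrite Cpowz_mult_l by auto.
    match type of Y with ?l = ?r =>
      transitivity (qtri q k * Cpowz u k * (l - r)); [ring|rewrite Y; ring] end.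
Qed.

(** The theta factor picks up powers of [u / a] under [u -> u / q^i]; dividing
    them out leaves the equation of the [3phi2] at [kappa u / q^2]. *)
Lemma sollap_eq (a a' a'' u : C) : a <> 0 -> a' <> 0 -> a'' <> 0 ->
  ~ spiral 1 q (a / a') -> ~ spiral 1 q (a / a'') ->
  a + a' + a'' = a1 + a2 + a3 -> a * a' + a * a'' + a' * a'' = a1 * a2 + a1 * a3 + a2 * a3 ->
  a * a' * a'' = a1 * a2 * a3 -> u <> 0 -> ~ qpoles q (kappa * (u / q ^ 2)) ->
  laplace_eq (sollap a a' a'') u = 0.
Proof using hq hb1 hlam.
  intros Ha Ha' Ha'' H1 H2 E1 E2 E3 Hu Hp. pose proof (q_nz q hq) as Hq.
  destruct (phi_spec q a a' a'' b1 hq Ha Ha' Ha'' hb1 H1 H2) as [_ P].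
  specialize (P _ Hp). fold (solphi a a' a'') in P.
  unfold laplace_eq. rewrite <- E1, <- E2, <- E3. unfold sollap.
  assert (T : forall k, theta q (u / a * Cpowz q k) = theta q (u / a) / (qtri q k * Cpowz (u / a) k)).
  { intros k. apply theta_qshift; auto. now apply Cdiv_nz. }
  pose proof (T (-1)%Z) as T1. pose proof (T (-2)%Z) as T2. pose proof (T 1%Z) as T3. clear T.
  unfold qtri in T1, T2, T3. simpl in T1, T2, T3.
  replace (u / a * / (q * 1)) with (u / q / a) in T1 by (field; auto).
  replace (u / a * / (q * (q * 1))) with (u / (q * (q * 1)) / a) in T2 by (field; auto).
  replace (u / a * (q * 1)) with (u * q / a) in T3 by (field; auto).
  simpl in P |- *. set (f := solphi a a' a'') in *. set (th := theta q (u / a)) in *.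
  replace (q * (kappa * (u / (q * (q * 1))))) with (kappa * (u / q)) in P by (field; auto).
  replace (q * (q * 1) * (kappa * (u / (q * (q * 1))))) with (kappa * u) in P by (field; auto).
  replace (q * (q * (q * 1)) * (kappa * (u / (q * (q * 1))))) with (kappa * (u * q)) in P by (field; auto).
  set (f0 := f (kappa * (u / (q * (q * 1))))) in *. set (f1 := f (kappa * (u / q))) in *.
  set (f2 := f (kappa * u)) in *. set (f3 := f (kappa * (u * q))) in *.
  rewrite T1, T2, T3. clear T1 T2 T3.
  match type of P with ?l = ?r =>
    (* The factor is read off from the coefficient of [f (kappa (u q))]. *)
    transitivity (- th * lam * a / u * (a' * a'' / a ^ 2) * (l - r)) end.
  - unfold kappa. rewrite <- E3. simpl. field. repeat split; auto.
  - rewrite P. ring.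
Qed.

(** The coefficient of [F(u / q^2)] in [laplace_eq] is a nonzero multiple of
    [1 - kappa u / q^2], so off the poles a solution is determined by its values
    closer to the origin. *)
Lemma laplace_descent (F : C -> C) :
  (forall u : C, u <> 0 -> (Cmod (kappa * u) < 1)%R -> F u = 0) ->
  (forall u : C, u <> 0 -> ~ qpoles q (kappa * (u / q ^ 2)) -> laplace_eq F u = 0) ->
  forall v : C, v <> 0 -> ~ qpoles q (kappa * v) -> F v = 0.
Proof using hq ha1 ha2 ha3 hb1 hlam.
  intros H0 HE v Hv Hp. pose proof (q_nz q hq) as Hq.
  assert (qn : forall n, q ^ n <> 0) by (intros; now apply Cpow_nz).
  destruct (spiral_small q (kappa * v) 1 hq Rlt_0_1) as [K HK].
  assert (A : forall n k, (K <= k + n)%nat -> F (v * q ^ k) = 0).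
  { induction n as [|n IH]; intros k Hk.
    - apply H0; [now apply Cmult_neq_0|]. rewrite Cmult_assoc. apply HK. lia.
    - assert (Hu : v * q ^ (k + 2) <> 0) by now apply Cmult_neq_0.
      assert (Eu : v * q ^ (k + 2) / q ^ 2 = v * q ^ k) by (rewrite Cpow_add_r; field; auto).
      assert (Hpk : ~ qpoles q (kappa * (v * q ^ k))).
      { intros Q. apply Hp. apply (qpoles_shift q _ k); auto.
        now replace (q ^ k * (kappa * v)) with (kappa * (v * q ^ k)) by ring. }
      pose proof (HE _ Hu) as L. unfold laplace_eq in L. rewrite Eu in L. specialize (L Hpk).
      replace (v * q ^ (k + 2) / q) with (v * q ^ S k) in L
        by (rewrite Cpow_add_r, Cpow_S; simpl; field; auto).
      replace (v * q ^ (k + 2) * q) with (v * q ^ S (S (S k))) in L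
        by (rewrite Cpow_add_r, !Cpow_S; simpl; ring).
      assert (E1 : F (v * q ^ S k) = 0) by (apply IH; lia).
      assert (E2 : F (v * q ^ (k + 2)) = 0) by (apply IH; lia).
      assert (E3 : F (v * q ^ S (S (S k))) = 0) by (apply IH; lia).
      rewrite E1, E2, E3 in L. set (w := v * q ^ k) in *.
      assert (Hw : w <> 0) by now apply Cmult_neq_0.
      replace (v * q ^ (k + 2)) with (w * q ^ 2) in L by (unfold w; rewrite Cpow_add_r; ring).
      assert (N : 1 - kappa * w <> 0).
      { apply Cminus_nz. intros E. apply Hpk. exists O. rewrite <- E. simpl. field. }
      assert (L2 : - (lam * a1 * a2 * a3) / (w ^ 3 * q ^ 3) * (1 - kappa * w) * F w = 0).
      { rewrite <- L. unfold kappa. simpl. field. repeat split; auto. }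
      apply Cmult_eq0 in L2. destruct L2 as [L2|L2]; auto. exfalso. revert L2.
      apply Cmult_neq_0; auto. apply Cdiv_nz.
      + apply Copp_nz. repeat apply Cmult_neq_0; auto.
      + apply Cmult_neq_0; auto. now apply Cpow_nz. }
  specialize (A K 0%nat ltac:(lia)). replace (v * q ^ 0) with v in A by (simpl; ring). exact A.
Qed.

(** [laplace_small] needs [|kappa u| < 1]; the q-difference equation shared by both
    sides removes this restriction. *)
Theorem laplace_identity (u : C) : u <> 0 -> ~ qpoles q (kappa * u) ->
  theta q lam * borellap u = sollap_sum u.
Proof using hq ha1 ha2 ha3 hb1 h12 h21 h13 h31 h23 h32 hbq hlam hlamq.
  intros Hu Hp.
  assert (E : theta q lam * borellap u - sollap_sum u = 0).
  { apply (laplace_descent (fun u => theta q lam * borellap u - sollap_sum u)); auto.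
    - intros w Hw Hk. rewrite laplace_small by auto. ring.
    - intros w Hw Hpw.
      pose proof (borellap_eq w Hw) as G.
      pose proof (sollap_eq a1 a2 a3 w ha1 ha2 ha3 h12 h13 ltac:(ring) ltac:(ring) ltac:(ring) Hw Hpw) as K1.
      pose proof (sollap_eq a2 a1 a3 w ha2 ha1 ha3 h21 h23 ltac:(ring) ltac:(ring) ltac:(ring) Hw Hpw) as K2.
      pose proof (sollap_eq a3 a1 a2 w ha3 ha1 ha2 h31 h32 ltac:(ring) ltac:(ring) ltac:(ring) Hw Hpw) as K3.
      transitivity (theta q lam * laplace_eq borellap w
        - (weight q b1 lam a1 a2 a3 * laplace_eq (sollap a1 a2 a3) w
         + weight q b1 lam a2 a1 a3 * laplace_eq (sollap a2 a1 a3) w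
         + weight q b1 lam a3 a1 a2 * laplace_eq (sollap a3 a1 a2) w)).
      + unfold laplace_eq, sollap_sum, Cdiv. ring.
      + rewrite G, K1, K2, K3. ring. }
  replace (theta q lam * borellap u) with (theta q lam * borellap u - sollap_sum u + sollap_sum u) by ring.
  rewrite E. ring.
Qed.

Lemma theta_lam_over (x : C) : x <> 0 -> ~ spiral (- lam) q x -> theta q (lam / x) <> 0.
Proof using hq hlam.
  intros Hx Hs E. pose proof (q_nz q hq) as Hq. apply theta_zero in E; auto using Cdiv_nz.
  destruct E as [k E]. apply Hs. exists (- k)%Z. rewrite Cpowz_opp by auto.
  pose proof (Cpowz_nz q k Hq).
  replace x with (lam / (lam / x)) by (field; auto). rewrite E. field. auto.
Qed.

(** The theta functions in the kernel differ from [theta_q(lam / x)] by Gaussian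
    factors only. *)
Lemma f31_borellap (x : C) : x <> 0 -> ~ spiral (- lam) q x ->
  f31 a1 a2 a3 b1 q lam x = borellap (lam / x) / theta q (lam / x).
Proof using hq ha1 ha2 ha3 hb1 h12 h21 h13 h31 h23 h32 hbq hlam hlamq.
  intros Hx Hs. pose proof (q_nz q hq) as Hq. pose proof (theta_lam_over x Hx Hs) as Ht.
  assert (Hu : lam / x <> 0) by now apply Cdiv_nz.
  unfold f31, qLaplace. apply Zser_CSeriesZ.
  replace (borellap (lam / x) / theta q (lam / x)) with (/ theta q (lam / x) * borellap (lam / x))
    by (unfold Cdiv; ring).
  generalize (Zser_scal (/ theta q (lam / x)) _ _ (borellap_Zser _ Hu)). apply Zser_ext.
  intros k. replace (lam * Cpowz q k / x) with (lam / x * Cpowz q k) by (field; auto).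
  rewrite theta_qshift by auto. unfold borelval.
  pose proof (qtri_nz q k Hq). pose proof (Cpowz_nz (lam / x) k Hu).
  set (F := mero_cont _ _). field. auto.
Qed.
End Laplace.

(** * Continuity and removal of singularities *)

Lemma Ccv_pow u l n : Ccv u l -> Ccv (fun k => u k ^ n) (l ^ n).
Proof.
  intros H. induction n as [|n IH]; [apply (Ccv_const 1)|].
  rewrite Cpow_S. apply Ccv_ext with (fun k => u k * u k ^ n); [intros; now rewrite Cpow_S|].
  now apply Ccv_mult.
Qed.

Lemma laurent_seq_continuous (y : Z -> C) (q u : C) (us : nat -> C) :
  (0 < Cmod q < 1)%R -> expgrowth y -> u <> 0 -> (forall n, us n <> 0) ->
  Ccv us u -> Ccv (fun n => laurent y q (us n)) (laurent y q u).
Proof.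
  intros Hq Hy Hu Hus H. pose proof (q_nz q Hq) as Hq0.
  pose proof (Ccv_inv us u Hu H) as H'.
  destruct (Ccv_bounded _ _ H) as (r & Hr0 & Hr). destruct (Ccv_bounded _ _ H') as (s & Hs0 & Hs).
  destruct Hy as (A & w & HA & Hw & Hy).
  assert (TB := fun n => laurent_term_bound y q (us n) A w r s Hq (Hus n) HA Hw Hy (Hr n) (Hs n)).
  unfold laurent, CSeriesZ. apply Ccv_plus.
  - apply tannery with (fun n => A * ((w * r) ^ n * Cmod (tri q n)))%R.
    + apply rsummable_scal; auto. apply tri_summable; auto. apply Rmult_le_pos; lra.
    + intros n i. apply (TB n).
    + intros i. apply Ccv_scal, Ccv_scal. rewrite Cpowz_nat.
      apply Ccv_ext with (fun n => us n ^ i); [intros; now rewrite Cpowz_nat|].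
      now apply Ccv_pow.
  - apply tannery with (fun n => A * ((w * s) ^ S n * Cmod (tri q (S (S n)))))%R.
    + apply rsummable_scal; auto. apply tri_summable2; auto. apply Rmult_le_pos; lra.
    + intros n i. apply (TB n).
    + intros i. apply Ccv_scal, Ccv_scal. rewrite Cpowz_neg.
      apply Ccv_ext with (fun n => / us n ^ S i); [intros; now rewrite Cpowz_neg|].
      apply Ccv_inv; [now apply Cpow_nz|now apply Ccv_pow].
Qed.

Definition punctured (x : C) (Q : C -> Prop) : Prop :=
  exists d : R, (0 < d)%R /\ forall y, y <> x -> (Cmod (y - x) < d)%R -> Q y.

Lemma punctured_and x (Q1 Q2 : C -> Prop) : punctured x Q1 -> punctured x Q2 ->
  punctured x (fun y => Q1 y /\ Q2 y).
Proof.
  intros (d1 & P1 & H1) (d2 & P2 & H2). exists (Rmin d1 d2).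
  pose proof (Rmin_l d1 d2). pose proof (Rmin_r d1 d2).
  split; [now apply Rmin_pos|]. intros y Hy Hd. split; [apply H1|apply H2]; auto; lra.
Qed.

Lemma punctured_impl x (Q1 Q2 : C -> Prop) : (forall y, Q1 y -> Q2 y) ->
  punctured x Q1 -> punctured x Q2.
Proof. intros H (d & P & K). exists d. auto. Qed.

Lemma punctured_nz (x : C) : x <> 0 -> punctured x (fun y => y <> 0).
Proof.
  intros Hx. exists (Cmod x). split; [now apply Cmod_pos|]. intros y _ Hd ->.
  replace (0 - x) with (- x) in Hd by ring. rewrite Cmod_opp in Hd. lra.
Qed.

(** Two points of a spiral are at a distance at least [1 - |q|] times the larger
    modulus, so a spiral has no accumulation point except the origin. *)
Lemma punctured_spiral (mu q x : C) : (0 < Cmod q < 1)%R -> mu <> 0 -> x <> 0 ->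
  punctured x (fun y => ~ spiral mu q y).
Proof.
  intros H Hmu Hx. pose proof (q_nz q H) as Hq. pose proof (Cmod_pos x Hx) as Hx'.
  set (e := (Cmod x * (1 - Cmod q) / 8)%R).
  assert (He : (0 < e)%R) by (unfold e; apply Rdiv_lt_0_compat; [apply Rmult_lt_0_compat|]; lra).
  assert (He2 : (e <= Cmod x / 8)%R) by (unfold e; nra).
  assert (key : forall y n, (Cmod (y - x) < e)%R -> (Cmod (y * q ^ S n - x) < e)%R -> False).
  { intros y n H1 H2.
    pose proof (Cmod_triangle_minus (y - x) (y * q ^ S n - x)) as T.
    replace (y - x - (y * q ^ S n - x)) with (y * (1 - q ^ S n)) in T by ring.
    rewrite Cmod_mult in T.
    assert (Hy : (Cmod x / 2 <= Cmod y)%R).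
    { pose proof (Cmod_rev_triangle x y) as T2. rewrite Cmod_minus_sym in T2. lra. }
    assert (Hn : (1 - Cmod q <= Cmod (1 - q ^ S n))%R).
    { pose proof (Cmod_rev_triangle 1 (q ^ S n)) as T2. rewrite Cmod_1, Cmod_pow in T2.
      assert (Cmod q ^ S n <= Cmod q)%R; [|lra].
      simpl. rewrite <- (Rmult_1_r (Cmod q)) at 3. apply Rmult_le_compat_l; [lra|].
      rewrite <- (pow1 n). apply pow_incr. lra. }
    assert (Cmod x / 2 * (1 - Cmod q) <= Cmod y * Cmod (1 - q ^ S n))%R.
    { apply Rmult_le_compat; lra. }
    unfold e in *. nra. }
  assert (uniq : forall y y', (Cmod (y - x) < e)%R -> (Cmod (y' - x) < e)%R ->
     spiral mu q y -> spiral mu q y' -> y = y').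
  { intros y y' H1 H2 [k ->] [k' ->].
    destruct (Z.lt_trichotomy k k') as [L|[->|L]]; auto; exfalso.
    - apply (key (mu * Cpowz q k) (Z.to_nat (k' - k - 1))); auto.
      rewrite <- Cmult_assoc, <- Cpowz_plus_nat by auto.
      replace (k + Z.of_nat (S (Z.to_nat (k' - k - 1))))%Z with k' by lia. exact H2.
    - apply (key (mu * Cpowz q k') (Z.to_nat (k - k' - 1))); auto.
      rewrite <- Cmult_assoc, <- Cpowz_plus_nat by auto.
      replace (k' + Z.of_nat (S (Z.to_nat (k - k' - 1))))%Z with k by lia. exact H1. }
  destruct (excluded_middle_informative
    (exists y0, y0 <> x /\ (Cmod (y0 - x) < e)%R /\ spiral mu q y0)) as [(y0 & N0 & D0 & S0)|N].
  - exists (Cmod (y0 - x)). split; [now apply Cmod_pos, Cminus_nz|].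
    intros y Hy Hd Sy. rewrite (uniq y y0) in Hd by (auto; lra). lra.
  - exists e. split; auto. intros y Hy Hd Sy. apply N. now exists y.
Qed.

Lemma ball_of_Cmod (x y : C) (e : R) : (Cmod (y - x) < e)%R ->
  ball (M := C_UniformSpace) x e y.
Proof. apply C_NormedModule_mixin_compat1. Qed.

Lemma Cmod_of_ball (x y : C) (e : posreal) : ball (M := C_UniformSpace) x e y ->
  (Cmod (y - x) < sqrt 2 * e)%R.
Proof. apply C_NormedModule_mixin_compat2. Qed.

Lemma filterlim_punctured (f : C -> C) (x l : C) :
  (forall e, (0 < e)%R -> punctured x (fun y => (Cmod (f y - l) < e)%R)) ->
  filterlim f (locally' (T := C_UniformSpace) x) (locally (T := C_UniformSpace) l).
Proof.
  intros H. apply (filterlim_locally (U := C_UniformSpace) f l). intros e.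
  destruct (H e (cond_pos e)) as (d & Hd & K).
  assert (Hs : (0 < sqrt 2)%R) by (apply sqrt_lt_R0; lra).
  assert (Hd' : (0 < d / sqrt 2)%R) by (apply Rdiv_lt_0_compat; lra).
  exists (mkposreal _ Hd'). intros y Hy Hyx. apply ball_of_Cmod. apply K; auto.
  apply Cmod_of_ball in Hy. simpl in Hy.
  replace (sqrt 2 * (d / sqrt 2))%R with d in Hy by (field; lra). exact Hy.
Qed.

(** It is enough to test a limit on sequences, for which dominated convergence is
    available. *)
Lemma punctured_of_sequences (f : C -> C) (x l : C) (Q : C -> Prop) :
  (forall ys, (forall n, Q (ys n)) -> Ccv ys x -> Ccv (fun n => f (ys n)) l) ->
  punctured x Q -> forall e, (0 < e)%R -> punctured x (fun y => (Cmod (f y - l) < e)%R).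
Proof.
  intros H (d & Hd & HQ) e He. apply NNPP. intros N.
  assert (B : forall n : nat, exists y, y <> x /\ (Cmod (y - x) < Rmin d (/ INR (S n)))%R /\
     (e <= Cmod (f y - l))%R).
  { intros n. apply NNPP. intros K. apply N. exists (Rmin d (/ INR (S n))). split.
    - apply Rmin_pos; auto. apply Rinv_0_lt_compat. apply lt_0_INR. lia.
    - intros y Hy Hyd. apply Rnot_le_lt. intros L. apply K. now exists y. }
  set (ys := fun n => proj1_sig (constructive_indefinite_description _ (B n))).
  assert (Hys : forall n, ys n <> x /\ (Cmod (ys n - x) < Rmin d (/ INR (S n)))%R /\
     (e <= Cmod (f (ys n) - l))%R).
  { intros n. unfold ys. apply proj2_sig. }
  destruct (H ys) with (eps := e) as [M HM]; auto.
  - intros n. destruct (Hys n) as (K1 & K2 & _). apply HQ; auto.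
    pose proof (Rmin_l d (/ INR (S n))). lra.
  - intros e' He'. destruct (archimed_cor1 e' He') as (M & HM & HM0). exists M. intros n Hn.
    destruct (Hys n) as (_ & K2 & _). pose proof (Rmin_r d (/ INR (S n))).
    assert (/ INR (S n) <= / INR M)%R; [|lra].
    apply Rinv_le_contravar; [now apply lt_0_INR|apply le_INR; lia].
  - specialize (HM M (le_n M)). destruct (Hys M) as (_ & _ & K3). lra.
Qed.

Lemma theta_product_nz (q a x : C) : (0 < Cmod q < 1)%R -> a <> 0 -> x <> 0 ->
  punctured x (fun y => theta q (a * y) <> 0).
Proof.
  intros H Ha Hx.
  assert (Hm : - (1) / a <> 0) by (apply Cdiv_nz; auto using Copp_nz, C1_nz).
  pose proof (punctured_and _ _ _ (punctured_nz x Hx) (punctured_spiral _ q x H Hm Hx)) as P.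
  revert P. apply punctured_impl. intros y [Hy Hs] E.
  apply theta_zero in E; auto using Cmult_neq_0. destruct E as [k E]. apply Hs. exists k.
  replace y with (a * y / a) by (field; auto). rewrite E. field. auto.
Qed.

Theorem theorem2 (q a1 a2 a3 b1 lam : C)
  (hq : (0 < Cmod q < 1)%R)
  (ha1 : a1 <> 0) (ha2 : a2 <> 0) (ha3 : a3 <> 0) (hb1 : b1 <> 0)
  (h12 : ~ spiral 1 q (a1 / a2)) (h21 : ~ spiral 1 q (a2 / a1))
  (h13 : ~ spiral 1 q (a1 / a3)) (h31 : ~ spiral 1 q (a3 / a1))
  (h23 : ~ spiral 1 q (a2 / a3)) (h32 : ~ spiral 1 q (a3 / a2))
  (hb1q : forall n : nat, b1 <> / q ^ n)
  (hlam : lam <> 0) (hlamq : ~ spiral (- (1)) q lam) :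
  let z := fun x : C => q * b1 / (a1 * a2 * a3 * x) in
  let v1 := fun x : C => theta q (a1 * x) / theta q x
    * phi [a1; a1 * q / b1; RtoC 0] [a1 * q / a2; a1 * q / a3] q (z x) in
  let v2 := fun x : C => theta q (a2 * x) / theta q x
    * phi [a2; a2 * q / b1; RtoC 0] [a2 * q / a1; a2 * q / a3] q (z x) in
  let v3 := fun x : C => theta q (a3 * x) / theta q x
    * phi [a3; a3 * q / b1; RtoC 0] [a3 * q / a2; a3 * q / a1] q (z x) in
  let rhs := fun x : C =>
    qpochs_inf [a2; a3; b1 / a1] q / qpochs_inf [b1; a2 / a1; a3 / a1] q
      * (theta q (a1 * lam) / theta q lam)
      * (theta q (a1 * q * x / lam) / theta q (q * x / lam))
      * (theta q x / theta q (a1 * x)) * v1 x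
    + qpochs_inf [a1; a3; b1 / a2] q / qpochs_inf [b1; a1 / a2; a3 / a2] q
      * (theta q (a2 * lam) / theta q lam)
      * (theta q (a2 * q * x / lam) / theta q (q * x / lam))
      * (theta q x / theta q (a2 * x)) * v2 x
    + qpochs_inf [a2; a1; b1 / a3] q / qpochs_inf [b1; a2 / a3; a1 / a3] q
      * (theta q (a3 * lam) / theta q lam)
      * (theta q (a3 * q * x / lam) / theta q (q * x / lam))
      * (theta q x / theta q (a3 * x)) * v3 x in
  forall x : C, x <> 0 -> ~ spiral (- lam) q x ->
    (* plain equality wherever every factor of the right-hand side is defined *)
    (theta q x <> 0 -> theta q (a1 * x) <> 0 -> theta q (a2 * x) <> 0 ->
     theta q (a3 * x) <> 0 -> ~ qpoles q (z x) ->
     f31 a1 a2 a3 b1 q lam x = rhs x) /\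
    (* at every x, the value obtained by removing singularities *)
    filterlim rhs (locally' (T := C_UniformSpace) x)
      (locally (T := C_UniformSpace) (f31 a1 a2 a3 b1 q lam x)).
Proof.
  intros z v1 v2 v3 rhs. pose proof (q_nz q hq) as Hq.
  assert (hbq : forall n, b1 * q ^ n <> 1).
  { intros n E. apply (hb1q n). assert (q ^ n <> 0) by now apply Cpow_nz.
    replace b1 with (b1 * q ^ n / q ^ n) by (field; auto). rewrite E. field. auto. }
  assert (Htl : theta q lam <> 0).
  { intros E. apply hlamq. now apply theta_zero. }
  assert (main : forall x : C, x <> 0 -> ~ spiral (- lam) q x ->
    theta q x <> 0 -> theta q (a1 * x) <> 0 -> theta q (a2 * x) <> 0 ->
    theta q (a3 * x) <> 0 -> ~ qpoles q (z x) -> f31 a1 a2 a3 b1 q lam x = rhs x).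
  { intros x Hx Hs T0 T1 T2 T3 Hz.
    assert (Hu : lam / x <> 0) by now apply Cdiv_nz.
    assert (Ez : kappa q a1 a2 a3 b1 lam * (lam / x) = z x) by (unfold kappa, z; field; auto).
    pose proof (theta_lam_over q lam hq hlam x Hx Hs) as Ht.
    rewrite f31_borellap by auto.
    pose proof (laplace_identity q a1 a2 a3 b1 lam hq ha1 ha2 ha3 hb1 h12 h21 h13 h31 h23 h32
      hbq hlam hlamq (lam / x) Hu) as L.
    rewrite Ez in L. specialize (L Hz).
    unfold sollap_sum, sollap, weight, conncoef, solphi in L. rewrite Ez in L.
    (* The theta factors of the theorem are those of [sollap], by reflection. *)
    assert (TI : forall a : C, a <> 0 -> theta q (lam / x / a) = theta q (a * q * x / lam)).
    { intros a Ha. replace (a * q * x / lam) with (q * (a * x / lam)) by (field; auto).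
      rewrite theta_inv by (auto using Cdiv_nz, Cmult_neq_0). f_equal. field. auto. }
    rewrite !TI in L by auto. pose proof (TI 1 C1_nz) as T'.
    replace (lam / x / 1) with (lam / x) in T' by (field; auto).
    replace (1 * q * x / lam) with (q * x / lam) in T' by (field; auto).
    rewrite T' in *.
    unfold rhs, v1, v2, v3, qpochs_inf. cbn [map Cprod fold_right]. rewrite !Cmult_1_r.
    (* The statement lists the lower parameters of the third series in the other order. *)
    assert (Sw : phi [a3; a3 * q / b1; RtoC 0] [a3 * q / a1; a3 * q / a2] q (z x)
      = phi [a3; a3 * q / b1; RtoC 0] [a3 * q / a2; a3 * q / a1] q (z x)).
    { assert (Ec : phi_coef [a3; a3 * q / b1; RtoC 0] [a3 * q / a1; a3 * q / a2] q
        = phi_coef [a3; a3 * q / b1; RtoC 0] [a3 * q / a2; a3 * q / a1] q).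
      { apply functional_extensionality. intros n.
        rewrite !phi_coef_solcoef. unfold solcoef. f_equal. ring. }
      unfold phi. now rewrite Ec. }
    rewrite Sw in L.
    assert (Nb : qpoch_inf b1 q <> 0) by (apply qpoch_inf_nz; auto; lra).
    assert (I : forall w, ~ spiral 1 q w -> qpoch_inf w q <> 0).
    { intros w Hw. apply qpoch_inf_nz; [lra|]. now apply spiral_qpow_neq. }
    pose proof (I _ h12). pose proof (I _ h21). pose proof (I _ h13). pose proof (I _ h31).
    pose proof (I _ h23). pose proof (I _ h32).
    set (G := borellap q a1 a2 a3 b1 lam (lam / x)) in *.
    transitivity (theta q lam * G / (theta q lam * theta q (q * x / lam))).
    - field. auto.
    - rewrite L. field. repeat split; auto. }
  intros x Hx Hs. split; [now apply main|].
  apply filterlim_punctured.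
  assert (Hml : - lam <> 0) by now apply Copp_nz.
  (* The poles [z y = q^(-n)] lie on the spiral of [mu]. *)
  set (mu := q * b1 / (a1 * a2 * a3)).
  assert (Hmu : mu <> 0) by (apply Cdiv_nz; auto using Cmult_neq_0).
  apply (punctured_of_sequences rhs x _ (fun y => y <> 0 /\ ~ spiral (- lam) q y /\
    theta q y <> 0 /\ theta q (a1 * y) <> 0 /\ theta q (a2 * y) <> 0 /\
    theta q (a3 * y) <> 0 /\ ~ qpoles q (z y))).
  - intros ys Hys Hc.
    apply Ccv_ext with (fun n => f31 a1 a2 a3 b1 q lam (ys n)).
    { intros n. destruct (Hys n) as (K1 & K2 & K3 & K4 & K5 & K6 & K7). now apply main. }
    apply Ccv_ext with (fun n => borellap q a1 a2 a3 b1 lam (lam / ys n) / theta q (lam / ys n)).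
    { intros n. destruct (Hys n) as (K1 & K2 & _). symmetry. now apply f31_borellap. }
    rewrite f31_borellap by auto.
    assert (Hcu : Ccv (fun n => lam / ys n) (lam / x)).
    { apply Ccv_scal. now apply Ccv_inv. }
    assert (Hun : forall n, lam / ys n <> 0).
    { intros n. destruct (Hys n) as (K1 & _). now apply Cdiv_nz. }
    apply Ccv_div.
    + now apply theta_lam_over.
    + apply laurent_seq_continuous; auto using Cdiv_nz. apply borelval_growth; auto.
    + rewrite theta_laurent.
      apply Ccv_ext with (fun n => laurent (fun _ => 1) q (lam / ys n)).
      { intros n. now rewrite theta_laurent. }
      apply laurent_seq_continuous; auto using Cdiv_nz, expgrowth_1.
  - assert (Tx : punctured x (fun y => theta q y <> 0)).
    { generalize (theta_product_nz q 1 x hq C1_nz Hx). apply punctured_impl.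
      intros y. now rewrite Cmult_1_l. }
    repeat apply punctured_and; auto using punctured_nz, punctured_spiral, theta_product_nz.
    generalize (punctured_and _ _ _ (punctured_nz x Hx) (punctured_spiral mu q x hq Hmu Hx)).
    apply punctured_impl. intros y [Hy Hsp] [n E]. apply Hsp. exists (Z.of_nat n).
    rewrite Cpowz_nat. assert (q ^ n <> 0) by now apply Cpow_nz.
    replace y with (mu / z y) by (unfold mu, z; field; repeat split; auto).
    rewrite E. field. auto.
Qed.
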